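(* We have $$N_{\mathbb{Z}}^{*,\dagger}(X)=\frac19X^{3/2}\log X+O(X^{3/2})\quad\text{as }X\to\infty.$$
   Context: A binary form is integral if its coefficients lie in $\mathbb{Z}$; an integral binary quadratic form is primitive if its coefficients are coprime. For a binary form $\xi$ and $T=\begin{pmatrix} t_1&t_2\\t_3&t_4\end{pmatrix}\in\mathrm{GL}_2(\mathbb{R})$, put $\xi_T(x,y)=\det(T)^{-\deg\xi/2}\xi(t_1x+t_2y,t_3x+t_4y)$; $[F]$ denotes the $\mathrm{GL}_2(\mathbb{Z})$-equivalence class of $F$ under this action. For $f=\alpha x^2+\beta xy+\gamma y^2$, put $\Delta(f)=\beta^2-4\alpha\gamma$ and $M_f=\begin{pmatrix}\beta&2\gamma\\-2\alpha&-\beta\end{pmatrix}$. For a binary quartic form $F=a_4x^4+a_3x^3y+a_2x^2y^2+a_1xy^3+a_0y^4$, put $I(F)=12a_4a_0-3a_3a_1+a_2^2$, $J(F)=72a_4a_2a_0+9a_3a_2a_1-27a_4a_1^2-27a_3^2a_0-2a_2^3$, $\Delta(F)=(4I(F)^3-J(F)^2)/27$, $\mathcal{Q}_F(x)=x^3-3I(F)x+J(F)$. $\mathrm{Gal}(F)$ is the Galois group of the splitting field of $F(x,1)$ over $\mathbb{Q}$. Let $V_{\mathbb{Z}}^{\mathrm{sm}}$ be the set of integral, irreducible (over $\mathbb{Q}$) binary quartic forms $F$ with $\mathrm{Gal}(F)$ isomorphic to $D_4$ (dihedral of order eight), $C_4$ or $V_4$. Let $V_{\mathbb{Z}}^{\mathrm{sm},*,\dagger}$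 be the set of $F\in V_{\mathbb{Z}}^{\mathrm{sm}}$ such that $\mathrm{Gal}(F)\not\simeq V_4$ and $F_T=F$ for some $T\in\mathrm{GL}_2(\mathbb{Z})\setminus\{\pm I_{2\times2}\}$. Height: for $F\in V_{\mathbb{Z}}^{\mathrm{sm}}$ with $\mathrm{Gal}(F)\not\simeq V_4$ there is, up to sign, a unique integral primitive binary quadratic form $f$ with $\Delta(f)\ne0$ and $F_{M_f}=F$. Put $F_4(x,y)=(3a_3^2-8a_4a_2)x^4+4(a_3a_2-6a_4a_1)x^3y+2(2a_2^2-24a_4a_0-3a_3a_1)x^2y^2+4(a_2a_1-6a_3a_0)xy^3+(3a_1^2-8a_2a_0)y^4$. There is a unique root $\omega_f(F)$ of $\mathcal{Q}_F$ such that $F_4+4\omega_f(F)F$ is a non-zero complex constant multiple of $f^2$. Let $\omega'_f(F),\omega''_f(F)$ be the other two roots, and set $L_f(F)=\omega_f(F)$, $K_f(F)=-\omega_f'(F)\omega_f''(F)$, $H(F)=H_f(F)=\max\{L_f(F)^2,|K_f(F)|\}$. For $X>0$, $N_{\mathbb{Z}}^{*,\dagger}(X)=\#\{[F]:F\in V_{\mathbb{Z}}^{\mathrm{sm},*,\dagger}\text{ such that }H(F)\leq X\}$. *)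

(* Defs.v *)
From HB Require Import structures.
From mathcomp Require Import all_boot all_order all_algebra.
From mathcomp Require Import all_fingroup all_solvable all_field.
From mathcomp Require Import boolp classical_sets functions cardinality reals.
From mathcomp Require Import finmap complex mpoly.

Set Implicit Arguments.
Unset Strict Implicit.
Unset Printing Implicit Defensive.

Import Order.TTheory GRing.Theory Num.Theory.
Local Open Scope ring_scope.

(* A binary form of degree d over R is an element of {mpoly R[2]} satisfying
   d.-homog; the variables are x = 'X_0 and y = 'X_1. *)

Definition mnm2 (i j : nat) : 'X_{1..2} := [multinom [tuple i; j]].

Definition quartic_form (R : comNzRingType) (b4 b3 b2 b1 b0 : R) : {mpoly R[2]} :=
  b4 *: 'X_[mnm2 4 0] + b3 *: 'X_[mnm2 3 1] + b2 *: 'X_[mnm2 2 2]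
  + b1 *: 'X_[mnm2 1 3] + b0 *: 'X_[mnm2 0 4].

Section Coefficients.
Variables (R : comNzRingType) (F : {mpoly R[2]}).
Definition a4 : R := F@_(mnm2 4 0).
Definition a3 : R := F@_(mnm2 3 1).
Definition a2 : R := F@_(mnm2 2 2).
Definition a1 : R := F@_(mnm2 1 3).
Definition a0 : R := F@_(mnm2 0 4).
Definition alpha : R := F@_(mnm2 2 0).
Definition beta  : R := F@_(mnm2 1 1).
Definition gamma : R := F@_(mnm2 0 2).
End Coefficients.

(* The action on quartic forms: the factor det(T)^(-deg/2) is det(T)^(-2).
   It is meaningful when \det T is a unit of R. *)
Definition quartic_act (R : comUnitRingType) (T : 'M[R]_2) (F : {mpoly R[2]}) :
    {mpoly R[2]} :=
  (\det T) ^- 2 *: (F \mPo [tuple \sum_(j < 2) T i j *: 'X_j | i < 2]).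

Definition GL2Z_class (F : {mpoly int[2]}) : set {mpoly int[2]} :=
  [set G | exists2 T : 'M[int]_2, T \in unitmx & G = quartic_act T F].

Definition Q_form (F : {mpoly int[2]}) : {mpoly rat[2]} :=
  map_mpoly (intr : int -> rat) F.

Definition irreducible_elt (A : unitRingType) (p : A) : Prop :=
  [/\ p != 0, p \isn't a GRing.unit
    & forall q r : A, p = q * r -> q \is a GRing.unit \/ r \is a GRing.unit].

(* F(x, 1) as a univariate polynomial over the rationals *)
Definition dehomogenize (F : {mpoly int[2]}) : {poly rat} :=
  mmap (fun c : int => (c%:~R)%:P) (fun i : 'I_2 => if i == 0 then 'X else 1) F.

(* The existential is harmless: splitting fields exist and are unique up to
   isomorphism. *)
Definition Gal_isog (F : {mpoly int[2]}) (gT : finGroupType) (G : {group gT}) :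
    Prop :=
  exists2 L : splittingFieldType rat,
    splittingFieldFor 1%VS (map_poly (in_alg L) (dehomogenize F)) {:L}
    & ('Gal({:L} / 1%AS) \isog G)%g.

(* 'Z_4 and 'Z_2 * 'Z_2 carry their additive group structures; 'D_8 has order 8. *)
Definition Gal_is_D4 F := Gal_isog F ([set: gsort 'D_8])%G.
Definition Gal_is_C4 F := Gal_isog F [set: 'Z_4]%G.
Definition Gal_is_V4 F := Gal_isog F [set: ('Z_2 * 'Z_2)%type]%G.

Definition V_sm (F : {mpoly int[2]}) : Prop :=
  [/\ F \is 4.-homog, irreducible_elt (Q_form F)
    & [\/ Gal_is_D4 F, Gal_is_C4 F | Gal_is_V4 F]].

Definition V_sm_star_dagger (F : {mpoly int[2]}) : Prop :=
  [/\ V_sm F, ~ Gal_is_V4 F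
    & exists T : 'M[int]_2,
        [/\ T \in unitmx, T != 1%:M, T != - 1%:M & quartic_act T F = F]].

Definition quadratic_disc (R : comNzRingType) (f : {mpoly R[2]}) : R :=
  beta f ^+ 2 - 4%:R * alpha f * gamma f.

Definition primitive_quadratic (f : {mpoly int[2]}) : Prop :=
  gcdz (gcdz (alpha f) (beta f)) (gamma f) = 1.

Definition M_quad (R : comNzRingType) (f : {mpoly R[2]}) : 'M[R]_2 :=
  \matrix_(i < 2, j < 2)
    if i == 0 then if j == 0 then beta f else 2%:R * gamma f
              else if j == 0 then - (2%:R * alpha f) else - beta f.

Section QuarticInvariants.
Variables (R : comNzRingType) (F : {mpoly R[2]}).
Let a4 := a4 F. Let a3 := a3 F. Let a2 := a2 F. Let a1 := a1 F. Let a0 := a0 F.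

Definition I_inv : R := 12%:R * a4 * a0 - 3%:R * a3 * a1 + a2 ^+ 2.

Definition J_inv : R :=
  72%:R * a4 * a2 * a0 + 9%:R * a3 * a2 * a1 - 27%:R * a4 * a1 ^+ 2
  - 27%:R * a3 ^+ 2 * a0 - 2%:R * a2 ^+ 3.

Definition cubic_resolvent : {poly R} :=
  'X^3 - (3%:R * I_inv) *: 'X + J_inv%:P.

Definition F4_covariant : {mpoly R[2]} :=
  quartic_form (3%:R * a3 ^+ 2 - 8%:R * a4 * a2)
               (4%:R * (a3 * a2 - 6%:R * a4 * a1))
               (2%:R * (2%:R * a2 ^+ 2 - 24%:R * a4 * a0 - 3%:R * a3 * a1))
               (4%:R * (a2 * a1 - 6%:R * a3 * a0))
               (3%:R * a1 ^+ 2 - 8%:R * a2 * a0).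
End QuarticInvariants.

Section Height.
Variable R : realType.

Definition C_form (F : {mpoly int[2]}) : {mpoly R[i][2]} :=
  map_mpoly (intr : int -> R[i]) F.

Definition fixing_quadratic (F f : {mpoly int[2]}) : Prop :=
  [/\ f \is 2.-homog, primitive_quadratic f, quadratic_disc f != 0
    & quartic_act (M_quad (Q_form f)) (Q_form F) = Q_form F].

Definition is_omega (F f : {mpoly int[2]}) (w : R[i]) : Prop :=
  root (cubic_resolvent (C_form F)) w /\
  exists2 c : R[i], c != 0 &
    F4_covariant (C_form F) + (4%:R * w) *: C_form F = c *: C_form f ^+ 2.

(* H(F) = h.  For F in V_sm with Galois group not V4 the form f is unique up to
   sign and w is unique, so h is determined by F. *)
Definition is_height (F : {mpoly int[2]}) (h : R) : Prop :=
  exists (f : {mpoly int[2]}) (w w' w'' : R[i]),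
    [/\ fixing_quadratic F f,
        is_omega F f w,
        cubic_resolvent (C_form F)
          = ('X - w%:P) * ('X - w'%:P) * ('X - w''%:P)
      & let L := w in
        let K := - (w' * w'') in
        h%:C%C = Num.max (L ^+ 2) `|K| ].

Definition counted_classes (X : R) : set (set {mpoly int[2]}) :=
  (GL2Z_class @` [set F | V_sm_star_dagger F /\
                          exists2 h : R, is_height F h & h <= X])%classic.

(* fset_set is empty on infinite sets, so an infinite set of classes would be
   counted as 0; a positive main term for N_count excludes this for large X. *)
Definition N_count (X : R) : nat := #|` fset_set (counted_classes X)|%fset.

End Height.

(* Main.v *)
Require Import Defs.
From HB Require Import structures.
From mathcomp Require Import all_boot all_order all_algebra reals ring lra zify.
Import Order.TTheory GRing.Theory Num.Theory.
Local Open Scope ring_scope.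

(* An element T of GL2(Z) other than +-I fixing an irreducible quartic form F has trace 0,
   so it is conjugate to diag(1, -1), to the exchange of the variables or to a rotation of
   order 4, and F is equivalent to A x^4 + B x^2 y^2 + C y^4 or to
   A x^4 + B x^3 y + C x^2 y^2 +- B x y^3 + A y^4.  For the first family put L = 2 B,
   m = A, n = 16 C, for the second one (with sign +) L = 6 A - C, m = F(1, 1),
   n = F(1, -1).  Then L is the distinguished root of the cubic resolvent and
   K = (9 m n - L^2) / 4, so H(F) <= X means L^2 <= X and |9 m n - L^2| <= 4 X.  Given m
   and L, n runs over a class modulo 16 in an interval of length 8 X / (9 |m|), and L
   over a class modulo 2 in [- sqrt X, sqrt X]; the harmonic sum over m <> 0 yields
   (1/9) X^(3/2) log X for each family.  Every class is obtained twice, by A <-> C in the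
   first family and by B <-> - B in the second, and the invariants I, J and the covariant
   F4 + 4 L F, a multiple of f^2, show that there are no further coincidences.
   A root x of F(x, 1), respectively (x + 1) / (x - 1), is a root of a biquadratic
   polynomial, so the Galois group is D4 or C4 unless m n or L^2 - m n is a square.  Those
   exceptions, the third family and the forms whose distinguished root is another
   one number O(X^(3/2)). *)

(** The counted classes are enclosed between two lists instead of being described exactly. The upper
    list keeps every triple (m, L, n) allowed by the height together with all exceptional ones, and
    may repeat a class. The lower list keeps the triples outside [sqr_cover]; for them the Galois
    group is computed and the classes are shown to be distinct. Both lists differ from the same
    lattice count by O(X^(3/2)). Why the trace is 0: when T is diagonalisable, an invariant quartic
    is a combination of monomials in two eigenforms u, v of T, and for nonzero trace u^2 v^2 is the
    only invariant monomial, so F would be proportional to a square. Why squares are set aside: the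
    other roots of the resolvent are (- L +- 3 sqrt (m n)) / 2. If m n is not a square, L is the
    only integral root, an equivalence has to preserve it, and F4 + 4 L F is carried along. That
    makes the equivalences between normal forms monomial matrices. *)

Module Ranges.
Set Implicit Arguments.
Unset Strict Implicit.
Unset Printing Implicit Defensive.

Section Ranges.
Variable R : realType.
Implicit Type X : R.

(* If L is a root of Q_F and 12 I(F) = 3 L^2 + 9 E, the two other roots are
   (- L +- 3 sqrt E) / 2, so that H(F) <= X reads [in_range X L E] when L is the
   distinguished root. *)
Definition in_range X (L E : int) : bool :=
  ((L ^+ 2)%:~R <= X) && (`|(9 * E - L ^+ 2)%:~R| <= 4 * X).

(* A consequence of H(F) <= X when E >= 0, whichever root is the distinguished one. *)
Definition small_range X (L E : int) : bool := (3 * L ^+ 2 + 9 * E)%:~R <= 8 * X.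
End Ranges.

End Ranges.

(** * The Galois group of a biquadratic polynomial with roots +- [th], +- [ph] *)

Module BiquadraticGalois.
From mathcomp Require Import all_fingroup all_solvable all_field.
Set Implicit Arguments.
Unset Strict Implicit.
Unset Printing Implicit Defensive.

Section BiquadraticGalois.

Variables (L : splittingFieldType rat) (th ph : L) (u v : rat).
Hypothesis sum_sq : th ^+ 2 + ph ^+ 2 = u%:A.
Hypothesis prod_sq : th ^+ 2 * ph ^+ 2 = v%:A.
Hypothesis gen : <<1 & [:: th; ph]>>%VS = {:L}%VS.
Hypothesis v_nsq : forall k : rat, v != k ^+ 2.
Hypothesis disc_nsq : forall k : rat, u ^+ 2 - 4 * v != k ^+ 2.

Let G := 'Gal({:L} / 1%AS)%G.
(** [s] and [t] are square roots of u^2 - 4 v and of v, hence irrational. The pair of signs with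
    which an automorphism acts on them is the invariant that drives the whole section. *)
Let s := th ^+ 2 - ph ^+ 2.
Let t := th * ph.

Lemma pchar0_split : [pchar L] =i pred0.
Proof. exact: ftrans (pchar_lalg L) (pchar_num _). Qed.

Lemma natr_neq0_split n : n.+1%:R != 0 :> L.
Proof. by have /pcharf0P-> := pchar0_split. Qed.

Lemma gal_alg (g : gal_of {:L}) (k : rat) : g k%:A = k%:A.
Proof. by rewrite linearZ rmorph1. Qed.

(** L is Galois over the rationals and x is irrational, so some automorphism moves x, and - x is the
    only other square root of k. *)
Lemma gal_neg_sqrt (x : L) (k : rat) : x ^+ 2 = k%:A -> (forall l : rat, k != l ^+ 2) ->
  exists2 g, g \in G & g x = - x.
Proof.
move=> xk knsq.
have galL : galois 1 {:L}.
  rewrite /galois sub1v normalFieldf andbT /=.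
  by apply/separableP=> y _; apply: pcharf0_separable; apply: pchar0_split.
have xn1 : x \notin fixedField G.
  have -> : fixedField G = 1%AS by apply/galois_fixedField.
  apply/negP=> /vlineP[l xl].
  case/negP: (knsq l); rewrite -subr_eq0 -(@fmorph_eq0 _ _ (in_alg L)) /= scalerBl.
  by rewrite -xk xl subr_eq0 exprZn expr1n.
have [g gG gx] : exists2 g, g \in G & g x != x.
  apply/exists_inP; apply: contraR xn1; rewrite negb_exists_in => /forall_inP h.
  by apply/fixedFieldP; rewrite ?memvf // => g /h; rewrite negbK => /eqP.
exists g => //; apply/eqP; have /eqP : g x ^+ 2 = x ^+ 2 by rewrite -rmorphXn /= xk gal_alg.
by rewrite eqf_sqr (negPf gx).
Qed.

Lemma gal_sqrt (x : L) (k : rat) (g : gal_of {:L}) : x ^+ 2 = k%:A -> (g x == x) || (g x == - x).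
Proof. by move=> xk; rewrite -eqf_sqr -rmorphXn /= xk gal_alg. Qed.

Lemma s_sq : s ^+ 2 = (u ^+ 2 - 4 * v)%:A.
Proof.
have -> : (u ^+ 2 - 4 * v)%:A = u%:A ^+ 2 - 4 * v%:A :> L.
  by rewrite -!/(in_alg L _) rmorphB rmorphXn rmorphM rmorph_nat.
by rewrite -sum_sq -prod_sq /s; ring.
Qed.

Lemma t_sq : t ^+ 2 = v%:A. Proof. by rewrite exprMn. Qed.

Lemma gal_ext (g h : gal_of {:L}) : g th = h th -> g ph = h ph -> g = h.
Proof.
move=> eth eph; apply/eqP; rewrite eq_mulgV1; apply/gal_eqP.
have sub : (<<1 & [:: th; ph]>> <= fixedField [set (g * h^-1)%g])%VS.
  apply/Fadjoin_seqP; split; first exact: sub1v.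
  move=> x; rewrite !inE => /orP[] /eqP ->; apply/fixedFieldP; rewrite ?memvf // => k /set1P ->;
    rewrite galM ?memvf // ?eth ?eph -galM ?memvf // mulgV gal_id //.
rewrite gen in sub => x _.
have [_ /(_ (g * h^-1)%g)] := mem_fixedFieldP (subvP sub x (memvf x)).
by rewrite inE eqxx gal_id => ->.
Qed.

Lemma s_neq0 : s != 0.
Proof.
apply/eqP=> s0; case/eqP: (disc_nsq 0); apply/eqP; rewrite expr0n /=.
by rewrite -(@fmorph_eq0 _ _ (in_alg L)) /= -s_sq s0 expr0n.
Qed.

Lemma t_neq0 : t != 0.
Proof.
apply/eqP=> t0; case/eqP: (v_nsq 0); apply/eqP; rewrite expr0n /=.
by rewrite -(@fmorph_eq0 _ _ (in_alg L)) /= -t_sq t0 expr0n.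
Qed.

Lemma oppr_neq (x : L) : x != 0 -> (- x == x) = false.
Proof.
move=> x0; apply/negbTE; rewrite -subr_eq0 -opprD oppr_eq0 -mulr2n -mulr_natl.
by rewrite mulf_neq0 // natr_neq0_split.
Qed.

Lemma th_neq0 : th != 0.
Proof. by have := t_neq0; rewrite mulf_eq0 negb_or => /andP[]. Qed.
Lemma ph_neq0 : ph != 0.
Proof. by have := t_neq0; rewrite mulf_eq0 negb_or => /andP[]. Qed.

Lemma sign_of (x y : L) : (x == y) || (x == - y) -> exists b : bool, x = (-1) ^+ b * y.
Proof.
by case/orP=> /eqP ->; [exists false; rewrite mul1r | exists true; rewrite mulN1r].
Qed.

(** Divide h t = h th * h ph by h th. It is used with (x, y) equal to (th, ph) or to (ph, th). *)
Lemma gal_second (h : gal_of {:L}) (b1 b2 : bool) (x y : L) : x != 0 -> x * y = t ->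
  h th = (-1) ^+ b1 * x -> h t = (-1) ^+ b2 * t -> h ph = (-1) ^+ (b1 (+) b2) * y.
Proof.
move=> x0 xy hth; rewrite rmorphM /= hth -xy => e; apply: (mulfI x0).
transitivity ((-1) ^+ b1 * ((-1) ^+ b1 * x * h ph)); first by rewrite -mulrA signrMK.
by rewrite e signr_addb; ring.
Qed.

Lemma two_th_sq : 2 * th ^+ 2 = u%:A + s. Proof. by rewrite -sum_sq /s; ring. Qed.
Lemma two_ph_sq : 2 * ph ^+ 2 = u%:A - s. Proof. by rewrite -sum_sq /s; ring. Qed.

Lemma gal_fix_s (h : gal_of {:L}) (b2 : bool) : h s = s -> h t = (-1) ^+ b2 * t ->
  exists b : bool, h th = (-1) ^+ b * th /\ h ph = (-1) ^+ (b (+) b2) * ph.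
Proof.
move=> hs ht; have [b hb] : exists b : bool, h th = (-1) ^+ b * th.
  apply: sign_of; rewrite -eqf_sqr -rmorphXn /=.
  apply/eqP/(mulfI (natr_neq0_split 1)); rewrite two_th_sq -hs -(gal_alg h u) -rmorphD.
  by rewrite -two_th_sq [RHS]rmorphM /= [h 2%:R]rmorph_nat.
by exists b; split=> //; apply: (gal_second th_neq0 _ hb ht).
Qed.

Lemma gal_neg_s (h : gal_of {:L}) (b2 : bool) : h s = - s -> h t = (-1) ^+ b2 * t ->
  exists b : bool, h th = (-1) ^+ b * ph /\ h ph = (-1) ^+ (b (+) b2) * th.
Proof.
move=> hs ht; have [b hb] : exists b : bool, h th = (-1) ^+ b * ph.
  apply: sign_of; rewrite -eqf_sqr -rmorphXn /=.
  apply/eqP/(mulfI (natr_neq0_split 1)); rewrite two_ph_sq -hs -(gal_alg h u) -rmorphD.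
  by rewrite -two_th_sq [RHS]rmorphM /= [h 2%:R]rmorph_nat.
by exists b; split=> //; apply: (gal_second ph_neq0 _ hb ht); rewrite mulrC.
Qed.

Lemma galMv (g h : gal_of {:L}) x : (g * h)%g x = h (g x).
Proof. by rewrite galM ?memvf. Qed.

(* Such an automorphism acts on {th, - th, ph, - ph} as a 4-cycle. *)
Definition rotation (g : gal_of {:L}) := g \in G /\ g s = - s /\ g t = - t.

(** Take one automorphism negating s and one negating t; if neither negates both, their product
    does. *)
Lemma rotation_ex : exists g, rotation g.
Proof.
have [g1 G1 s1] := gal_neg_sqrt s_sq disc_nsq.
have [g2 G2 t2] := gal_neg_sqrt t_sq v_nsq.
have [/eqP t1|/eqP t1] := orP (gal_sqrt g1 t_sq); last by exists g1.
have [/eqP s2|/eqP s2] := orP (gal_sqrt g2 s_sq); last by exists g2.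
by exists (g1 * g2)%g; split; [exact: groupM | rewrite !galMv s1 t1 rmorphN /= s2 t2].
Qed.

Lemma rotation_values g : rotation g ->
  (g th = ph /\ g ph = - th) \/ (g th = - ph /\ g ph = th).
Proof.
move=> [_ [gs gt]]; have [|[] [/= -> ->]] := @gal_neg_s g true gs; first by rewrite mulN1r.
  by right; rewrite mulN1r mul1r.
by left; rewrite mulN1r mul1r.
Qed.

Lemma rotation_sq g : rotation g -> (g ^+ 2)%g th = - th /\ (g ^+ 2)%g ph = - ph.
Proof.
by rewrite expgS expg1 !galMv => /rotation_values [] [e1 e2]; rewrite ?(e1, e2) ?rmorphN /= ?(e1, e2) ?opprK.
Qed.

Lemma rotation_order g : rotation g -> #[g]%g = 4.
Proof.
move=> rg; have [e1 e2] := rotation_sq rg.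
have g4 : (g ^+ 4 = 1)%g.
  have -> : (g ^+ 4 = g ^+ 2 * g ^+ 2)%g by rewrite -expgD.
  by apply: gal_ext; rewrite galMv gal_id ?e1 ?e2 rmorphN /= ?e1 ?e2 opprK.
have g2 : (g ^+ 2 != 1)%g.
  by apply/eqP=> g2; move/eqP: e1; rewrite g2 gal_id eq_sym oppr_neq ?th_neq0.
have : (#[g]%g %| 4)%N by rewrite order_dvdn g4.
have : ~~ (#[g]%g %| 2)%N by rewrite order_dvdn.
by case: #[g]%g => [|[|[|[|[|n]]]]] // _ /dvdn_leq.
Qed.

(** If h fixes s and t, it multiplies th and ph by a common sign, so it is 1 or g^2. If it negates
    both, the product of h and g falls under the first case. *)
Lemma rotation_cycle g h : rotation g -> h \in G ->
  (h s == s) = (h t == t) -> h \in <[g]>%g.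
Proof.
move=> rg hG st; have [e1 e2] := rotation_sq rg.
have fix_in (k : gal_of {:L}) : k s = s -> k t = t -> k \in <[g]>%g.
  move=> ks kt; have [|b [kth kph]] := @gal_fix_s k false ks; first by rewrite mul1r.
  rewrite addbF in kph; case: b kth kph => kth kph.
    suff -> : k = (g ^+ 2)%g by apply: mem_cycle.
    by apply: gal_ext; rewrite ?e1 ?e2 ?kth ?kph mulN1r.
  suff -> : k = 1%g by apply: group1.
  by apply: gal_ext; rewrite gal_id ?kth ?kph mul1r.
have [/eqP hs|hs] := orP (gal_sqrt h s_sq).
  by apply: fix_in => //; apply/eqP; rewrite -st hs.
have [/eqP ht|/eqP ht] := orP (gal_sqrt h t_sq).
  by move: st; rewrite (eqP hs) ht eqxx oppr_neq ?s_neq0.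
have [_ [gs gt]] := rg; rewrite -(groupMr h (cycle_id g)).
by apply: fix_in; rewrite galMv ?(eqP hs) ?ht rmorphN /= ?gs ?gt opprK.
Qed.

Lemma sign_agree (h : gal_of {:L}) :
  ((h s == s) = (h t == t)) \/ (h s == s) = ~~ (h t == t).
Proof. by case: (h s == s); case: (h t == t); [left|right|right|left]. Qed.

Lemma gal_s_cases (h : gal_of {:L}) : (h s == s) = false -> h s = - s.
Proof. by move=> hs; have := gal_sqrt h s_sq; rewrite hs => /eqP. Qed.

Lemma gal_t_cases (h : gal_of {:L}) : (h t == t) = false -> h t = - t.
Proof. by move=> hs; have := gal_sqrt h t_sq; rewrite hs => /eqP. Qed.

Lemma reflection_s (x : gal_of {:L}) : x s = - s -> x t = t -> #[x]%g = 2.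
Proof.
move=> xs xt; have [|b [e1 e2]] := @gal_neg_s x false xs; first by rewrite mul1r.
rewrite addbF in e2; apply: nt_prime_order => //.
  rewrite expgS expg1; apply: gal_ext; rewrite galMv gal_id ?e1 ?e2.
    by rewrite rmorphM rmorph_sign /= e2 signrMK.
  by rewrite rmorphM rmorph_sign /= e1 signrMK.
by apply/eqP=> x1; move/eqP: xs; rewrite x1 gal_id eq_sym oppr_neq ?s_neq0.
Qed.

Lemma reflection_t (x : gal_of {:L}) : x s = s -> x t = - t -> #[x]%g = 2.
Proof.
move=> xs xt; have [|b [e1 e2]] := @gal_fix_s x true xs; first by rewrite mulN1r.
apply: nt_prime_order => //.
  rewrite expgS expg1; apply: gal_ext; rewrite galMv gal_id ?e1 ?e2.
    by rewrite rmorphM rmorph_sign /= e1 signrMK.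
  by rewrite rmorphM rmorph_sign /= e2 signrMK.
by apply/eqP=> x1; move/eqP: xt; rewrite x1 gal_id eq_sym oppr_neq ?t_neq0.
Qed.

(** Here x y is a rotation, and each h in G lies in its cycle C or satisfies h x in C. Since x is
    outside C, the order of G is a multiple of 4 in ]4, 8]. Two involutions generate a dihedral
    group. *)
Lemma two_reflections_D8 (x y : gal_of {:L}) : x \in G -> y \in G ->
  x s = - s -> x t = t -> y s = s -> y t = - t -> G \isog [set: gsort 'D_8]%G.
Proof.
move=> xG yG xs xt ys yt.
have rg : rotation (x * y)%g.
  by split; [exact: groupM | rewrite !galMv xs xt rmorphN /= ys yt].
have cyc h : h \in G -> h \in <[x * y]>%g \/ (h * x)%g \in <[x * y]>%g.
  move=> hG; have [e|e] := sign_agree h; [left; exact: rotation_cycle rg hG e|right].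
  apply: rotation_cycle rg _ _; first exact: groupM.
  rewrite !galMv; case hs: (h s == s) e; case ht: (h t == t) => // _.
    by rewrite (eqP hs) (gal_t_cases ht) rmorphN /= xs xt !oppr_neq ?s_neq0 ?t_neq0.
  by rewrite (eqP ht) (gal_s_cases hs) rmorphN /= xs xt opprK !eqxx.
have xyG : (<[x * y]> \subset G)%g by rewrite cycle_subG groupM.
(* Powers of a rotation act on s and t by equal signs, while x does not. *)
have xnot : x \notin <[x * y]>%g.
  apply/negP=> /cycleP[i xE].
  suff : (x s == s) = (x t == t) by rewrite xs xt eqxx oppr_neq ?s_neq0.
  rewrite xE; elim: i {xE} => [|i IHi]; first by rewrite expg0 !gal_id !eqxx.
  have [_ [gs gt]] := rg.
  rewrite expgS !(@galMv (x * y)%g) gs gt !rmorphN /=.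
  case hs: (((x * y) ^+ i)%g s == s) IHi => /esym ht.
    by rewrite (eqP hs) (eqP ht) !oppr_neq ?s_neq0 ?t_neq0.
  by rewrite (gal_s_cases hs) (gal_t_cases ht) !opprK !eqxx.
have oxy : #|<[x * y]>%g| = 4 by rewrite -orderE rotation_order.
have oG : #|G| = 8.
  have le8 : (#|G| <= 8)%N.
    apply: (@leq_trans #|<[x * y]> :|: <[x * y]> :* x^-1|%g).
      apply: subset_leq_card; apply/subsetP=> h hG; rewrite inE mem_rcoset invgK.
      by apply/orP; apply: cyc.
    by rewrite (leq_trans (leq_card_setU _ _)) // card_rcoset oxy.
  have lt4 : (4 < #|G|)%N.
    have : (#|<[x * y]>%g| < #|G|)%N.
      by apply: proper_card; rewrite properE xyG /=; apply/subsetPn; exists x.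
    by rewrite oxy.
  have := cardSg xyG; rewrite oxy => /dvdnP[k kE]; move: le8 lt4; rewrite kE.
  by case: k {kE} => [|[|[|k]]] //; rewrite !mulSn; lia.
have Gxy : G :=: <<[set x; y]>>%g.
  apply/eqP; rewrite eqEsubset gen_subG; apply/andP; split; last first.
    by apply/subsetP=> h; rewrite !inE => /orP[] /eqP ->.
  have xin : x \in <<[set x; y]>>%g by rewrite mem_gen // !inE eqxx.
  have yin : y \in <<[set x; y]>>%g by rewrite mem_gen // !inE eqxx orbT.
  have sub : (<[x * y]> \subset <<[set x; y]>>)%g by rewrite cycle_subG groupM.
  apply/subsetP=> h /cyc[|] /(subsetP sub) //.
  by rewrite groupMr.
have xy : x != y.
  by apply/eqP=> xy; move/eqP: xs; rewrite xy ys eq_sym oppr_neq ?s_neq0.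
have := involutions_gen_dihedral (reflection_s xs xt) (reflection_t ys yt) xy.
by rewrite -Gxy oG.
Qed.

(** If every automorphism has equal signs on s and t, G is the cycle of a rotation g. Otherwise some
    h has different signs, and h and h g are the two reflections. *)
Lemma biquadratic_galois_group :
  G \isog [set: gsort 'D_8]%G \/ G \isog [set: 'Z_4]%G.
Proof.
have [g rg] := rotation_ex; have [gG [gs gt]] := rg.
have [/exists_inP[h hG hst]|noh] := boolP [exists h in G, (h s == s) != (h t == t)]; last first.
  right; have -> : G = <[g]>%G.
    apply/group_inj/eqP; rewrite eqEsubset /= cycle_subG gG andbT.
    apply/subsetP=> h hG; apply: (rotation_cycle rg hG).
    by move: noh; rewrite negb_exists_in => /forall_inP/(_ h hG); rewrite negbK => /eqP.
  rewrite isog_cyclic_card ?cycle_cyclic // cardsT card_ord -orderE rotation_order // eqxx andbT.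
  by apply/cyclicP; exists Zp1; apply: (Zp_cycle 3).
left; case hs: (h s == s) hst; case ht: (h t == t) => // _.
  apply: (@two_reflections_D8 (h * g)%g h); rewrite ?groupM ?galMv ?(eqP hs) ?(gal_t_cases ht) //.
  by rewrite rmorphN /= gt opprK.
apply: (@two_reflections_D8 h (h * g)%g); rewrite ?groupM ?galMv ?(eqP ht) ?(gal_s_cases hs) //.
by rewrite rmorphN /= gs opprK.
Qed.

(** A rotation runs through four distinct conjugates; this later forces irreducibility in degree
    4. *)
Lemma biquadratic_orbit : exists2 g, g \in G & uniq [:: th; g th; g (g th); g (g (g th))].
Proof.
have [g rg] := rotation_ex; have [gG _] := rg; exists g => //.
have [e1 e2] := rotation_sq rg; rewrite expgS expg1 !galMv in e1 e2.
have thNph (b : bool) : th != (-1) ^+ b * ph.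
  apply: contraNneq s_neq0 => e.
  by rewrite /s e exprMn sqrr_sign mul1r subrr.
have [Tph Tnph] := (thNph false, thNph true); rewrite mul1r in Tph; rewrite mulN1r in Tnph.
rewrite e1 rmorphN /=; have [[-> _]|[-> _]] := rotation_values rg;
  rewrite /= !inE !negb_or ?opprK ?eqr_opp ?[_ == - th]eq_sym ?[- th == th]oppr_neq ?th_neq0 //=;
  rewrite ?[ph == - th]eqr_oppLR ?[ph == - ph]eq_sym ?[- ph == ph]oppr_neq ?ph_neq0 //=.
by rewrite Tph Tnph eqr_oppLR Tnph.
by rewrite Tph Tnph eqr_oppLR Tnph [ph == th]eq_sym Tph.
Qed.

End BiquadraticGalois.

End BiquadraticGalois.

Module FixedQuartics.
From mathcomp Require Import all_fingroup all_solvable all_field.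
From mathcomp Require Import boolp classical_sets functions cardinality.
From mathcomp Require Import finmap complex mpoly.
Import BiquadraticGalois Ranges.
Set Implicit Arguments.
Unset Strict Implicit.
Unset Printing Implicit Defensive.

(** * Two by two matrices and binary quartic forms in coordinates *)

Definition mx2 (R : Type) (p q r s : R) : 'M[R]_2 :=
  \matrix_(i, j) if i == 0 then if j == 0 then p else q
                 else if j == 0 then r else s.

Lemma mx2_eta (R : Type) (T : 'M[R]_2) : T = mx2 (T 0 0) (T 0 1) (T 1 0) (T 1 1).
Proof.
apply/matrixP=> i j; rewrite mxE.
by have [->|/negPf ni] := eqVneq i 0; have [->|/negPf nj] := eqVneq j 0;
  congr (T _ _); apply/val_inj; [case: j nj => [[|[]]] | case: i ni => [[|[]]] |
  case: i ni => [[|[]]] | case: j nj => [[|[]]]].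
Qed.

Lemma det_mx2 (R : comNzRingType) (p q r s : R) : \det (mx2 p q r s) = p * s - q * r.
Proof.
rewrite (expand_det_row _ 0) !big_ord_recl big_ord0 addr0 /cofactor !det_mx11 !mxE /=.
by rewrite expr0 expr1 mul1r mulN1r mulrN.
Qed.

Lemma mnm2E0 i j : mnm2 i j 0 = i. Proof. by []. Qed.
Lemma mnm2E1 i j : mnm2 i j 1 = j. Proof. by []. Qed.

Lemma mnm2_eq i j k l : (mnm2 i j == mnm2 k l) = (i == k) && (j == l).
Proof.
apply/eqP/andP=> [/mnmP h|[/eqP-> /eqP->]//].
by have := h 0; have := h 1; rewrite !mnm2E0 !mnm2E1 => -> ->.
Qed.

Lemma ord2_ind (P : 'I_2 -> Prop) : P 0 -> P 1 -> forall i, P i.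
Proof.
move=> P0 P1 [[|[|//]] h]; [set i := Ordinal h; have -> : i = 0 by apply/val_inj |
  set i := Ordinal h; have -> : i = 1 by apply/val_inj]; by [].
Qed.

Lemma mnm2_eta (m : 'X_{1..2}) : m = mnm2 (m 0) (m 1).
Proof. by apply/mnmP; apply: ord2_ind. Qed.

Lemma mdeg_mnm2 i j : mdeg (mnm2 i j) = (i + j)%N.
Proof. by rewrite mdegE !big_ord_recl big_ord0 addn0. Qed.

Lemma mpolyX2 (R : comNzRingType) i j :
  'X_[mnm2 i j] = 'X_0 ^+ i * 'X_1 ^+ j :> {mpoly R[2]}.
Proof.
rewrite mpolyXE_id !big_ord_recl big_ord0 mulr1.
by congr (_ * 'X__ ^+ _); apply/val_inj.
Qed.

Section QuarticForm.
Variable R : comNzRingType.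
Implicit Types b c : R.

Lemma quartic_form_coef b4 b3 b2 b1 b0 m :
  (quartic_form b4 b3 b2 b1 b0)@_m =
    b4 *+ (m == mnm2 4 0) + b3 *+ (m == mnm2 3 1) + b2 *+ (m == mnm2 2 2)
    + b1 *+ (m == mnm2 1 3) + b0 *+ (m == mnm2 0 4).
Proof.
rewrite /quartic_form !mcoeffD !mcoeffZ !mcoeffX !(eq_sym _ m).
by rewrite !mulr_natr.
Qed.

Lemma a4_form b4 b3 b2 b1 b0 : a4 (quartic_form b4 b3 b2 b1 b0) = b4.
Proof. by rewrite /a4 quartic_form_coef !mnm2_eq /= !mulr0n !addr0. Qed.
Lemma a3_form b4 b3 b2 b1 b0 : a3 (quartic_form b4 b3 b2 b1 b0) = b3.
Proof. by rewrite /a3 quartic_form_coef !mnm2_eq /= !mulr0n !addr0 add0r. Qed.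
Lemma a2_form b4 b3 b2 b1 b0 : a2 (quartic_form b4 b3 b2 b1 b0) = b2.
Proof. by rewrite /a2 quartic_form_coef !mnm2_eq /= !mulr0n !addr0 !add0r. Qed.
Lemma a1_form b4 b3 b2 b1 b0 : a1 (quartic_form b4 b3 b2 b1 b0) = b1.
Proof. by rewrite /a1 quartic_form_coef !mnm2_eq /= !mulr0n !addr0 !add0r. Qed.
Lemma a0_form b4 b3 b2 b1 b0 : a0 (quartic_form b4 b3 b2 b1 b0) = b0.
Proof. by rewrite /a0 quartic_form_coef !mnm2_eq /= !mulr0n !add0r. Qed.

Definition form_coefs := (a4_form, a3_form, a2_form, a1_form, a0_form).

Lemma homog4_eta (F : {mpoly R[2]}) :
  F \is 4.-homog -> F = quartic_form (a4 F) (a3 F) (a2 F) (a1 F) (a0 F).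
Proof.
move=> hF; apply/mpolyP=> m; rewrite quartic_form_coef.
have [dm|dm] := eqVneq (mdeg m) 4; last first.
  rewrite (dhomog_nemf_coeff hF dm).
  have ne k : mdeg k = 4 -> (m == k) = false.
    by move=> dk; apply/eqP=> mk; rewrite mk dk eqxx in dm.
  by rewrite !ne ?mdeg_mnm2 //= !mulr0n !addr0.
move: dm; rewrite (mnm2_eta m) mdeg_mnm2.
case: (m 0) => [|[|[|[|[|k]]]]]; case: (m 1) => [|[|[|[|[|l]]]]] //= _;
  by rewrite ?mulr0n ?addr0 ?add0r.
Qed.

Lemma homog_quartic_form b4 b3 b2 b1 b0 : quartic_form b4 b3 b2 b1 b0 \is 4.-homog.
Proof. by rewrite !rpredD ?rpredZ // dhomogX; apply/eqP/mdeg_mnm2. Qed.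

Lemma homog2_eta (f : {mpoly R[2]}) : f \is 2.-homog ->
  f = alpha f *: 'X_[mnm2 2 0] + beta f *: 'X_[mnm2 1 1] + gamma f *: 'X_[mnm2 0 2].
Proof.
move=> hf; apply/mpolyP=> m; rewrite !mcoeffD !mcoeffZ !mcoeffX !(eq_sym _ m).
rewrite !mulr_natr.
have [dm|dm] := eqVneq (mdeg m) 2; last first.
  rewrite (dhomog_nemf_coeff hf dm).
  have ne k : mdeg k = 2 -> (m == k) = false.
    by move=> dk; apply/eqP=> mk; rewrite mk dk eqxx in dm.
  by rewrite !ne ?mdeg_mnm2 //= !mulr0n !addr0.
move: dm; rewrite (mnm2_eta m) mdeg_mnm2.
case: (m 0) => [|[|[|k]]]; case: (m 1) => [|[|[|l]]] //= _;
  by rewrite ?mulr0n ?addr0 ?add0r.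
Qed.

Lemma quartic_form_inj b4 b3 b2 b1 b0 c4 c3 c2 c1 c0 :
  quartic_form b4 b3 b2 b1 b0 = quartic_form c4 c3 c2 c1 c0 ->
  [/\ b4 = c4, b3 = c3, b2 = c2, b1 = c1 & b0 = c0].
Proof.
move=> e; split; [move/(congr1 (@a4 R)): e | move/(congr1 (@a3 R)): e
  | move/(congr1 (@a2 R)): e | move/(congr1 (@a1 R)): e | move/(congr1 (@a0 R)): e];
  by rewrite !form_coefs.
Qed.

Lemma quartic_formE b4 b3 b2 b1 b0 :
  quartic_form b4 b3 b2 b1 b0 =
  b4%:MP * 'X_0 ^+ 4 + b3%:MP * 'X_0 ^+ 3 * 'X_1 + b2%:MP * 'X_0 ^+ 2 * 'X_1 ^+ 2
  + b1%:MP * 'X_0 * 'X_1 ^+ 3 + b0%:MP * 'X_1 ^+ 4 :> {mpoly R[2]}.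
Proof.
by rewrite /quartic_form !mpolyX2 -!mul_mpolyC !expr0 !expr1 !mulr1 !mul1r !mulrA.
Qed.

Lemma add_quartic_form b4 b3 b2 b1 b0 c4 c3 c2 c1 c0 :
  quartic_form b4 b3 b2 b1 b0 + quartic_form c4 c3 c2 c1 c0 =
  quartic_form (b4 + c4) (b3 + c3) (b2 + c2) (b1 + c1) (b0 + c0).
Proof. by rewrite !quartic_formE !mpolyCD; ring. Qed.

Lemma scale_quartic_form c b4 b3 b2 b1 b0 : c *: quartic_form b4 b3 b2 b1 b0 =
  quartic_form (c * b4) (c * b3) (c * b2) (c * b1) (c * b0).
Proof. by rewrite -mul_mpolyC !quartic_formE !mpolyCM; ring. Qed.

Lemma sqr_quadratic_form b2 b1 b0 :
  (b2 *: 'X_[mnm2 2 0] + b1 *: 'X_[mnm2 1 1] + b0 *: 'X_[mnm2 0 2]) ^+ 2 =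
  quartic_form (b2 ^+ 2) (2 * b2 * b1) (b1 ^+ 2 + 2 * b2 * b0) (2 * b1 * b0) (b0 ^+ 2).
Proof.
rewrite !quartic_formE !mpolyX2 -!mul_mpolyC !(rmorphD, rmorphM, rmorphXn, rmorph_nat) /=.
ring.
Qed.

End QuarticForm.

(** * The action of matrices on coefficients, invariants and covariants *)

Section Substitution.
Variable R : comNzRingType.
Implicit Types b p q r s : R.

(** [sub4] to [sub0] are the coefficients, from x^4 down to y^4, of F(p x + q y, r x + s y). In
    particular [sub4 b4 b3 b2 b1 b0 x 0 y 0] is the value F(x, y), which is how forms are evaluated
    below. *)
Definition sub4 b4 b3 b2 b1 b0 p q r s : R :=
  b4 * p ^+ 4 + b3 * p ^+ 3 * r + b2 * p ^+ 2 * r ^+ 2 + b1 * p * r ^+ 3 + b0 * r ^+ 4.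
Definition sub3 b4 b3 b2 b1 b0 p q r s : R :=
  4 * b4 * p ^+ 3 * q + b3 * (p ^+ 3 * s + 3 * p ^+ 2 * q * r)
  + b2 * (2 * p ^+ 2 * r * s + 2 * p * q * r ^+ 2)
  + b1 * (3 * p * r ^+ 2 * s + q * r ^+ 3) + 4 * b0 * r ^+ 3 * s.
Definition sub2 b4 b3 b2 b1 b0 p q r s : R :=
  6 * b4 * p ^+ 2 * q ^+ 2 + b3 * (3 * p ^+ 2 * q * s + 3 * p * q ^+ 2 * r)
  + b2 * (p ^+ 2 * s ^+ 2 + 4 * p * q * r * s + q ^+ 2 * r ^+ 2)
  + b1 * (3 * p * r * s ^+ 2 + 3 * q * r ^+ 2 * s) + 6 * b0 * r ^+ 2 * s ^+ 2.
Definition sub1 b4 b3 b2 b1 b0 p q r s : R :=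
  4 * b4 * p * q ^+ 3 + b3 * (3 * p * q ^+ 2 * s + q ^+ 3 * r)
  + b2 * (2 * p * q * s ^+ 2 + 2 * q ^+ 2 * r * s)
  + b1 * (p * s ^+ 3 + 3 * q * r * s ^+ 2) + 4 * b0 * r * s ^+ 3.
Definition sub0 b4 b3 b2 b1 b0 p q r s : R :=
  b4 * q ^+ 4 + b3 * q ^+ 3 * s + b2 * q ^+ 2 * s ^+ 2 + b1 * q * s ^+ 3 + b0 * s ^+ 4.

Definition sub_form b4 b3 b2 b1 b0 p q r s :=
  quartic_form (sub4 b4 b3 b2 b1 b0 p q r s) (sub3 b4 b3 b2 b1 b0 p q r s)
    (sub2 b4 b3 b2 b1 b0 p q r s) (sub1 b4 b3 b2 b1 b0 p q r s)
    (sub0 b4 b3 b2 b1 b0 p q r s).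

Lemma comp_quartic_form b4 b3 b2 b1 b0 p q r s :
  quartic_form b4 b3 b2 b1 b0 \mPo [tuple \sum_(j < 2) mx2 p q r s i j *: 'X_j | i < 2] =
  sub_form b4 b3 b2 b1 b0 p q r s.
Proof.
rewrite [in LHS]quartic_formE !(rmorphD, rmorphM, rmorphXn) /= !comp_mpolyC !comp_mpolyXU.
rewrite -!tnth_nth !tnth_mktuple !big_ord_recl !big_ord0 !addr0 !mxE /=.
have -> : lift ord0 ord0 = 1 :> 'I_2 by apply/val_inj.
rewrite /sub_form /sub4 /sub3 /sub2 /sub1 /sub0 quartic_formE.
rewrite -!mul_mpolyC !rmorphD !rmorphM !rmorph_nat /=; ring.
Qed.

Lemma sub_sub b4 b3 b2 b1 b0 p q r s p' q' r' s' :
  sub_form (sub4 b4 b3 b2 b1 b0 p q r s) (sub3 b4 b3 b2 b1 b0 p q r s)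
    (sub2 b4 b3 b2 b1 b0 p q r s) (sub1 b4 b3 b2 b1 b0 p q r s)
    (sub0 b4 b3 b2 b1 b0 p q r s) p' q' r' s' =
  sub_form b4 b3 b2 b1 b0 (p * p' + q * r') (p * q' + q * s')
    (r * p' + s * r') (r * q' + s * s').
Proof.
congr quartic_form; rewrite /sub4 /sub3 /sub2 /sub1 /sub0; ring.
Qed.

Lemma I_inv_sub b4 b3 b2 b1 b0 p q r s :
  I_inv (sub_form b4 b3 b2 b1 b0 p q r s) =
  (p * s - q * r) ^+ 4 * I_inv (quartic_form b4 b3 b2 b1 b0).
Proof. by rewrite /I_inv !form_coefs /sub4 /sub3 /sub2 /sub1 /sub0; ring. Qed.

Lemma J_inv_sub b4 b3 b2 b1 b0 p q r s :
  J_inv (sub_form b4 b3 b2 b1 b0 p q r s) =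
  (p * s - q * r) ^+ 6 * J_inv (quartic_form b4 b3 b2 b1 b0).
Proof. by rewrite /J_inv !form_coefs /sub4 /sub3 /sub2 /sub1 /sub0; ring. Qed.

(** The coefficients of F4, which is - 1/3 times the Hessian determinant of F; hence the factor
    det^2 in its transformation rule. *)
Definition cov4 b4 b3 b2 b1 b0 : R := 3 * b3 ^+ 2 - 8 * b4 * b2.
Definition cov3 b4 b3 b2 b1 b0 : R := 4 * (b3 * b2 - 6 * b4 * b1).
Definition cov2 b4 b3 b2 b1 b0 : R := 2 * (2 * b2 ^+ 2 - 24 * b4 * b0 - 3 * b3 * b1).
Definition cov1 b4 b3 b2 b1 b0 : R := 4 * (b2 * b1 - 6 * b3 * b0).
Definition cov0 b4 b3 b2 b1 b0 : R := 3 * b1 ^+ 2 - 8 * b2 * b0.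

Lemma F4_covariant_form b4 b3 b2 b1 b0 :
  F4_covariant (quartic_form b4 b3 b2 b1 b0) =
  quartic_form (cov4 b4 b3 b2 b1 b0) (cov3 b4 b3 b2 b1 b0) (cov2 b4 b3 b2 b1 b0)
    (cov1 b4 b3 b2 b1 b0) (cov0 b4 b3 b2 b1 b0).
Proof. by rewrite /F4_covariant !form_coefs. Qed.

Lemma F4_covariant_sub b4 b3 b2 b1 b0 p q r s :
  F4_covariant (sub_form b4 b3 b2 b1 b0 p q r s) =
  (p * s - q * r) ^+ 2 *:
    sub_form (cov4 b4 b3 b2 b1 b0) (cov3 b4 b3 b2 b1 b0) (cov2 b4 b3 b2 b1 b0)
      (cov1 b4 b3 b2 b1 b0) (cov0 b4 b3 b2 b1 b0) p q r s.
Proof.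
rewrite F4_covariant_form scale_quartic_form.
congr quartic_form; rewrite /cov4 /cov3 /cov2 /cov1 /cov0 /sub4 /sub3 /sub2 /sub1 /sub0; ring.
Qed.

End Substitution.

Lemma map_quartic_form (R S : comNzRingType) (f : {rmorphism R -> S}) b4 b3 b2 b1 b0 :
  map_mpoly f (quartic_form b4 b3 b2 b1 b0) =
  quartic_form (f b4) (f b3) (f b2) (f b1) (f b0).
Proof.
rewrite !quartic_formE !(rmorphD, rmorphM, rmorphXn) /= !map_mpolyC.
by rewrite !map_mpolyX.
Qed.

Lemma quartic_act_mx2 (R : comUnitRingType) (b4 b3 b2 b1 b0 p q r s : R) :
  quartic_act (mx2 p q r s) (quartic_form b4 b3 b2 b1 b0) =
  (p * s - q * r) ^- 2 *: sub_form b4 b3 b2 b1 b0 p q r s.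
Proof. by rewrite /quartic_act det_mx2 comp_quartic_form. Qed.

Lemma unitmx_int (p q r s : int) :
  (mx2 p q r s \in unitmx) = ((p * s - q * r) ^+ 2 == 1).
Proof.
by rewrite unitmxE det_mx2 sqrf_eq1.
Qed.

Lemma quartic_act_int (b4 b3 b2 b1 b0 p q r s : int) : (p * s - q * r) ^+ 2 = 1 ->
  quartic_act (mx2 p q r s) (quartic_form b4 b3 b2 b1 b0) =
  sub_form b4 b3 b2 b1 b0 p q r s.
Proof. by move=> d1; rewrite quartic_act_mx2 d1 invr1 scale1r. Qed.

Lemma GL2Z_class_sub (b4 b3 b2 b1 b0 p q r s : int) : (p * s - q * r) ^+ 2 = 1 ->
  GL2Z_class (sub_form b4 b3 b2 b1 b0 p q r s) = GL2Z_class (quartic_form b4 b3 b2 b1 b0).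
Proof.
move=> d1; apply/seteqP; split=> G [T]; rewrite (mx2_eta T) unitmx_int => /eqP e ->.
- move: (T 0 0) (T 0 1) (T 1 0) (T 1 1) e => p' q' r' s' e.
  exists (mx2 (p * p' + q * r') (p * q' + q * s') (r * p' + s * r') (r * q' + s * s')).
    rewrite unitmx_int; apply/eqP; rewrite -[RHS]mulr1 -{1}d1 -e; ring.
  rewrite !quartic_act_int //; first by rewrite -sub_sub.
  by rewrite -[RHS]mulr1 -{1}d1 -e; ring.
- move: (T 0 0) (T 0 1) (T 1 0) (T 1 1) e => p' q' r' s' e.
  set d := p * s - q * r in d1.
  have dK x y : x = d ^+ 2 * y -> x = y by rewrite d1 mul1r.
  have e' : (d * (s * p' - q * r') * (d * (- r * q' + p * s'))
    - d * (s * q' - q * s') * (d * (- r * p' + p * r'))) ^+ 2 = 1.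
    transitivity (d ^+ 2 * (d ^+ 2 * (d ^+ 2 * (p' * s' - q' * r') ^+ 2))).
      by rewrite /d; ring.
    by rewrite d1 !mul1r.
  (* As d^2 = 1, the inverse of the first matrix is d times its adjugate; the witness is this
     inverse times T. *)
  exists (mx2 (d * (s * p' - q * r')) (d * (s * q' - q * s'))
     (d * (- r * p' + p * r')) (d * (- r * q' + p * s'))).
    by rewrite unitmx_int e'.
  have E1 : p * (d * (s * p' - q * r')) + q * (d * (- r * p' + p * r')) = p'.
    by apply: (dK); rewrite /d; ring.
  have E2 : p * (d * (s * q' - q * s')) + q * (d * (- r * q' + p * s')) = q'.
    by apply: (dK); rewrite /d; ring.
  have E3 : r * (d * (s * p' - q * r')) + s * (d * (- r * p' + p * r')) = r'.
    by apply: (dK); rewrite /d; ring.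
  have E4 : r * (d * (s * q' - q * s')) + s * (d * (- r * q' + p * s')) = s'.
    by apply: (dK); rewrite /d; ring.
  by rewrite !quartic_act_int // sub_sub E1 E2 E3 E4.
Qed.

(** * Consequences of irreducibility over the rationals *)

Lemma homog_nonunit d (f : {mpoly rat[2]}) : f \is d.+1.-homog -> f \isn't a GRing.unit.
Proof.
move=> hf; apply/negP=> /mulrV /(congr1 (mcoeff 0)).
rewrite rmorphM /= (dhomog_nemf_coeff hf) /= ?mdeg0 // mul0r mcoeff1 eqxx.
by move/esym/eqP; rewrite oner_eq0.
Qed.

Lemma irreducible_homogM d e (f g : {mpoly rat[2]}) :
  f \is d.+1.-homog -> g \is e.+1.-homog -> ~ irreducible_elt (f * g).
Proof.
by move=> hf hg [_ _ /(_ f g erefl)] [] u;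
  [have := homog_nonunit hf | have := homog_nonunit hg]; rewrite u.
Qed.

Lemma Q_form_form (b4 b3 b2 b1 b0 : int) : Q_form (quartic_form b4 b3 b2 b1 b0) =
  quartic_form b4%:~R b3%:~R b2%:~R b1%:~R b0%:~R.
Proof. exact: (map_quartic_form (intmul 1)). Qed.

Lemma homogX d i j : (i + j)%N = d -> 'X_[mnm2 i j] \is [in rat[2], d.-homog].
Proof. by move=> <-; rewrite dhomogX; apply/eqP/mdeg_mnm2. Qed.

(** A zero at (1, k) splits off y - k x; the cubic cofactor is given by Horner's scheme. *)
Lemma irreducible_at_slope (b4 b3 b2 b1 b0 k : rat) :
  irreducible_elt (quartic_form b4 b3 b2 b1 b0) ->
  b4 + b3 * k + b2 * k ^+ 2 + b1 * k ^+ 3 + b0 * k ^+ 4 != 0.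
Proof.
move=> irr; apply/eqP=> z.
have {z}b4E : b4 = - (b3 * k + b2 * k ^+ 2 + b1 * k ^+ 3 + b0 * k ^+ 4).
  by apply/eqP; rewrite -subr_eq0 -z; apply/eqP; ring.
have : quartic_form b4 b3 b2 b1 b0 =
  ('X_[mnm2 0 1] - k *: 'X_[mnm2 1 0]) *
  ((b3 + k * (b2 + k * (b1 + k * b0))) *: 'X_[mnm2 3 0]
   + (b2 + k * (b1 + k * b0)) *: 'X_[mnm2 2 1]
   + (b1 + k * b0) *: 'X_[mnm2 1 2] + b0 *: 'X_[mnm2 0 3]).
  rewrite b4E quartic_formE !mpolyX2 -!mul_mpolyC.
  rewrite !(rmorphN, rmorphD, rmorphM, rmorphXn) /=; ring.
move=> e; move: irr; rewrite e; apply: (@irreducible_homogM 0 2).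
  by rewrite rpredB ?rpredZ ?homogX.
by rewrite !rpredD ?rpredZ ?homogX.
Qed.

Lemma irreducible_b0 (b4 b3 b2 b1 b0 : rat) :
  irreducible_elt (quartic_form b4 b3 b2 b1 b0) -> b0 != 0.
Proof.
move=> irr; apply/eqP=> z.
have : quartic_form b4 b3 b2 b1 b0 =
  'X_[mnm2 1 0] * (b4 *: 'X_[mnm2 3 0] + b3 *: 'X_[mnm2 2 1]
   + b2 *: 'X_[mnm2 1 2] + b1 *: 'X_[mnm2 0 3]).
  rewrite z quartic_formE !mpolyX2 -!mul_mpolyC.
  rewrite !(rmorphN, rmorphD, rmorphM, rmorphXn, rmorph0) /=; ring.
move=> e; move: irr; rewrite e; apply: (@irreducible_homogM 0 2); first exact: homogX.
by rewrite !rpredD ?rpredZ ?homogX.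
Qed.

Lemma irreducible_nonzero (b4 b3 b2 b1 b0 u v : int) :
  irreducible_elt (Q_form (quartic_form b4 b3 b2 b1 b0)) -> (u != 0) || (v != 0) ->
  b4 * u ^+ 4 + b3 * u ^+ 3 * v + b2 * u ^+ 2 * v ^+ 2 + b1 * u * v ^+ 3 + b0 * v ^+ 4 != 0.
Proof.
rewrite Q_form_form => irr uv; rewrite -(intr_eq0 rat).
have [u0|u0] := eqVneq u 0.
  rewrite u0 in uv *; rewrite !expr0n /= !(mulr0, mul0r, add0r) rmorphM rmorphXn.
  by rewrite mulf_neq0 ?(irreducible_b0 irr) // expf_neq0 // intr_eq0.
have u0' : u%:~R != 0 :> rat by rewrite intr_eq0.
have := irreducible_at_slope (v%:~R / u%:~R) irr; apply: contraNneq => e.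
apply/eqP/(mulfI (expf_neq0 4 u0')); rewrite mulr0 -[RHS]e.
by rewrite !(rmorphD, rmorphM, rmorphXn) /=; field.
Qed.

Lemma irreducible_square (b4 b3 b2 b1 b0 k c g2 g1 g0 : int) : k != 0 ->
  quartic_form (k * b4) (k * b3) (k * b2) (k * b1) (k * b0) =
  c *: (g2 *: 'X_[mnm2 2 0] + g1 *: 'X_[mnm2 1 1] + g0 *: 'X_[mnm2 0 2]) ^+ 2 ->
  ~ irreducible_elt (Q_form (quartic_form b4 b3 b2 b1 b0)).
Proof.
move=> k0 /(congr1 Q_form); rewrite sqr_quadratic_form scale_quartic_form !Q_form_form => e.
set f := g2%:~R *: 'X_[mnm2 2 0] + g1%:~R *: 'X_[mnm2 1 1]
           + g0%:~R *: 'X_[mnm2 0 2] : {mpoly rat[2]}.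
have hf : f \is 2.-homog by rewrite !rpredD ?rpredZ ?homogX.
have k0' : k%:~R != 0 :> rat by rewrite intr_eq0.
have -> : quartic_form b4%:~R b3%:~R b2%:~R b1%:~R b0%:~R = f * ((k%:~R^-1 * c%:~R) *: f).
  have {}e : k%:~R *: quartic_form b4%:~R b3%:~R b2%:~R b1%:~R b0%:~R =
      c%:~R *: quartic_form (g2%:~R ^+ 2) (2 * g2%:~R * g1%:~R)
      (g1%:~R ^+ 2 + 2 * g2%:~R * g0%:~R) (2 * g1%:~R * g0%:~R) (g0%:~R ^+ 2) :> {mpoly rat[2]}.
    by rewrite !scale_quartic_form; move: e; rewrite !(rmorphD, rmorphM).
  by rewrite -scalerAr -expr2 sqr_quadratic_form -scalerA -e scalerA mulVf // scale1r.
by apply: (@irreducible_homogM 1 1); rewrite ?rpredZ.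
Qed.

(** * Integral matrices fixing an irreducible quartic form have trace zero *)

Lemma mulz_sqr_eq1 (x y : int) : x ^+ 2 * y ^+ 2 = 1 -> x ^+ 2 = 1.
Proof.
move=> xy; have := sqr_ge0 x; have := sqr_ge0 y; move: xy.
move: (x ^+ 2) (y ^+ 2) => u v uv v0 u0.
have v1 : v != 0 by apply/eqP=> z; move: uv; rewrite z mulr0.
have u1 : u != 0 by apply/eqP=> z; move: uv; rewrite z mul0r.
nia.
Qed.

(** Suppose t = p + s is nonzero. If r = 0, then T is +- a shear and changes the coefficient of x^3
    y by a multiple of b4 q. Otherwise invariance under the companion matrix gives g0 (x^2 + t x y +
    d y^2)^2 in the new basis, a square up to a constant, against irreducibility. *)
Lemma fixed_trace (b4 b3 b2 b1 b0 p q r s : int) : (p * s - q * r) ^+ 2 = 1 ->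
  irreducible_elt (Q_form (quartic_form b4 b3 b2 b1 b0)) ->
  sub_form b4 b3 b2 b1 b0 p q r s = quartic_form b4 b3 b2 b1 b0 ->
  [\/ q != 0, r != 0 | p != s] -> p + s = 0.
Proof.
move=> d1 irr inv nscal; apply/eqP/negP=> /negP; set t := p + s => t0.
have [r0|r0] := eqVneq r 0.
  have {inv} [_ inv _ _ _] := quartic_form_inj inv.
  rewrite r0 mulr0 subr0 exprMn in d1.
  have p2 := mulz_sqr_eq1 d1.
  have s2 : s ^+ 2 = 1 by move: d1; rewrite p2 mul1r.
  have ps : p = s.
    have : (p - s) * (p + s) == 0 by rewrite -subr_sqr p2 s2 subrr.
    by rewrite mulf_eq0 (negPf t0) orbF subr_eq0 => /eqP.
  have q0 : q != 0 by move: nscal; rewrite r0 ps !eqxx; case.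
  have := @irreducible_nonzero b4 b3 b2 b1 b0 1 0 irr isT.
  rewrite !expr0n !expr1n /= !mulr0 !addr0 mulr1 => b40.
  have : 4 * b4 * q * (p ^+ 2 * p) + b3 * (p ^+ 2 * p ^+ 2) = b3.
    by rewrite -[RHS]inv /sub3 r0 -ps; ring.
  rewrite p2 !mul1r mulr1 => /(canRL (addrK _)) /eqP.
  rewrite subrr !mulf_eq0 (negPf b40) (negPf q0) /= => /eqP p0.
  by move: p2; rewrite p0.
set d := p * s - q * r in d1.
pose g4 := sub4 b4 b3 b2 b1 b0 1 p 0 r. pose g3 := sub3 b4 b3 b2 b1 b0 1 p 0 r.
pose g2 := sub2 b4 b3 b2 b1 b0 1 p 0 r. pose g1 := sub1 b4 b3 b2 b1 b0 1 p 0 r.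
pose g0 := sub0 b4 b3 b2 b1 b0 1 p 0 r.
(* In the basis (e1, T e1) the invariance of F becomes invariance under the
   companion matrix of T. *)
have gC : sub_form g4 g3 g2 g1 g0 0 (- d) 1 t = quartic_form g4 g3 g2 g1 g0.
  have := sub_sub b4 b3 b2 b1 b0 p q r s 1 p 0 r.
  have [-> -> -> -> ->] := quartic_form_inj inv.
  rewrite -/(sub_form b4 b3 b2 b1 b0 1 p 0 r) => e.
  have := sub_sub b4 b3 b2 b1 b0 1 p 0 r 0 (- d) 1 t.
  rewrite -/g4 -/g3 -/g2 -/g1 -/g0 => ->.
  rewrite -[RHS]/(sub_form b4 b3 b2 b1 b0 1 p 0 r) e.
  by congr (quartic_form _ _ _ _ _); rewrite /sub4 /sub3 /sub2 /sub1 /sub0 /d /t; ring.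
have {gC} [e4 e3 e2 e1 _] := quartic_form_inj gC.
rewrite /sub4 /sub3 /sub2 /sub1 in e4 e3 e2 e1.
have {}e4 : g4 = g0 by rewrite -e4; ring.
have d3 : d ^+ 3 = d by rewrite exprS d1 mulr1.
(* The coefficient of x^2 y^2 in the invariance reads 3 t (2 t g0 - d g1) = 0, because d^2 = 1. *)
have g1E : g1 = 2 * t * d * g0.
  have : 3 * t * d * (2 * t * d * g0 - g1) = 3 * t * (2 * t * g0 * d ^+ 2 - d * g1) by ring.
  have -> : 3 * t * (2 * t * g0 * d ^+ 2 - d * g1) = 0.
    rewrite d1 mulr1 -[RHS](subrr g2) -[X in _ = X - _]e2.
    transitivity (3 * t * (2 * t * g0 - d * g1) + g2 * (d ^+ 2 - 1)).
      by rewrite d1 subrr mulr0 addr0.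
    ring.
  have d0 : d != 0 by apply/eqP=> z; move: d1; rewrite z.
  by move/eqP; rewrite !mulf_eq0 (negPf t0) (negPf d0) /= subr_eq0 => /eqP.
have g3E : g3 = 2 * t * g0.
  rewrite -e3 g1E.
  transitivity (4 * t * g0 - 2 * t * g0 * d ^+ 2); first by ring.
  by rewrite d1; ring.
have g2E : g2 = (t ^+ 2 + 2 * d) * g0.
  apply: (mulfI (_ : 2 * t != 0)); first by rewrite mulf_neq0.
  have : 2 * t * g2 * d ^+ 2 = g1 + d ^+ 3 * g3 + 3 * d * t ^+ 2 * g1 - 4 * t ^+ 3 * g0.
    rewrite -[X in _ = X + _ + _ - _]e1; ring.
  rewrite d1 d3 mulr1 g3E g1E => ->.
  transitivity (4 * t * d * g0 + 6 * t ^+ 3 * g0 * d ^+ 2 - 4 * t ^+ 3 * g0); first by ring.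
  by rewrite d1; ring.
(* Back in the old basis by the adjugate of (1, p; 0, r): x becomes r x - p y, y stays, and F is
   multiplied by r^4. These are the coefficients of the transformed x^2 + t x y + d y^2. *)
apply: (@irreducible_square b4 b3 b2 b1 b0 (r ^+ 4) g0 (r ^+ 2) (t * r - 2 * p * r)
  (p ^+ 2 - t * p + d)); last exact: irr.
  by rewrite expf_neq0.
have := sub_sub b4 b3 b2 b1 b0 1 p 0 r r (- p) 0 1.
have g0E : g0 = d ^+ 2 * g0 by rewrite d1 mul1r.
rewrite -/g4 -/g3 -/g2 -/g1 -/g0 e4 g3E g2E g1E [X in sub_form _ _ _ _ X]g0E sqr_quadratic_form scale_quartic_form => e.
transitivity (sub_form b4 b3 b2 b1 b0 (1 * r + p * 0) (1 * - p + p * 1) (0 * r + r * 0) (0 * - p + r * 1)).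
  by congr quartic_form; rewrite /sub4 /sub3 /sub2 /sub1 /sub0; ring.
rewrite -e; congr quartic_form; rewrite /sub4 /sub3 /sub2 /sub1 /sub0.
all: by ring.
Qed.

(** * Trace zero matrices of determinant +-1 up to integral conjugacy *)

Lemma mulmx_mx2 (R : comNzRingType) (p q r s p' q' r' s' : R) :
  mx2 p q r s *m mx2 p' q' r' s' =
  mx2 (p * p' + q * r') (p * q' + q * s') (r * p' + s * r') (r * q' + s * s').
Proof.
apply/matrixP=> i j; rewrite !mxE !big_ord_recl big_ord0 addr0 !mxE /=.
by case: (i == 0); case: (j == 0).
Qed.

Lemma mx2_inj (R : Type) (p q r s p' q' r' s' : R) :
  mx2 p q r s = mx2 p' q' r' s' -> [/\ p = p', q = q', r = r' & s = s'].
Proof.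
move=> /matrixP e; have := e 0 0; have := e 0 1; have := e 1 0; have := e 1 1.
by rewrite !mxE.
Qed.

Definition conj_GL2Z (T T' : 'M[int]_2) := exists2 S, S \in unitmx & T *m S = S *m T'.

Lemma conj_GL2Z_trans T2 T1 T3 : conj_GL2Z T1 T2 -> conj_GL2Z T2 T3 -> conj_GL2Z T1 T3.
Proof.
move=> [S uS eS] [S' uS' eS']; exists (S *m S'); first by rewrite unitmx_mul uS.
by rewrite mulmxA eS -(mulmxA S T2) eS' mulmxA.
Qed.

Lemma conj_shear_upper (p q r k : int) : conj_GL2Z (mx2 p q r (- p))
  (mx2 (p - k * r) (q + 2 * p * k - k ^+ 2 * r) r (- (p - k * r))).
Proof.
exists (mx2 1 k 0 1); first by rewrite unitmx_int; apply/eqP; ring.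
by rewrite !mulmx_mx2; congr mx2; ring.
Qed.

Lemma conj_shear_lower (p q r k : int) : conj_GL2Z (mx2 p q r (- p))
  (mx2 (p + k * q) q (r - 2 * p * k - k ^+ 2 * q) (- (p + k * q))).
Proof.
exists (mx2 1 0 k 1); first by rewrite unitmx_int; apply/eqP; ring.
by rewrite !mulmx_mx2; congr mx2; ring.
Qed.

(** In the second alternative b c = 1 is the exchange of variables up to sign, and b c = -1 a
    rotation of order 4. *)
Definition involution_form (T : 'M[int]_2) :=
  (exists2 a : int, a ^+ 2 = 1 & T = mx2 a 0 0 (- a)) \/
  (exists b c : int, [/\ b ^+ 2 = 1, c ^+ 2 = 1 & T = mx2 0 b c 0]).

Lemma conj_upper_involution (p q : int) : p ^+ 2 = 1 ->
  exists2 T, conj_GL2Z (mx2 p q 0 (- p)) T & involution_form T.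
Proof.
move=> p2; set k := (q %/ 2)%Z.
have := conj_shear_upper p q 0 (- p * k).
have -> : q + 2 * p * (- p * k) - (- p * k) ^+ 2 * 0 = (q %% 2)%Z.
  rewrite mulr0 subr0 {1}(divz_eq q 2) -/k.
  transitivity ((q %% 2)%Z + 2 * k * (1 - p ^+ 2)); first by ring.
  by rewrite p2 subrr mulr0 addr0.
rewrite mulr0 subr0 => cT.
have : 0 <= (q %% 2)%Z < 2 by rewrite modz_ge0 // ltz_pmod.
move: (q %% 2)%Z cT => m cT m2.
have {m2} [m0|m1] : m = 0 \/ m = 1 by lia.
  by rewrite m0 in cT; exists (mx2 p 0 0 (- p)) => //; left; exists p.
(* For odd q the matrix is conjugate to the exchange and not to a diagonal matrix. *)
exists (mx2 0 1 1 0); last by right; exists 1, 1.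
apply: conj_GL2Z_trans cT _; exists (mx2 0 1 1 (- p)); first by rewrite unitmx_int; apply/eqP; ring.
rewrite !mulmx_mx2 m1; congr mx2; try ring.
by transitivity (p ^+ 2); [ring | rewrite p2; ring].
Qed.

Lemma conj_lower_involution (p r : int) : p ^+ 2 = 1 ->
  exists2 T, conj_GL2Z (mx2 p 0 r (- p)) T & involution_form T.
Proof.
move=> p2; have [|T cT fT] := @conj_upper_involution (- p) r; first by rewrite sqrrN.
exists T => //; apply: conj_GL2Z_trans cT.
exists (mx2 0 1 1 0); first by rewrite unitmx_int; apply/eqP; ring.
by rewrite !mulmx_mx2; congr mx2; ring.
Qed.

(** Descent on |p|. A shear replaces p by p - k r or p + k q, which lowers |p| with k = +-1 as soon
    as 0 < |r| <= |p| or 0 < |q| <= |p|. If p <> 0 and both |q| and |r| exceed |p|, then |q r| >=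
    (|p| + 1)^2 > p^2 + 1, against p^2 + q r = +-1. *)
Lemma involution_normal_form (p q r : int) : (p ^+ 2 + q * r) ^+ 2 = 1 ->
  exists2 T, conj_GL2Z (mx2 p q r (- p)) T & involution_form T.
Proof.
have [n] := ubnP `|p|%N; elim: n => // n IHn in p q r *; rewrite ltnS => pn e1.
have shrink (p' q' r' : int) : (`|p'| < `|p|)%N -> p' ^+ 2 + q' * r' = p ^+ 2 + q * r ->
    conj_GL2Z (mx2 p q r (- p)) (mx2 p' q' r' (- p')) ->
    exists2 T, conj_GL2Z (mx2 p q r (- p)) T & involution_form T.
  move=> lt e cT; have [||T cT' fT] := IHn p' q' r'; first exact: leq_trans lt pn.
    by rewrite e.
  by exists T => //; apply: conj_GL2Z_trans cT cT'.
have [p0|p0] := eqVneq p 0.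
  rewrite p0 oppr0 expr0n add0r exprMn in e1 *.
  exists (mx2 0 q r 0); first by exists 1%:M; rewrite ?unitmx1 // mulmx1 mul1mx.
  right; exists q, r; split=> //; first exact: mulz_sqr_eq1 e1.
  by rewrite mulrC in e1; apply: mulz_sqr_eq1 e1.
have e : p ^+ 2 + q * r = 1 \/ p ^+ 2 + q * r = -1.
  by move/eqP: e1; rewrite sqrf_eq1 => /orP[] /eqP; [left|right].
have [r0|r0] := eqVneq r 0.
  by rewrite r0 in e *; apply: conj_upper_involution; case: e; nia.
have [q0|q0] := eqVneq q 0.
  by rewrite q0 in e *; apply: conj_lower_involution; case: e; nia.
have [rp|rp] := leqP `|r|%N `|p|%N.
  have [k k2 lt] : exists2 k : int, k ^+ 2 = 1 & (`|(p - k * r)%R| < `|p|)%N.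
    by have [s|s] := boolP ((0 < p) == (0 < r)); [exists 1|exists (-1)] => //; move: s; lia.
  apply: (shrink (p - k * r) (q + 2 * p * k - k ^+ 2 * r) r) => //; first by ring.
  exact: conj_shear_upper.
have [qp|qp] := leqP `|q|%N `|p|%N.
  have [k k2 lt] : exists2 k : int, k ^+ 2 = 1 & (`|(p + k * q)%R| < `|p|)%N.
    by have [s|s] := boolP ((0 < p) == (0 < q)); [exists (-1)|exists 1] => //; move: s; lia.
  apply: (shrink (p + k * q) q (r - 2 * p * k - k ^+ 2 * q)) => //; first by ring.
  exact: conj_shear_lower.
have : (`|p|.+1 * `|p|.+1 <= `|q| * `|r|)%N by apply: leq_mul.
rewrite -abszM; have : `|p ^+ 2|%N = (`|p| * `|p|)%N by rewrite -abszM.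
case: e; move: p0; clear; nia.
Qed.

(** If T S = S T0, then F composed with S is fixed by the normal form T0, and comparing coefficients
    gives the three shapes; the sign of b c separates the last two. *)
Lemma trace0_fixed_form (b4 b3 b2 b1 b0 p q r : int) : (p ^+ 2 + q * r) ^+ 2 = 1 ->
  sub_form b4 b3 b2 b1 b0 p q r (- p) = quartic_form b4 b3 b2 b1 b0 ->
  exists x y z w A B C : int, (x * w - y * z) ^+ 2 = 1 /\
    [\/ sub_form b4 b3 b2 b1 b0 x y z w = quartic_form A 0 B 0 C,
        sub_form b4 b3 b2 b1 b0 x y z w = quartic_form A B C B A |
        sub_form b4 b3 b2 b1 b0 x y z w = quartic_form A B C (- B) A].
Proof.
move=> /involution_normal_form [T0 [S]]; rewrite (mx2_eta S) unitmx_int.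
move: (S 0 0) (S 0 1) (S 1 0) (S 1 1) => x y z w /eqP uS eT fT inv.
have [p' [q' [r' [s' [eT0 fixT]]]]] : exists p' q' r' s', T0 = mx2 p' q' r' s' /\
    sub_form (sub4 b4 b3 b2 b1 b0 x y z w) (sub3 b4 b3 b2 b1 b0 x y z w)
      (sub2 b4 b3 b2 b1 b0 x y z w) (sub1 b4 b3 b2 b1 b0 x y z w)
      (sub0 b4 b3 b2 b1 b0 x y z w) p' q' r' s' = sub_form b4 b3 b2 b1 b0 x y z w.
  exists (T0 0 0), (T0 0 1), (T0 1 0), (T0 1 1); split; first exact: mx2_eta.
  move: eT; rewrite {1}(mx2_eta T0) !mulmx_mx2 sub_sub => eT'.
  have [<- <- <- <-] := mx2_inj eT'.
  rewrite -sub_sub; have [-> -> -> -> ->] := quartic_form_inj inv; by [].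
rewrite /sub_form in fixT; exists x, y, z, w.
move: fixT; rewrite -/(sub_form b4 b3 b2 b1 b0 x y z w).
rewrite {1}/sub_form.
set A4 := sub4 b4 _ _ _ _ _ _ _ _; set A3 := sub3 b4 _ _ _ _ _ _ _ _.
set A2 := sub2 b4 _ _ _ _ _ _ _ _; set A1 := sub1 b4 _ _ _ _ _ _ _ _.
set A0 := sub0 b4 _ _ _ _ _ _ _ _.
rewrite /sub4 /sub3 /sub2 /sub1 /sub0 => /quartic_form_inj [f4 f3 f2 f1 f0].
case: fT; rewrite eT0.
  case=> a a2 eT0'; have [pE qE rE sE] := mx2_inj eT0'; rewrite pE qE rE sE in f4 f3 f2 f1 f0.
  exists A4, A2, A0; split=> //; apply: Or31.
  have odd0 (u v : int) : - (u * a ^+ 2 * a ^+ 2) = u -> u = 0 by rewrite a2; lia.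
  have A30 : A3 = 0 by apply: odd0; rewrite // -[RHS]f3; ring.
  have A10 : A1 = 0 by apply: odd0; rewrite // -[RHS]f1; ring.
  by rewrite -[A3]/(sub3 _ _ _ _ _ _ _ _ _) in A30; rewrite /sub_form A30 -/A1 A10.
move=> [b [c [b2' c2 eT0']]]; have [pE qE rE sE] := mx2_inj eT0'; rewrite pE qE rE sE in f4 f3 f2 f1 f0.
exists A4, A3, A2; split=> //.
have A04 : A0 = A4.
  transitivity (A0 * c ^+ 2 * c ^+ 2); first by rewrite c2 !mulr1.
  by rewrite -[RHS]f4; ring.
have A13 : A1 * (b * c) = A3.
  transitivity (A1 * (b * c) * c ^+ 2); first by rewrite c2 mulr1.
  by rewrite -[RHS]f3; ring.
have /eqP : (b * c) ^+ 2 = 1 by rewrite exprMn b2' c2.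
rewrite sqrf_eq1 => /orP[] /eqP bc; rewrite bc in A13.
  by rewrite mulr1 in A13; apply: Or32; rewrite /sub_form -/A0 A04 -/A1 A13.
have nA3 : - A3 = A1 by rewrite -A13; ring.
by apply: Or33; rewrite /sub_form -/A0 A04 -/A1 nA3.
Qed.

(* The quartic forms fixed by diag(1, -1), by the exchange of the variables and by
   (x, y) |-> (y, -x). *)
Definition type1 (A B C : int) : {mpoly int[2]} := quartic_form A 0 B 0 C.
Definition type2 (A B C : int) : {mpoly int[2]} := quartic_form A B C B A.
Definition type3 (A B C : int) : {mpoly int[2]} := quartic_form A B C (- B) A.

Lemma class_type1_swap A B C : GL2Z_class (type1 C B A) = GL2Z_class (type1 A B C).
Proof.
rewrite -(@GL2Z_class_sub A 0 B 0 C 0 1 1 0); last by ring.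
by congr GL2Z_class; congr quartic_form; rewrite /sub4 /sub3 /sub2 /sub1 /sub0; ring.
Qed.

Lemma class_type2_opp A B C : GL2Z_class (type2 A (- B) C) = GL2Z_class (type2 A B C).
Proof.
rewrite -(@GL2Z_class_sub A B C B A 1 0 0 (-1)); last by ring.
by congr GL2Z_class; congr quartic_form; rewrite /sub4 /sub3 /sub2 /sub1 /sub0; ring.
Qed.

Lemma sub4_intr (R : comNzRingType) (b4 b3 b2 b1 b0 p q r s : int) :
  (sub4 b4 b3 b2 b1 b0 p q r s)%:~R =
  sub4 b4%:~R b3%:~R b2%:~R b1%:~R b0%:~R p%:~R q%:~R r%:~R s%:~R :> R.
Proof. by rewrite /sub4 !(rmorphD, rmorphM, rmorphXn). Qed.

Lemma square_of_multiple (u k l : int) : k != 0 -> u * k ^+ 2 = l ^+ 2 ->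
  exists j, u = j ^+ 2.
Proof.
move=> k0 e; have : (k ^+ 2 %| l ^+ 2)%Z by rewrite -e dvdz_mull.
rewrite dvdz_pexp2r // => /dvdzP[j lE]; exists j.
by apply: (mulIf (expf_neq0 2 k0)); rewrite e lE exprMn.
Qed.

Lemma square_of_ratio (u v k l : int) : k != 0 -> u * k ^+ 2 = v * l ^+ 2 ->
  exists j, u * v = j ^+ 2.
Proof.
move=> k0 e; apply: (@square_of_multiple _ k (v * l)) => //.
by rewrite mulrAC e; ring.
Qed.

(** * The cubic resolvent and the square covariant over an extension ring *)

Section GenericRing.
Variable K : comNzRingType.

Lemma depressed_cubic_roots (a b w w' w'' : K) :
  'X^3 - a *: 'X + b%:P = ('X - w%:P) * ('X - w'%:P) * ('X - w''%:P) ->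
  [/\ w + w' + w'' = 0, w * w' + w * w'' + w' * w'' = - a & w ^+ 3 - a * w + b = 0].
Proof.
move=> e.
have cub : 'X^3 - a *: 'X + b%:P = 'X^3 - (w + w' + w'') *: 'X^2
    + (w * w' + w * w'' + w' * w'') *: 'X - (w * w' * w'')%:P.
  rewrite e -!mul_polyC !(rmorphD, rmorphM) /=; ring.
split.
- have := congr1 (fun p : {poly K} => p`_2) cub; rewrite !coefE /=.
  by rewrite !mulr0 !mulr1 !subr0 !addr0 sub0r => /esym/eqP; rewrite oppr_eq0 => /eqP.
- have := congr1 (fun p : {poly K} => p`_1) cub; rewrite !coefE /=.
  by rewrite !mulr0 !mulr1 !subr0 !addr0 !sub0r add0r.
- have := congr1 (fun p : {poly K} => p.[w]) e.
  by rewrite !hornerE /= subrr !mul0r.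
Qed.

Variable b4 b3 b2 b1 b0 : int.
Let F := quartic_form b4 b3 b2 b1 b0.

Lemma map_intr_form : map_mpoly intr F =
  quartic_form b4%:~R b3%:~R b2%:~R b1%:~R b0%:~R :> {mpoly K[2]}.
Proof. exact: (map_quartic_form (intmul 1)). Qed.

Lemma I_inv_intr : I_inv (map_mpoly intr F : {mpoly K[2]}) = (I_inv F)%:~R.
Proof.
rewrite map_intr_form /I_inv !form_coefs.
by rewrite !(rmorphD, rmorphN, rmorphM, rmorphXn, rmorph_nat).
Qed.

Lemma J_inv_intr : J_inv (map_mpoly intr F : {mpoly K[2]}) = (J_inv F)%:~R.
Proof.
rewrite map_intr_form /J_inv !form_coefs.
by rewrite !rmorphB rmorphD !rmorphM !rmorph_nat.
Qed.

Lemma F4_covariant_intr : F4_covariant (map_mpoly intr F : {mpoly K[2]}) =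
  quartic_form (cov4 b4 b3 b2 b1 b0)%:~R (cov3 b4 b3 b2 b1 b0)%:~R
    (cov2 b4 b3 b2 b1 b0)%:~R (cov1 b4 b3 b2 b1 b0)%:~R (cov0 b4 b3 b2 b1 b0)%:~R.
Proof.
rewrite map_intr_form F4_covariant_form; congr quartic_form;
  by rewrite /cov4 /cov3 /cov2 /cov1 /cov0 !(rmorphD, rmorphN, rmorphM, rmorphXn, rmorph_nat).
Qed.

(** Passing from forms to values allows the identity F4 + 4 w F = c f^2 to be transported and tested
    at well chosen points. *)
Lemma square_covariant_values (f : {mpoly int[2]}) (w c : K) : f \is 2.-homog ->
  F4_covariant (map_mpoly intr F) + (4%:R * w) *: map_mpoly intr F =
    c *: (map_mpoly intr f) ^+ 2 ->
  forall x y : K, sub4 (cov4 b4 b3 b2 b1 b0)%:~R (cov3 b4 b3 b2 b1 b0)%:~R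
       (cov2 b4 b3 b2 b1 b0)%:~R (cov1 b4 b3 b2 b1 b0)%:~R (cov0 b4 b3 b2 b1 b0)%:~R x 0 y 0
       + 4 * w * sub4 b4%:~R b3%:~R b2%:~R b1%:~R b0%:~R x 0 y 0
  = c * ((alpha f)%:~R * x ^+ 2 + (beta f)%:~R * x * y + (gamma f)%:~R * y ^+ 2) ^+ 2.
Proof.
move=> hf; rewrite F4_covariant_intr map_intr_form scale_quartic_form add_quartic_form.
have -> : map_mpoly intr f = (alpha f)%:~R *: 'X_[mnm2 2 0]
    + (beta f)%:~R *: 'X_[mnm2 1 1] + (gamma f)%:~R *: 'X_[mnm2 0 2] :> {mpoly K[2]}.
  rewrite [in LHS](homog2_eta hf) !(rmorphD (map_mpoly intr)) /=.
  by rewrite !(map_mpolyZ (intmul 1)) !map_mpolyX.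
rewrite sqr_quadratic_form scale_quartic_form => /quartic_form_inj [e4 e3 e2 e1 e0] x y.
rewrite {1 2}/sub4.
have -> (c4 c3 c2 c1 c0 d4 d3 d2 d1 d0 z : K) :
  c4 * x ^+ 4 + c3 * x ^+ 3 * y + c2 * x ^+ 2 * y ^+ 2 + c1 * x * y ^+ 3 + c0 * y ^+ 4
  + z * (d4 * x ^+ 4 + d3 * x ^+ 3 * y + d2 * x ^+ 2 * y ^+ 2 + d1 * x * y ^+ 3 + d0 * y ^+ 4)
  = (c4 + z * d4) * x ^+ 4 + (c3 + z * d3) * x ^+ 3 * y + (c2 + z * d2) * x ^+ 2 * y ^+ 2
    + (c1 + z * d1) * x * y ^+ 3 + (c0 + z * d0) * y ^+ 4 by ring.
rewrite e4 e3 e2 e1 e0; ring.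
Qed.

End GenericRing.

(** * What a bound on the height says about an equivalent form *)

Section Height.
Variable R : realType.
Implicit Types (w c : R[i]) (X h : R).

Lemma height_data (b4 b3 b2 b1 b0 : int) h (F := quartic_form b4 b3 b2 b1 b0) :
  is_height F h ->
  exists w w' w'' c (f2 f1 f0 : int), [/\ c != 0,
     w + w' + w'' = 0, w * w' + w * w'' + w' * w'' = - (3 * (I_inv F)%:~R) &
     w ^+ 3 - 3 * (I_inv F)%:~R * w + (J_inv F)%:~R = 0] /\
     h%:C%C = Num.max (w ^+ 2) `|- (w' * w'')| /\
     forall x y : R[i], sub4 (cov4 b4 b3 b2 b1 b0)%:~R (cov3 b4 b3 b2 b1 b0)%:~R
       (cov2 b4 b3 b2 b1 b0)%:~R (cov1 b4 b3 b2 b1 b0)%:~R (cov0 b4 b3 b2 b1 b0)%:~R x 0 y 0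
       + 4 * w * sub4 b4%:~R b3%:~R b2%:~R b1%:~R b0%:~R x 0 y 0
       = c * (f2%:~R * x ^+ 2 + f1%:~R * x * y + f0%:~R * y ^+ 2) ^+ 2.
Proof.
move=> [f [w [w' [w'' [[hf _ _ _] [_ [c c0 ef]] cub hE]]]]].
exists w, w', w'', c, (alpha f), (beta f), (gamma f).
rewrite /cubic_resolvent I_inv_intr J_inv_intr in cub.
have [s1 s2 s3] := depressed_cubic_roots cub.
by split=> //; split=> //; apply: square_covariant_values ef.
Qed.
End Height.

Section HeightBounds.
Variable R : realType.
Implicit Types (w c : R[i]) (X h : R).

(** I, J and F4 are unchanged since det^2 = 1, so w and c remain valid for the transformed form; all
    that is retained of f is that its values are integers. *)
Lemma height_data_sub (b4 b3 b2 b1 b0 c4 c3 c2 c1 c0 p q r s : int) h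
    (F := quartic_form c4 c3 c2 c1 c0) : (p * s - q * r) ^+ 2 = 1 ->
  sub_form b4 b3 b2 b1 b0 p q r s = F ->
  is_height (quartic_form b4 b3 b2 b1 b0) h ->
  exists w w' w'' c, [/\ c != 0,
     w + w' + w'' = 0, w * w' + w * w'' + w' * w'' = - (3 * (I_inv F)%:~R) &
     w ^+ 3 - 3 * (I_inv F)%:~R * w + (J_inv F)%:~R = 0] /\
     h%:C%C = Num.max (w ^+ 2) `|- (w' * w'')| /\
     forall x y : int, exists k : int,
       (sub4 (cov4 c4 c3 c2 c1 c0) (cov3 c4 c3 c2 c1 c0) (cov2 c4 c3 c2 c1 c0)
         (cov1 c4 c3 c2 c1 c0) (cov0 c4 c3 c2 c1 c0) x 0 y 0)%:~R
       + 4 * w * (sub4 c4 c3 c2 c1 c0 x 0 y 0)%:~R = c * k%:~R ^+ 2.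
Proof.
move=> d1 eF /height_data[w [w' [w'' [c [f2 [f1 [f0 [[c_n0 s1 s2 s3] [hE val]]]]]]]]].
exists w, w', w'', c; rewrite -eF I_inv_sub J_inv_sub.
rewrite (exprM _ 2 2) (exprM _ 2 3) d1 !expr1n !mul1r.
split=> //; split=> // x y.
exists (f2 * (p * x + q * y) ^+ 2 + f1 * (p * x + q * y) * (r * x + s * y)
        + f0 * (r * x + s * y) ^+ 2).
have [e4 e3 e2 e1 e0] := quartic_form_inj eF.
have := F4_covariant_sub b4 b3 b2 b1 b0 p q r s.
rewrite d1 scale1r eF F4_covariant_form => /quartic_form_inj [-> -> -> -> ->].
rewrite -e4 -e3 -e2 -e1 -e0.
have subE := fun b4 b3 b2 b1 b0 : int => quartic_form_inj (sub_sub b4 b3 b2 b1 b0 p q r s x 0 y 0).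
have [-> _ _ _ _] := subE b4 b3 b2 b1 b0.
have [-> _ _ _ _] := subE (cov4 b4 b3 b2 b1 b0) (cov3 b4 b3 b2 b1 b0) (cov2 b4 b3 b2 b1 b0)
  (cov1 b4 b3 b2 b1 b0) (cov0 b4 b3 b2 b1 b0).
rewrite !sub4_intr; have := val (p * x + q * y)%:~R (r * x + s * y)%:~R.
rewrite /sub4 => ->; congr (_ * _ ^+ 2).
by rewrite !(rmorphD, rmorphM, rmorphXn).
Qed.

(** The order on [R[i]] is partial; a bound on [Num.max] bounds both arguments once they are
    comparable. Hence the distinguished root is shown to be real before its height is exploited. *)
Lemma le_real_max (x y z : R[i]) : x \is Num.real -> y \is Num.real ->
  Num.max x y <= z -> (x <= z) && (y <= z).
Proof. by move=> xR yR; rewrite comparable_ge_max // real_comparable. Qed.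

Lemma height_parts h X w w' w'' : w \is Num.real ->
  h%:C%C = Num.max (w ^+ 2) `|- (w' * w'')| -> h <= X ->
  w ^+ 2 <= X%:C%C /\ `|w' * w''| <= X%:C%C.
Proof.
move=> wR hE hX; apply/andP; rewrite -(normrN (w' * w'')).
by apply: le_real_max; rewrite ?realX ?normr_real // -hE lecR.
Qed.

Lemma intr_RC (n : int) : n%:~R = (n%:~R : R)%:C%C.
Proof. by rewrite rmorph_int. Qed.

(** With w = L the sum rules give K = 3 I - L^2, hence 4 K = 12 I - 4 L^2 = 9 E - L^2. *)
Lemma height_root (L E I : int) h X w w' w'' : w + w' + w'' = 0 ->
  w * w' + w * w'' + w' * w'' = - (3 * I%:~R) -> 12 * I = 3 * L ^+ 2 + 9 * E ->
  h%:C%C = Num.max (w ^+ 2) `|- (w' * w'')| -> h <= X -> w = L%:~R ->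
  (L ^+ 2)%:~R <= X /\ `|(9 * E - L ^+ 2)%:~R| <= 4 * X.
Proof.
move=> s1 s2 eI hE hX wL; have wR : w \is Num.real by rewrite wL realz.
have [w2 ww] := height_parts wR hE hX; split.
  by move: w2; rewrite wL -rmorphXn /= intr_RC lecR.
have -> : `|(9 * E - L ^+ 2)%:~R| = 4 * `|(3 * I - L ^+ 2)%:~R| :> R.
  have -> : 9 * E - L ^+ 2 = 4 * (3 * I - L ^+ 2) by lia.
  by rewrite rmorphM normrM ger0_norm.
rewrite ler_pM2l // -lecR (le_trans _ ww) //.
have -> : w' * w'' = - (3 * I - L ^+ 2)%:~R.
  have w'E : w'' = - w - w' by apply/eqP; rewrite -subr_eq0 -s1; apply/eqP; ring.
  rewrite rmorphB rmorphM rmorphXn /= -wL.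
  apply/eqP; rewrite -subr_eq0; apply/eqP.
  transitivity (w * w' + w * w'' + w' * w'' + 3 * I%:~R); last by rewrite s2 addNr.
  rewrite w'E; ring.
by rewrite normrN intr_RC normc_def /= expr0n addr0 sqrtr_sqr lexx.
Qed.

(** Since E >= 0, w is real. Then 12 I = 4 (w^2 - w' w''), and both terms are at most X in absolute
    value. *)
Lemma height_other (L E I : int) h X w w' w'' : w + w' + w'' = 0 ->
  w * w' + w * w'' + w' * w'' = - (3 * I%:~R) -> 12 * I = 3 * L ^+ 2 + 9 * E ->
  h%:C%C = Num.max (w ^+ 2) `|- (w' * w'')| -> h <= X ->
  (2 * w + L%:~R) ^+ 2 = (9 * E)%:~R -> 0 <= E ->
  (3 * L ^+ 2 + 9 * E)%:~R <= 8 * X.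
Proof.
move=> s1 s2 eI hE hX wE E0.
have wLR : 2 * w + L%:~R \is Num.real by rewrite realEsqr wE ler0z mulr_ge0.
have wR : w \is Num.real.
  have -> : w = 2^-1 * (2 * w + L%:~R - L%:~R) by rewrite addrK mulKf // pnatr_eq0.
  by rewrite realM ?realB ?realz // realV realn.
have [w2 ww] := height_parts wR hE hX.
have I3 : 3 * I%:~R = w ^+ 2 - w' * w''.
  have w'E : w'' = - w - w' by apply/eqP; rewrite -subr_eq0 -s1; apply/eqP; ring.
  by rewrite -[LHS]opprK -s2 w'E; ring.
rewrite -lecR -intr_RC -eI.
have -> : (12 * I)%:~R = 4 * (w ^+ 2 - w' * w'') by rewrite -I3 rmorphM mulrA -natrM.
have -> : (8 * X)%:C%C = 4 * (X%:C%C + X%:C%C).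
  by rewrite -rmorphD -[4](rmorph_nat (real_complex R)) -rmorphM /=; congr (_%:C)%C; ring.
rewrite ler_pM2l //; apply: le_trans (lerD w2 ww).
rewrite lerD2l; apply: le_trans (_ : `|- (w' * w'')| <= _); last by rewrite normrN.
apply: real_ler_norm; rewrite realN -[w' * w''](subKr (w ^+ 2)) -I3.
by rewrite realB ?realX // realM ?realn ?realz.
Qed.
End HeightBounds.

(** * Every counted class is a normal form in a bounded range *)

Section Cases.
Variable R : realType.
Implicit Types (X h : R).

(** Dividing the two equations shows that a / e is the square of a rational number. *)
Lemma linked_square (K : numFieldType) (a e k l : int) (t c : K) :
  c != 0 -> t != 0 -> a != 0 -> e != 0 ->
  4 * a%:~R * t = c * k%:~R ^+ 2 -> 4 * e%:~R * t = c * l%:~R ^+ 2 ->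
  exists j, a * e = j ^+ 2.
Proof.
move=> c0 t0 a0 e0 ak el.
have l0 : l != 0.
  apply/eqP=> l0; move/eqP: el; rewrite l0 expr0n mulr0 !mulf_eq0 (negPf t0).
  by rewrite intr_eq0 (negPf e0) pnatr_eq0.
apply: (@square_of_ratio a e l k) => //; apply/eqP; rewrite -(eqr_int K).
rewrite !(rmorphM, rmorphXn) /=; apply/eqP/(mulfI c0).
transitivity (a%:~R * (c * l%:~R ^+ 2)); first by ring.
rewrite -el; transitivity (e%:~R * (4 * a%:~R * t)); first by ring.
by rewrite ak; ring.
Qed.

(** Removing the factor w - L from the cubic leaves w^2 + L w + L^2 - 3 I = 0; complete the
    square. *)
Lemma depressed_cubic_other_root (K : numFieldType) (w : K) (L E I J : int) :
  12 * I = 3 * L ^+ 2 + 9 * E -> J = 3 * I * L - L ^+ 3 -> w != L%:~R ->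
  w ^+ 3 - 3 * I%:~R * w + J%:~R = 0 -> (2 * w + L%:~R) ^+ 2 = (9 * E)%:~R.
Proof.
move=> eI eJ wL; rewrite eJ => e; apply/(mulfI (_ : w - L%:~R != 0)); first by rewrite subr_eq0.
have -> : 9 * E = 12 * I - 3 * L ^+ 2 by rewrite eI; ring.
apply/eqP; rewrite -subr_eq0 -(mulr0 4) -e; apply/eqP.
by rewrite !(rmorphB, rmorphM, rmorphXn, rmorph_nat) /=; ring.
Qed.

Definition case_type1 X (A B C : int) :=
  [&& A != 0, C != 0, A <= C & in_range X (2 * B) (16 * (A * C))].

Definition case_type2 X (A B C : int) :=
  [&& 2 * A + 2 * B + C != 0, 2 * A - 2 * B + C != 0, 0 <= B &
    in_range X (6 * A - C) ((2 * A + 2 * B + C) * (2 * A - 2 * B + C))].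

(** This and [case_square2] collect the forms whose distinguished root differs from L. *)
Definition case_square1 X (A B C : int) :=
  [/\ A != 0, C != 0, (exists j, A * C = j ^+ 2) & small_range X (2 * B) (16 * (A * C))].

Definition case_square2 X (A B C : int) :=
  [/\ 2 * A + 2 * B + C != 0, 2 * A - 2 * B + C != 0,
    (exists j, (2 * A + 2 * B + C) * (2 * A - 2 * B + C) = j ^+ 2) &
    small_range X (6 * A - C) ((2 * A + 2 * B + C) * (2 * A - 2 * B + C))].

Definition case_type3 X (A B C : int) :=
  small_range X (- (6 * A + C)) ((2 * A - C) ^+ 2 + 4 * B ^+ 2).

Lemma in_small_range X L E : 0 <= E -> in_range X L E -> small_range X L E.
Proof.
rewrite /in_range /small_range => E0 /andP[l]; rewrite ler_norml => /andP[_ h].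
have -> : 3 * L ^+ 2 + 9 * E = (9 * E - L ^+ 2) + 4 * L ^+ 2 by ring.
rewrite rmorphD rmorphM /=; move: l h; lra.
Qed.

Lemma type1_invariants A B C : let F := type1 A B C in
  12 * I_inv F = 3 * (2 * B) ^+ 2 + 9 * (16 * (A * C)) /\
  J_inv F = 3 * I_inv F * (2 * B) - (2 * B) ^+ 3.
Proof. by rewrite /I_inv /J_inv !form_coefs; split; ring. Qed.

Lemma type2_invariants A B C : let F := type2 A B C in
  12 * I_inv F = 3 * (6 * A - C) ^+ 2
    + 9 * ((2 * A + 2 * B + C) * (2 * A - 2 * B + C)) /\
  J_inv F = 3 * I_inv F * (6 * A - C) - (6 * A - C) ^+ 3.
Proof. by rewrite /I_inv /J_inv !form_coefs; split; ring. Qed.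

Lemma type3_invariants A B C : let F := type3 A B C in
  12 * I_inv F = 3 * (- (6 * A + C)) ^+ 2 + 9 * ((2 * A - C) ^+ 2 + 4 * B ^+ 2) /\
  J_inv F = 3 * I_inv F * (- (6 * A + C)) - (- (6 * A + C)) ^+ 3.
Proof. by rewrite /I_inv /J_inv !form_coefs; split; ring. Qed.

Section Normalised.
Variables (b4 b3 b2 b1 b0 p q r s : int) (X h : R).
Hypothesis d1 : (p * s - q * r) ^+ 2 = 1.
Hypothesis hb : is_height (quartic_form b4 b3 b2 b1 b0) h.
Hypothesis hX : h <= X.
Hypothesis irr : irreducible_elt (Q_form (quartic_form b4 b3 b2 b1 b0)).

Lemma normalised_nonzero (c4 c3 c2 c1 c0 u v : int) :
  sub_form b4 b3 b2 b1 b0 p q r s = quartic_form c4 c3 c2 c1 c0 ->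
  (u != 0) || (v != 0) -> sub4 c4 c3 c2 c1 c0 u 0 v 0 != 0.
Proof.
move=> e uv; have [e4 e3 e2 e1 e0] := quartic_form_inj e.
have [] := quartic_form_inj (sub_sub b4 b3 b2 b1 b0 p q r s u 0 v 0).
rewrite e4 e3 e2 e1 e0 => -> _ _ _ _; apply: irreducible_nonzero => //.
rewrite -negb_and; apply: contraL uv => /andP[/eqP z1 /eqP z2].
have uE : (p * s - q * r) * u = s * (p * u + q * v) - q * (r * u + s * v) by ring.
have vE : (p * s - q * r) * v = p * (r * u + s * v) - r * (p * u + q * v) by ring.
have d0 : p * s - q * r != 0 by apply/eqP=> z; move: d1; rewrite z.
rewrite negb_or !negbK; rewrite z1 z2 !mulr0 subrr in uE vE.
by move/eqP: uE; move/eqP: vE; rewrite !mulf_eq0 (negPf d0) /= => -> ->.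
Qed.

(** F4 + 4 L F is a multiple of (x y)^2. At its zeros (1, 0) and (0, 1), where F takes the values A
    and C, F4 + 4 w F equals 4 (w - L) F; so if w <> L, both 4 (w - L) A and 4 (w - L) C are c times
    a square. *)
Lemma normalised_type1 A B C : sub_form b4 b3 b2 b1 b0 p q r s = type1 A B C ->
  (A != 0 /\ C != 0) /\ (in_range X (2 * B) (16 * (A * C)) \/ case_square1 X A B C).
Proof.
move=> e; have A0 := @normalised_nonzero _ _ _ _ _ 1 0 e isT.
have C0 := @normalised_nonzero _ _ _ _ _ 0 1 e isT.
have {}A0 : A != 0 by move: A0; rewrite /sub4 !expr0n expr1n /= !(mulr0, mul0r, addr0, mulr1).
have {}C0 : C != 0 by move: C0; rewrite /sub4 !expr0n expr1n /= !(mulr0, mul0r, addr0, add0r, mulr1).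
have [w [w' [w'' [c [[c0 s1 s2 s3] [hE val]]]]]] := height_data_sub d1 e hb.
have [eI eJ] := type1_invariants A B C; split=> //.
have [wL|wL] := eqVneq w (2 * B)%:~R.
  by left; apply/andP; apply: (height_root s1 s2 eI hE hX wL).
right; have wE := depressed_cubic_other_root eI eJ wL s3.
have [k1 v1] := val 1 0; have [k2 v2] := val 0 1.
have [j jE] : exists j, A * C = j ^+ 2.
  apply: (@linked_square _ A C k1 k2 (w - (2 * B)%:~R) c) => //; rewrite ?subr_eq0 // -?v1 -?v2.
    rewrite /sub4 /cov4 !expr0n expr1n /= !(mulr0, mul0r, addr0, mulr1, sub0r).
    by rewrite !(rmorphN, rmorphM, rmorph_nat) /=; ring.
  rewrite /sub4 /cov0 !expr0n expr1n /= !(mulr0, mul0r, addr0, add0r, mulr1, sub0r).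
  by rewrite !(rmorphN, rmorphM, rmorph_nat) /=; ring.
split=> //; first by exists j.
by apply: (height_other s1 s2 eI hE hX wE); rewrite jE mulr_ge0 // sqr_ge0.
Qed.

Lemma normalised_type2 A B C (m := 2 * A + 2 * B + C) (n := 2 * A - 2 * B + C) :
  sub_form b4 b3 b2 b1 b0 p q r s = type2 A B C ->
  (m != 0 /\ n != 0) /\ (in_range X (6 * A - C) (m * n) \/ case_square2 X A B C).
Proof.
move=> e; have m0 := @normalised_nonzero _ _ _ _ _ 1 1 e isT.
have n0 := @normalised_nonzero _ _ _ _ _ 1 (-1) e isT.
have mE : sub4 A B C B A 1 0 1 0 = m by rewrite /sub4 /m; ring.
have nE : sub4 A B C B A 1 0 (-1) 0 = n by rewrite /sub4 /n; ring.
rewrite mE in m0; rewrite nE in n0.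
have [w [w' [w'' [c [[c0 s1 s2 s3] [hE val]]]]]] := height_data_sub d1 e hb.
have [eI eJ] := type2_invariants A B C; split=> //.
have [wL|wL] := eqVneq w (6 * A - C)%:~R.
  by left; apply/andP; apply: (height_root s1 s2 eI hE hX wL).
right; have wE := depressed_cubic_other_root eI eJ wL s3.
(* For this family F4 + 4 L F is a multiple of (x^2 - y^2)^2, whose zeros are these two points. *)
have [k1 v1] := val 1 1; have [k2 v2] := val 1 (-1).
have [j jE] : exists j, m * n = j ^+ 2.
  apply: (@linked_square _ m n k1 k2 (w - (6 * A - C)%:~R) c) => //; rewrite ?subr_eq0 // -?v1 -?v2.
    rewrite mE; have -> : sub4 (cov4 A B C B A) (cov3 A B C B A) (cov2 A B C B A)
      (cov1 A B C B A) (cov0 A B C B A) 1 0 1 0 = - (4 * m * (6 * A - C)).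
      by rewrite /sub4 /cov4 /cov3 /cov2 /cov1 /cov0 /m; ring.
    by rewrite !(rmorphN, rmorphM, rmorph_nat) /=; ring.
  rewrite nE; have -> : sub4 (cov4 A B C B A) (cov3 A B C B A) (cov2 A B C B A)
    (cov1 A B C B A) (cov0 A B C B A) 1 0 (-1) 0 = - (4 * n * (6 * A - C)).
    by rewrite /sub4 /cov4 /cov3 /cov2 /cov1 /cov0 /n; ring.
  by rewrite !(rmorphN, rmorphM, rmorph_nat) /=; ring.
split=> //; first by exists j.
by apply: (height_other s1 s2 eI hE hX wE); rewrite jE sqr_ge0.
Qed.

(** Here E is a sum of squares, so the same inequality holds whichever root is distinguished. Its
    left side is the definite form 144 A^2 + 36 B^2 + 12 C^2, which leaves O(X^(3/2)) triples. *)
Lemma normalised_type3 A B C : sub_form b4 b3 b2 b1 b0 p q r s = type3 A B C ->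
  case_type3 X A B C.
Proof.
move=> e; have [w [w' [w'' [c [[c0 s1 s2 s3] [hE _]]]]]] := height_data_sub d1 e hb.
have [eI eJ] := type3_invariants A B C.
have E0 : 0 <= (2 * A - C) ^+ 2 + 4 * B ^+ 2 by rewrite addr_ge0 ?sqr_ge0 // mulr_ge0 ?sqr_ge0.
have [wL|wL] := eqVneq w (- (6 * A + C))%:~R.
  by apply: in_small_range => //; apply/andP; apply: (height_root s1 s2 eI hE hX wL).
by apply: (height_other s1 s2 eI hE hX (depressed_cubic_other_root eI eJ wL s3)).
Qed.

End Normalised.

Lemma counted_class_cases X G : counted_classes X G ->
  exists A B C : int,
    ((case_type1 X A B C \/ case_square1 X A B C) /\ G = GL2Z_class (type1 A B C)) \/
    ((case_type2 X A B C \/ case_square2 X A B C) /\ G = GL2Z_class (type2 A B C)) \/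
    (case_type3 X A B C /\ G = GL2Z_class (type3 A B C)).
Proof.
move=> [F [[[hF irr _] _ [T [uT T1 TN1 fT]]] [h hh hX]] <-].
rewrite (homog4_eta hF) in irr fT hh *.
move: (a4 F) (a3 F) (a2 F) (a1 F) (a0 F) irr fT hh => b4 b3 b2 b1 b0 irr fT hh.
rewrite (mx2_eta T) in uT T1 TN1 fT.
move: (T 0 0) (T 0 1) (T 1 0) (T 1 1) uT T1 TN1 fT => p q r s.
rewrite unitmx_int => /eqP d1 T1 TN1; rewrite quartic_act_int // => fT.
(* A scalar T would have p^2 = 1, that is, T = +-I. *)
have nscal : [\/ q != 0, r != 0 | p != s].
  have [q0|] := eqVneq q 0; last by move=> *; apply: Or31.
  have [r0|] := eqVneq r 0; last by move=> *; apply: Or32.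
  have [ps|] := eqVneq p s; last by move=> *; apply: Or33.
  have mx2_scalar (a : int) : mx2 a 0 0 a = a%:M.
    apply/matrixP=> i j; rewrite !mxE; move: i j.
    by apply: ord2_ind; apply: ord2_ind.
  have : p ^+ 2 = 1 by apply: (@mulz_sqr_eq1 p p); rewrite -d1 q0 r0 -ps; ring.
  move/eqP; rewrite sqrf_eq1 q0 r0 -ps !mx2_scalar in T1 TN1 *.
  by case/orP=> /eqP pE; move: T1 TN1; rewrite pE ?scalemx1 ?raddfN eqxx.
have tr := fixed_trace d1 irr fT nscal.
have sE : s = - p by apply/eqP; rewrite -addr_eq0 addrC tr.
rewrite sE in d1 fT.
have pqr : (p ^+ 2 + q * r) ^+ 2 = 1 by rewrite -d1; ring.
have [x [y [z [w [A [B [C [u1 [e|e|e]]]]]]]]] := trace0_fixed_form pqr fT;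
  rewrite -(GL2Z_class_sub _ _ _ _ _ u1) e.
- have [[A0 C0] [rg|sq]] := normalised_type1 u1 hh hX irr e; last first.
    by exists A, B, C; left; split; [right|].
  have [AC|CA] := lerP A C.
    by exists A, B, C; left; split; [left; rewrite /case_type1 A0 C0 AC|].
  exists C, B, A; left; split; last by rewrite class_type1_swap.
  by left; rewrite /case_type1 A0 C0 (ltW CA) [C * A]mulrC.
- have [[m0 n0] [rg|sq]] := normalised_type2 u1 hh hX irr e; last first.
    by exists A, B, C; right; left; split; [right|].
  have [B0|B0] := lerP 0 B.
    by exists A, B, C; right; left; split; [left; rewrite /case_type2 m0 n0 B0|].
  exists A, (- B), C; right; left; split; last by rewrite class_type2_opp.
  left; rewrite /case_type2 oppr_ge0 (ltW B0).
  have -> : 2 * A + 2 * - B + C = 2 * A - 2 * B + C by ring.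
  have -> : 2 * A - 2 * - B + C = 2 * A + 2 * B + C by ring.
  by rewrite m0 n0 [(_ - 2 * B + C) * _]mulrC.
- exists A, B, C; right; right; split=> //; exact: (normalised_type3 u1 hh hX (e : _ = type3 A B C)).
Qed.
End Cases.

(** * Forms that are irreducible with Galois group D4 or C4 *)

Definition poly5 (b4 b3 b2 b1 b0 : rat) : {poly rat} :=
  b4 *: 'X^4 + b3 *: 'X^3 + b2 *: 'X^2 + b1 *: 'X + b0%:P.

Lemma dehomogenize_form (b4 b3 b2 b1 b0 : int) :
  dehomogenize (quartic_form b4 b3 b2 b1 b0) = poly5 b4%:~R b3%:~R b2%:~R b1%:~R b0%:~R.
Proof.
rewrite /dehomogenize; set h := (fun i : 'I_2 => _).
rewrite -[LHS]/(mmap ((polyC \o intmul 1) : {rmorphism int -> {poly rat}}) h _).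
rewrite /quartic_form !mmapD !mmapZ !mmapX /mmap1 !big_ord_recl !big_ord0 /h /=.
by rewrite !expr1n !mulr1 !mul_polyC.
Qed.

Lemma size_poly5 (b4 b3 b2 b1 b0 : rat) : b4 != 0 -> size (poly5 b4 b3 b2 b1 b0) = 5%N.
Proof.
move=> b0n; have -> : poly5 b4 b3 b2 b1 b0 = Poly [:: b0; b1; b2; b3; b4].
  by apply/polyP=> i; rewrite coef_Poly !coefE; case: i => [|[|[|[|[|i]]]]] /=;
    rewrite ?nth_nil; ring.
by rewrite (PolyK (c := 0)).
Qed.

(** A rational factor vanishing at x vanishes at its four conjugates, so it already has degree at
    least 4. *)
Lemma irreducible_poly_orbit (L : splittingFieldType rat) (p : {poly rat}) (x : L)
    (g : gal_of {:L}) : size p = 5%N -> root (map_poly (in_alg L) p) x ->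
  uniq [:: x; g x; g (g x); g (g (g x))] -> irreducible_poly p.
Proof.
move=> sp px ux.
have big (q : {poly rat}) : q != 0 -> root (map_poly (in_alg L) q) x -> (4 < size q)%N.
  move=> q0 qx; rewrite -(size_map_poly (in_alg L)).
  have rg y : root (map_poly (in_alg L) q) y -> root (map_poly (in_alg L) q) (g y).
    move=> /rootP qy; apply/rootP; rewrite -[RHS](rmorph0 g) -qy.
    rewrite -horner_map -map_poly_comp; congr _.[_]; apply: eq_map_poly => c /=.
    by rewrite linearZ rmorph1.
  apply: (@max_poly_roots _ _ [:: x; g x; g (g x); g (g (g x))]) => //.
    by rewrite map_poly_eq0.
  by rewrite /= qx !rg.
suff irr (q : {poly rat}) : size q != 1%N -> q %| p -> q %= p by split; rewrite ?sp.
move=> sq qp; have p0 : p != 0 by rewrite -size_poly_eq0 sp.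
have [r pE] : exists r : {poly rat}, p = r * q by apply/dvdpP.
have [r0 q0] : r != 0 /\ q != 0 by apply/andP; rewrite -negb_or -mulf_eq0 -pE.
have spq : (size p = (size r + size q).-1)%N by rewrite pE size_mul.
rewrite -dvdp_size_eqp // sp; move: px; rewrite pE rmorphM rootM => /orP[/(big _ r0)|/(big _ q0)] b.
  by move: spq sq b; rewrite -size_poly_gt0 in q0; rewrite sp; move: q0; lia.
by move: spq b; rewrite -size_poly_gt0 in r0; rewrite sp; move: r0;
  move: (size r) (size q) => k l *; apply/eqP; lia.
Qed.

(* The substitution (x, y) |-> (x t, t), under which a form q of degree d becomes
   q(x, 1) t^d; it turns a factorisation of F into one of F(x, 1). *)
Definition weighted (q : {mpoly rat[2]}) : {poly {poly rat}} :=
  mmap (fun c : rat => c%:P%:P) (fun i : 'I_2 => if i == 0 then 'X%:P * 'X else 'X) q.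

Lemma weightedE q : weighted q =
  mmap (polyC \o polyC : {rmorphism rat -> {poly {poly rat}}})
    (fun i : 'I_2 => if i == 0 then 'X%:P * 'X else 'X) q.
Proof. by []. Qed.

Lemma weightedM q r : weighted (q * r) = weighted q * weighted r.
Proof. by rewrite !weightedE rmorphM. Qed.

Lemma weightedX i j : weighted 'X_[mnm2 i j] = 'X^i *: 'X^(i + j).
Proof.
rewrite weightedE mmapX /mmap1 !big_ord_recl big_ord0 /= mulr1.
by rewrite exprMn -rmorphXn mul_polyC -scalerAl exprD.
Qed.

Lemma coef_weighted q i j : (weighted q)`_(i + j)`_i = q@_(mnm2 i j).
Proof.
rewrite [in RHS](mpolyE q) [in LHS](mpolyE q) weightedE !raddf_sum /= !coef_sum.
apply: eq_bigr => m _; rewrite mmapZ -weightedE [in LHS](mnm2_eta m) weightedX /=.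
rewrite mcoeffZ mcoeffX [in RHS](mnm2_eta m) mnm2_eq.
rewrite mul_polyC coefZ coefZ coefXn coefCM.
congr (_ * _); rewrite mulr_natr coefMn coefXn eq_sym.
have [->|ne] := eqVneq (m 0) i; last by rewrite mul0rn.
by rewrite eqn_add2l eq_sym mulr1n.
Qed.

Lemma weighted_form (b4 b3 b2 b1 b0 : rat) :
  weighted (quartic_form b4 b3 b2 b1 b0) = (poly5 b4 b3 b2 b1 b0)%:P * 'X^4.
Proof.
have wZ c q : weighted (c *: q) = c%:P%:P * weighted q by rewrite weightedE mmapZ.
rewrite /quartic_form weightedE !mmapD -!weightedE !wZ !weightedX /=.
rewrite -!mul_polyC /poly5 -!mul_polyC !(rmorphD, rmorphM) /=; ring.
Qed.

(** Strip from q and r their powers of X; the cofactors do not vanish at 0, so their product has no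
    factor X left and is the constant c. *)
Lemma polyXn_factor (D : idomainType) (q r : {poly D}) c n : c != 0 -> q * r = c%:P * 'X^n ->
  exists a b i j, [/\ q = a%:P * 'X^i, r = b%:P * 'X^j, a * b = c & (i + j)%N = n].
Proof.
move=> c0 e.
have e0 : c%:P * 'X^n != 0 by rewrite mulf_neq0 ?polyC_eq0 // monic_neq0 ?monicXn.
have q0 : q != 0 by apply: contraNneq e0 => z; rewrite -e z mul0r.
have r0 : r != 0 by apply: contraNneq e0 => z; rewrite -e z mulr0.
have [i [q1 + qE]] := multiplicity_XsubC q 0; rewrite q0 subr0 /= in qE * => q10.
have [j [r1 + rE]] := multiplicity_XsubC r 0; rewrite r0 subr0 /= in rE * => r10.
have qr1 : q1 * r1 * 'X^(i + j) = c%:P * 'X^n by rewrite -e qE rE exprD; ring.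
have n0 : q1 * r1 != 0 by rewrite mulf_neq0 //; [apply: contraNneq q10 | apply: contraNneq r10] => ->; rewrite root0.
have ij : (i + j)%N = n.
  have [lt|lt|//] := ltngtP (i + j) n.
    have : q1 * r1 = c%:P * 'X^(n - (i + j)).
      apply: (mulIf (monic_neq0 (monicXn D (i + j)))).
      by rewrite qr1 -mulrA -exprD subnK // ltnW.
    move/(congr1 (fun p : {poly D} => p.[0])); rewrite !hornerE ?hornerXn expr0n.
    rewrite subn_eq0 leqNgt lt mulr0 => /eqP; rewrite mulf_eq0.
    by rewrite /root in q10 r10; rewrite (negPf q10) (negPf r10).
  have : q1 * r1 * 'X^(i + j - n) = c%:P.
    apply: (mulIf (monic_neq0 (monicXn D n))).
    by rewrite -qr1 -(mulrA (q1 * r1)) -exprD subnK // ltnW.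
  move/(congr1 (fun p : {poly D} => p.[0])); rewrite !hornerE ?hornerXn expr0n.
  by rewrite subn_eq0 leqNgt lt mulr0 => /esym/eqP; rewrite (negPf c0).
have {}qr1 : q1 * r1 = c%:P.
  by apply: (mulIf (monic_neq0 (monicXn D n))); rewrite -qr1 ij.
have sqr : (size q1 * size r1 = 1)%N.
  have := congr1 (fun p : {poly D} => size p) qr1; rewrite size_polyC c0.
  have q1n : q1 != 0 by apply: contraNneq q10 => ->; rewrite root0.
  have r1n : r1 != 0 by apply: contraNneq r10 => ->; rewrite root0.
  rewrite size_mul //; rewrite -size_poly_gt0 in q1n; rewrite -size_poly_gt0 in r1n.
  by move: (size q1) (size r1) q1n r1n => [|[|k]] [|[|l]] //=; rewrite ?addnS.
move/eqP: sqr; rewrite muln_eq1 => /andP[/size_poly1P[a a0 q1E] /size_poly1P[b b0 r1E]].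
exists a, b, i, j; split=> //; rewrite ?qE ?rE ?q1E ?r1E //.
by apply: polyC_inj; rewrite rmorphM /= -q1E -r1E.
Qed.

Lemma weighted_monomial (q : {mpoly rat[2]}) (c : rat) i :
  weighted q = c%:P%:P * 'X^i -> q = c *: 'X_[mnm2 0 i].
Proof.
move=> e; apply/mpolyP=> m; rewrite (mnm2_eta m) -coef_weighted e.
rewrite mul_polyC coefZ coefXn mcoeffZ mcoeffX mnm2_eq coefCM.
congr (_ * _); have [->|n0] := eqVneq (m 0%R) 0%N.
  by rewrite add0n eq_sym; case: (i == m 1); rewrite ?coef1 ?coef0.
case: (_ == i); rewrite ?coef0 // coef1.
by rewrite (negPf n0).
Qed.

(** The map [weighted] turns F = q r into a factorisation p t^4 = (a t^i) (b t^j) with p = a b. One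
    of a, b is constant, and the corresponding form is a constant times a power of y. *)
Lemma irreducible_form (b4 b3 b2 b1 b0 : rat) : b4 != 0 ->
  irreducible_poly (poly5 b4 b3 b2 b1 b0) -> irreducible_elt (quartic_form b4 b3 b2 b1 b0).
Proof.
move=> b4n [_ irr]; set p := poly5 _ _ _ _ _ in irr.
have p0 : p != 0 by rewrite -size_poly_eq0 size_poly5.
have main (q r : {mpoly rat[2]}) (a b : {poly rat}) i j : weighted q = a%:P * 'X^i ->
    weighted r = b%:P * 'X^j -> quartic_form b4 b3 b2 b1 b0 = q * r -> size a = 1%N ->
    q \is a GRing.unit.
  move=> qE rE F sa; have /eqP/size_poly1P[a0 a0n aE] := sa; rewrite aE in qE.
  have {}qE := weighted_monomial qE; case: i qE => [|i] qE.
    rewrite qE mpolyX2 !expr0 mulr1; apply/unitrP; exists (a0^-1)%:MP.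
    by rewrite -mul_mpolyC mulr1 -!mpolyCM mulVf ?mulfV.
  (* A positive power of y vanishes at (1, 0), where F takes the value b4. *)
  pose e10 (k : 'I_2) : rat := if k == 0 then 1 else 0.
  have ev k l : 'X_[mnm2 k l].@[e10] = (l == 0%N)%:R.
    by rewrite mevalX !big_ord_recl big_ord0 /= expr1n mul1r mulr1 expr0n.
  have := congr1 (meval e10) F; rewrite qE mevalM mevalZ ev mulr0 mul0r.
  rewrite /quartic_form !mevalD !mevalZ !ev /= mulr1 !mulr0 !addr0 => b40.
  by rewrite b40 eqxx in b4n.
split.
- apply: contraNneq b4n => F0; have := congr1 (mcoeff (mnm2 4 0)) F0.
  by rewrite quartic_form_coef !mnm2_eq /= !mulr0n !addr0 mulr1n mcoeff0 => ->.
- exact: homog_nonunit (homog_quartic_form _ _ _ _ _).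
- move=> q r F; have := congr1 weighted F; rewrite weighted_form weightedM -/p => /esym e.
  have [a [b [i [j [qE rE ab ij]]]]] := polyXn_factor p0 e.
  have [sa|sa] := eqVneq (size a) 1%N; first by left; apply: main qE rE F sa.
  right; apply: (main r q b a j i) => //; first by rewrite mulrC.
  have ap : a %= p by apply: irr sa _; rewrite -ab dvdp_mulr.
  have a0 : a != 0 by apply: contraNneq p0 => z; rewrite -ab z mul0r.
  have b0n : b != 0 by apply: contraNneq p0 => z; rewrite -ab z mulr0.
  have := eqp_size ap; rewrite -ab size_mul //.
  rewrite -size_poly_gt0 in a0; rewrite -size_poly_gt0 in b0n.
  by move: (size a) (size b) a0 b0n => k l *; lia.
Qed.

Lemma not_exponent2 (gT : finGroupType) (H : {group gT}) (g : gT) : g \in H -> (g ^+ 2 != 1)%g ->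
  ~ H \isog [set: ('Z_2 * 'Z_2)%type]%G.
Proof.
move=> gH g2 /isogP[f injf _]; case/eqP: g2; apply: (injmP injf); rewrite ?groupX //.
rewrite morphX // morph1 expgS expg1; case: (f g) => a b; congr (_, _);
  by apply/val_inj; case: a => [[|[]]] //; case: b => [[|[]]].
Qed.

(** The roots are taken in [algC], and the number field they generate is equipped with the structure
    of a splitting field. *)
Lemma splitting_field_exists (p : {poly rat}) : p != 0 ->
  exists L : splittingFieldType rat, splittingFieldFor 1%VS (map_poly (in_alg L) p) {:L}.
Proof.
move=> p0; have [r Dr] := closed_field_poly_normal (map_poly (ratr : rat -> algC) p).
have [Qr [QrC [rr Drr genQr]]] := num_field_exists r.
have split : splittingFieldFor 1%VS (map_poly (in_alg Qr) p) {:Qr}.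
  exists rr => //; rewrite -(eqp_map QrC) rmorph_prod /=.
  have -> : map_poly QrC (map_poly (in_alg Qr) p) = map_poly ratr p.
    rewrite -map_poly_comp; apply: eq_map_poly => c /=.
    by rewrite alg_num_field fmorph_rat.
  rewrite Dr -Drr big_map; apply: (eqp_trans (eqp_scale _ _)).
    by rewrite lead_coef_eq0 map_poly_eq0.
  apply/eqpW/eq_bigr => z _; by rewrite rmorphB /= map_polyX map_polyC.
have ax : SplittingField.axiom Qr by exists (map_poly (in_alg Qr) p) => //; apply/polyOver1P; exists p.
pose LM := FieldExt_isSplittingField.Build rat Qr ax.
pose L : splittingFieldType rat := HB.pack Qr LM.
by exists L.
Qed.

(** The hypothesis ranges over all splitting fields because V4 has to be refuted in whichever one
    [Gal_isog] provides; there g has order greater than 2. *)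
Lemma V_sm_of_orbit (b4 b3 b2 b1 b0 : int) (F := quartic_form b4 b3 b2 b1 b0) : b4 != 0 ->
  (forall L : splittingFieldType rat,
    splittingFieldFor 1%VS (map_poly (in_alg L) (dehomogenize F)) {:L} ->
    exists x (g : gal_of {:L}), [/\ root (map_poly (in_alg L) (dehomogenize F)) x,
      g \in 'Gal({:L} / 1%AS)%g, uniq [:: x; g x; g (g x); g (g (g x))]
      & 'Gal({:L} / 1%AS)%G \isog [set: gsort 'D_8]%G \/
        'Gal({:L} / 1%AS)%G \isog [set: 'Z_4]%G]) ->
  V_sm F /\ ~ Gal_is_V4 F.
Proof.
rewrite dehomogenize_form; set p := poly5 _ _ _ _ _ => b4n H.
have b4q : b4%:~R != 0 :> rat by rewrite intr_eq0.
have p0 : p != 0 by rewrite -size_poly_gt0 size_poly5.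
have [L sL] := splitting_field_exists p0; split.
  have [x [g [px _ ux DZ]]] := H L sL; split; first exact: homog_quartic_form.
    rewrite Q_form_form; apply: irreducible_form => //.
    exact: irreducible_poly_orbit (size_poly5 _ _ _ _ b4q) px ux.
  case: DZ => iso; [apply: Or31|apply: Or32]; exists L => //; rewrite dehomogenize_form //.
move=> [K]; rewrite dehomogenize_form => sK isoV; have [x [g [_ gG ux _]]] := H K sK.
apply: (not_exponent2 gG _ isoV); apply: contraTneq ux => g2.
have -> : g (g x) = x by rewrite -galM ?memvf // -[(g * g)%g]/(g ^+ 2)%g g2 gal_id.
by rewrite /= !inE eqxx !orbT.
Qed.

Lemma quadratic_factor_root (K : fieldType) (P Q : {poly K}) rs :
  P %= \prod_(z <- rs) ('X - z%:P) -> Q %| P -> (1 < size Q)%N ->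
  exists2 z, z \in rs & root Q z.
Proof.
move=> Prs QP sQ; have : Q %| \prod_(z <- rs) ('X - z%:P) by rewrite -(eqp_dvdr _ Prs).
case/dvdp_prod_XsubC=> m Qm; case ms: (mask m rs) Qm => [|z zs] Qm.
  by move: sQ; rewrite (eqp_size Qm) big_nil size_poly1.
exists z; first by apply: (@mem_mask _ _ m); rewrite ms mem_head.
by rewrite (eqp_root Qm) root_prod_XsubC mem_head.
Qed.

(* Under y = S(x) / T(x), with inverse [bw], the roots x of P correspond to the roots of the
   biquadratic polynomial m y^4 + l y^2 + n. *)
Section BiquadraticSubstitution.

Variables (L : splittingFieldType rat) (p : {poly rat}) (m l n k : rat).
Let P := map_poly (in_alg L) p.
Variables (S T : {poly L}) (bw : L -> L) (D : pred L).
Hypothesis splitP : splittingFieldFor 1%VS P {:L}.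
Hypothesis m0 : m != 0.
Hypothesis k0 : k != 0.
Hypothesis PST : k%:A *: P = m%:A *: S ^+ 4 + l%:A *: (S ^+ 2 * T ^+ 2) + n%:A *: T ^+ 4.
Hypothesis sP : (1 < size P)%N.
Hypothesis T0 : forall x, root P x -> T.[x] != 0.
Hypothesis bwK : forall x, root P x -> bw (S.[x] / T.[x]) = x.
Hypothesis bw_in : forall (E : {subfield L}) y, y \in E -> bw y \in E.
Hypothesis bw_gal : forall (g : gal_of {:L}) y, g (bw y) = bw (g y).
Hypothesis bw_inj : {in D &, injective bw}.
Hypothesis D_root : forall x, root P x -> S.[x] / T.[x] \in D.
Hypothesis D_gal : forall (g : gal_of {:L}) y, y \in D -> g y \in D.
Hypothesis size_factor : forall c : L, m%:A * c ^+ 2 + l%:A * c + n%:A = 0 ->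
  (1 < size (S ^+ 2 - c *: T ^+ 2)%R)%N.
Hypothesis nsq1 : forall c : rat, n / m != c ^+ 2.
Hypothesis nsq2 : forall c : rat, (- l / m) ^+ 2 - 4 * (n / m) != c ^+ 2.

(** Let th = S(x) / T(x) for a root x, and let ka be the other root of m z^2 + l z + n besides th^2.
    The factor S^2 - ka T^2 of P has a root z in L, which supplies ph with ph^2 = ka. Every root of
    P is [bw] of +- th or +- ph, so th and ph generate L. *)
Lemma substitution_galois :
    exists x (g : gal_of {:L}), [/\ root P x,
      g \in 'Gal({:L} / 1%AS)%g, uniq [:: x; g x; g (g x); g (g (g x))]
      & 'Gal({:L} / 1%AS)%G \isog [set: gsort 'D_8]%G \/
        'Gal({:L} / 1%AS)%G \isog [set: 'Z_4]%G].
Proof.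
have [rs Prs gen] := splitP.
have algM (a b : rat) : a%:A * b%:A = (a * b)%:A :> L by rewrite -scalerAl mul1r scalerA.
have m0' : m%:A != 0 :> L by rewrite -[m%:A]/(in_alg L m) fmorph_eq0.
have k0' : k%:A != 0 :> L by rewrite -[k%:A]/(in_alg L k) fmorph_eq0.
have [x _ Px] := quadratic_factor_root Prs (dvdpp P) sP.
have PE y : k%:A * P.[y] = m%:A * S.[y] ^+ 4 + l%:A * (S.[y] ^+ 2 * T.[y] ^+ 2) + n%:A * T.[y] ^+ 4.
  by have := congr1 (horner^~ y) PST; rewrite !hornerE.
pose th := S.[x] / T.[x].
have thE : m%:A * th ^+ 4 + l%:A * th ^+ 2 + n%:A = 0.
  apply: (mulIf (expf_neq0 4 (T0 Px))); rewrite mul0r -(mulr0 k%:A) -(rootP Px) PE /th.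
  by field; exact: T0.
pose ka := - (l / m)%:A - th ^+ 2.
have lE : l%:A = - m%:A * (th ^+ 2 + ka).
  have -> : th ^+ 2 + ka = - (l / m)%:A by rewrite /ka addrC subrK.
  by rewrite mulrNN algM mulrC divfK.
have nE : n%:A = m%:A * (th ^+ 2 * ka).
  by apply/eqP; rewrite -subr_eq0 -thE lE; apply/eqP; ring.
have PF : k%:A *: P = (m%:A *: (S ^+ 2 - th ^+ 2 *: T ^+ 2)) * (S ^+ 2 - ka *: T ^+ 2).
  rewrite PST lE nE -!mul_polyC !(rmorphD, rmorphM, rmorphN, rmorphXn) /=; ring.
have [z _ Qz] : exists2 z, z \in rs & root (S ^+ 2 - ka *: T ^+ 2) z.
  apply: quadratic_factor_root Prs _ _; last first.
    by apply: size_factor; rewrite lE nE; ring.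
  by rewrite -(dvdpZr _ _ k0') PF dvdp_mull.
have Pz : root P z.
  rewrite -(rootZ _ _ k0') PF rootM Qz orbT //.
pose ph := S.[z] / T.[z].
have phE : ph ^+ 2 = ka.
  have e : S.[z] ^+ 2 = ka * T.[z] ^+ 2.
    by apply/eqP; rewrite -subr_eq0 -!horner_exp -hornerZ -hornerN -hornerD.
  by rewrite /ph expr_div_n e mulfK // expf_neq0 // T0.
have sum_sq : th ^+ 2 + ph ^+ 2 = (- l / m)%:A.
  by rewrite phE /ka addrC subrK mulNr scaleNr.
have prod_sq : th ^+ 2 * ph ^+ 2 = (n / m)%:A.
  apply: (mulfI m0'); rewrite phE -nE.
  by rewrite algM mulrC divfK.
have gen2 : <<1 & [:: th; ph]>>%VS = {:L}%VS.
  apply/eqP; rewrite eqEsubv subvf -gen /=; apply/Fadjoin_seqP; split; first exact: sub1v.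
  move=> y yrs; have Py : root P y by rewrite (eqp_root Prs) root_prod_XsubC.
  rewrite -(bwK Py); apply: (bw_in (E := <<1 & [:: th; ph]>>%AS)).
  have : (S.[y] / T.[y]) ^+ 2 \in [:: th ^+ 2; ph ^+ 2].
    have := rootP Py; move/(congr1 ( *%R k%:A)); rewrite mulr0 PE lE nE -phE => e.
    have : (m%:A * ((S.[y] / T.[y]) ^+ 2 - th ^+ 2)) * ((S.[y] / T.[y]) ^+ 2 - ph ^+ 2) = 0.
      apply: (mulIf (expf_neq0 4 (T0 Py))); rewrite mul0r -e; field; exact: T0.
    by move/eqP; rewrite !mulf_eq0 (negPf m0') /= !subr_eq0 !inE.
  have thin : th \in <<1 & [:: th; ph]>>%VS by apply: seqv_sub_adjoin; rewrite mem_head.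
  have phin : ph \in <<1 & [:: th; ph]>>%VS by apply: seqv_sub_adjoin; rewrite !inE eqxx orbT.
  by rewrite !inE !eqf_sqr -!orbA => /or4P[] /eqP -> //; rewrite rpredN.
have [g gG ug] := biquadratic_orbit sum_sq prod_sq nsq1 nsq2.
exists x, g; split=> //; last exact: biquadratic_galois_group sum_sq prod_sq gen2 nsq1 nsq2.
have -> : [:: x; g x; g (g x); g (g (g x))] = map bw [:: th; g th; g (g th); g (g (g th))].
  by rewrite /= -!bw_gal bwK.
rewrite map_inj_in_uniq // => y1 y2 y1in y2in; apply: bw_inj.
  by move: y1in; rewrite !inE => /or4P[] /eqP ->; rewrite ?D_gal // D_root.
by move: y2in; rewrite !inE => /or4P[] /eqP ->; rewrite ?D_gal // D_root.
Qed.
End BiquadraticSubstitution.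

(** If b / a were a rational square, so would be a b = a^2 (b / a), and an integer that is a
    rational square is an integral one. *)
Lemma rat_square_int (a b : int) : a != 0 -> (forall j : int, a * b != j ^+ 2) ->
  forall c : rat, b%:~R / a%:~R != c ^+ 2.
Proof.
move=> a0 nsq c; apply/eqP=> e.
have a0' : a%:~R != 0 :> rat by rewrite intr_eq0.
have d0' : (denq c)%:~R != 0 :> rat by rewrite intr_eq0 denq_neq0.
have : a * b * (denq c) ^+ 2 = (a * numq c) ^+ 2.
  apply/eqP; rewrite -(eqr_int rat) !(rmorphM, rmorphXn) /=; apply/eqP.
  have -> : b%:~R = c ^+ 2 * a%:~R by rewrite -e divfK.
  by rewrite -{1}(divq_num_den c); field.
case/square_of_multiple=> [|j ab]; first exact: denq_neq0.
by case/eqP: (nsq j).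
Qed.

Lemma rat_square_disc (a d : int) : a != 0 -> (forall j : int, d != j ^+ 2) ->
  forall c : rat, d%:~R / a%:~R ^+ 2 != c ^+ 2.
Proof.
move=> a0 nsq c; apply/eqP=> e.
have nsq1 (j : int) : 1 * d != j ^+ 2 by rewrite mul1r.
have a0' : a%:~R != 0 :> rat by rewrite intr_eq0.
have /eqP := rat_square_int (oner_neq0 _) nsq1 (c * a%:~R); apply.
by rewrite divr1 exprMn -e divfK // expf_neq0.
Qed.

Lemma alg_intr_neq0 (L : splittingFieldType rat) (a : int) : a != 0 -> (a%:~R)%:A != 0 :> L.
Proof. by move=> a0; rewrite -[_ *: _]/(in_alg L a%:~R) fmorph_eq0 intr_eq0. Qed.

Lemma map_poly5 (L : splittingFieldType rat) b4 b3 b2 b1 b0 :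
  map_poly (in_alg L) (poly5 b4 b3 b2 b1 b0) =
  b4%:A *: 'X^4 + b3%:A *: 'X^3 + b2%:A *: 'X^2 + b1%:A *: 'X + (b0%:A)%:P.
Proof.
by rewrite /poly5 !rmorphD /= !map_polyZ !map_polyXn map_polyX map_polyC.
Qed.

Lemma type1_V_sm (A B C : int) : A != 0 ->
  (forall j : int, A * C != j ^+ 2) -> (forall j : int, B ^+ 2 - 4 * (A * C) != j ^+ 2) ->
  V_sm (type1 A B C) /\ ~ Gal_is_V4 (type1 A B C).
Proof.
move=> A0 nsq1 nsq2; apply: V_sm_of_orbit => // L; rewrite dehomogenize_form.
have A0' : A%:~R != 0 :> rat by rewrite intr_eq0.
have A0L := alg_intr_neq0 L A0.
move=> sP; apply: (@substitution_galois L _ A%:~R B%:~R C%:~R 1 'X 1 id predT) => //.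
- rewrite map_poly5 mulr0z scale0r !scale1r -!mul_polyC; ring.
- by rewrite size_map_poly size_poly5.
- by move=> x _; rewrite hornerC oner_eq0.
- by move=> x _; rewrite hornerX hornerC divr1.
- by move=> c _; rewrite expr1n alg_polyC size_XnsubC.
- exact: rat_square_int.
- move=> c; have := rat_square_disc A0 nsq2 c; rewrite !(rmorphB, rmorphM, rmorphXn) /=.
  congr (_ != _); by field.
Qed.

(** The substitution y = (x + 1) / (x - 1) turns the symmetry x -> 1 / x of the roots into y -> - y,
    which makes the polynomial biquadratic. *)
Lemma type2_V_sm (A B C : int) (m := 2 * A + 2 * B + C) (n := 2 * A - 2 * B + C) : m != 0 ->
  (forall j : int, m * n != j ^+ 2) -> (forall j : int, (6 * A - C) ^+ 2 - m * n != j ^+ 2) ->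
  V_sm (type2 A B C) /\ ~ Gal_is_V4 (type2 A B C).
Proof.
move=> m0 nsq1 nsq2.
have A0 : A != 0.
  by apply/eqP=> z; case/eqP: (nsq2 (2 * B)); rewrite /m /n z; ring.
apply: V_sm_of_orbit => // L; rewrite dehomogenize_form.
have m0' : m%:~R != 0 :> rat by rewrite intr_eq0.
have mL := alg_intr_neq0 L m0.
have two : 2 != 0 :> L by apply: natr_neq0_split.
set p := poly5 _ _ _ _ _; set P := map_poly _ _ => sP.
have PE (x : L) : P.[x] = A%:~R * x ^+ 4 + B%:~R * x ^+ 3 + C%:~R * x ^+ 2 + B%:~R * x + A%:~R.
  by rewrite /P map_poly5 !hornerE !scaler_int.
have x1 x : root P x -> x != 1.
  move=> Px; apply: contraTneq Px => ->; rewrite /root PE.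
  move: mL; rewrite scaler_int /m; congr (_ != 0).
  by rewrite !(rmorphD, rmorphM) /=; ring.
(* 16 P = m (x + 1)^4 + 2 L (x^2 - 1)^2 + n (x - 1)^4, where m = P(1) and n = P(-1). The inverse of
   the substitution has the same formula, and y = 1 is its pole. *)
apply: (@substitution_galois L p m%:~R (2 * (6 * A - C))%:~R n%:~R 16%:~R
  ('X + 1) ('X - 1) (fun y => (y + 1) / (y - 1)) (fun y => y != 1)) => //.
- rewrite -/P /P map_poly5 -!mul_polyC !scaler_int /m /n.
  ring.
- by rewrite size_map_poly size_poly5 // intr_eq0.
- by move=> x /x1; rewrite !hornerE subr_eq0.
- move=> x /x1 x10; rewrite !hornerE /=; have x1' : x - 1 != 0 by rewrite subr_eq0.
  field; rewrite x1' /=; have -> // : x + 1 + -1 * (x - 1) = 2 by ring.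
- by move=> E y yE; rewrite rpredM ?rpredV ?rpredD ?rpredN ?rpred1.
- by move=> g y; rewrite fmorph_div /= rmorphD rmorphB rmorph1.
- move=> y1 y2; rewrite !unfold_in => h1 h2 /eqP.
  rewrite eqr_div ?subr_eq0 // => /eqP e; apply: (mulfI two); apply/eqP.
  rewrite -subr_eq0 -(subrr ((y2 + 1) * (y1 - 1))) -{2}e; apply/eqP; ring.
- move=> x /x1 x10; rewrite unfold_in !hornerE; have x1' : x - 1 != 0 by rewrite subr_eq0.
  apply: contraNneq two => e; rewrite -(subrr (x + 1)) -{2}(divfK x1' (x + 1)) e.
  by apply/eqP; ring.
- by move=> g y; rewrite !unfold_in; apply: contraNneq => e; rewrite -(rmorph1 g) in e; apply/eqP/(fmorph_inj g).
(* The values at 1, 0 and -1 are 4, 1 - c and - 4 c. If they were all equal to a, then 3 a - (4 a -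
   a) would be both 0 and 12 - 4 = 8. *)
- move=> c _; rewrite ltnNge; apply/negP=> /size1_polyC qE.
  have qx x : (x + 1) ^+ 2 - c * (x - 1) ^+ 2 = (('X + 1) ^+ 2 - c *: ('X - 1) ^+ 2)`_0.
    rewrite -[RHS](hornerC _ x) -qE hornerD hornerN hornerZ !horner_exp.
    by rewrite hornerD hornerXsubC hornerX hornerC.
  set a := _`_0 in qx.
  have /eqP : 2 ^+ 3 = 0 :> L.
    transitivity (3 * a - (4 * a - a)); last by ring.
    by rewrite -{1}(qx 1) -{1}(qx 0) -(qx (-1)); ring.
  by rewrite expf_eq0 (negPf two).
- exact: rat_square_int.
- move=> c; have := rat_square_disc m0 nsq2 (c / 2).
  rewrite rmorphB rmorphXn (rmorphM _ m n) (rmorphM _ 2 (6 * A - C)) /=.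
  by apply: contraNneq => e; rewrite expr_div_n -e; apply/eqP; field.
Qed.

(** * Which normal forms are equivalent *)

Definition quadratic (R : comNzRingType) (g2 g1 g0 : R) : {mpoly R[2]} :=
  g2 *: 'X_[mnm2 2 0] + g1 *: 'X_[mnm2 1 1] + g0 *: 'X_[mnm2 0 2].

Lemma quadratic_coefs (R : comNzRingType) (g2 g1 g0 : R) (f := quadratic g2 g1 g0) :
  [/\ alpha f = g2, beta f = g1 & gamma f = g0].
Proof.
split; rewrite /alpha /beta /gamma !mcoeffD !mcoeffZ !mcoeffX !mnm2_eq /=;
  by rewrite !mulr0 mulr1 ?addr0 ?add0r.
Qed.

Lemma homog_quadratic (R : comNzRingType) (g2 g1 g0 : R) : quadratic g2 g1 g0 \is 2.-homog.
Proof. by rewrite !rpredD ?rpredZ // dhomogX; apply/eqP/mdeg_mnm2. Qed.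

Lemma map_quadratic (R : comNzRingType) (g2 g1 g0 : int) :
  map_mpoly intr (quadratic g2 g1 g0) = quadratic g2%:~R g1%:~R g0%:~R :> {mpoly R[2]}.
Proof.
rewrite !(rmorphD (map_mpoly intr)) /=.
by rewrite !(map_mpolyZ (intmul 1)) !map_mpolyX.
Qed.

Lemma M_quadE (R : comNzRingType) (g2 g1 g0 : R) :
  M_quad (quadratic g2 g1 g0) = mx2 g1 (2 * g0) (- (2 * g2)) (- g1).
Proof. by have [a b c] := quadratic_coefs g2 g1 g0; rewrite /M_quad a b c. Qed.

(* The value at (x, y) of F4 + 4 L F, a multiple of f^2 when L is the distinguished root. *)
Definition square_cov (b4 b3 b2 b1 b0 L x y : int) : int :=
  sub4 (cov4 b4 b3 b2 b1 b0) (cov3 b4 b3 b2 b1 b0) (cov2 b4 b3 b2 b1 b0)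
    (cov1 b4 b3 b2 b1 b0) (cov0 b4 b3 b2 b1 b0) x 0 y 0
  + 4 * L * sub4 b4 b3 b2 b1 b0 x 0 y 0.

Lemma square_cov_sub (b4 b3 b2 b1 b0 c4 c3 c2 c1 c0 p q r s L x y : int) :
  (p * s - q * r) ^+ 2 = 1 ->
  sub_form b4 b3 b2 b1 b0 p q r s = quartic_form c4 c3 c2 c1 c0 ->
  square_cov c4 c3 c2 c1 c0 L x y =
  square_cov b4 b3 b2 b1 b0 L (p * x + q * y) (r * x + s * y).
Proof.
move=> d1 eF; have [e4 e3 e2 e1 e0] := quartic_form_inj eF.
have := F4_covariant_sub b4 b3 b2 b1 b0 p q r s; rewrite /square_cov.
rewrite d1 scale1r eF F4_covariant_form => /quartic_form_inj [-> -> -> -> ->].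
rewrite -e4 -e3 -e2 -e1 -e0.
have subE := fun b4 b3 b2 b1 b0 : int => quartic_form_inj (sub_sub b4 b3 b2 b1 b0 p q r s x 0 y 0).
have [-> _ _ _ _] := subE b4 b3 b2 b1 b0.
by have [-> _ _ _ _] := subE (cov4 b4 b3 b2 b1 b0) (cov3 b4 b3 b2 b1 b0) (cov2 b4 b3 b2 b1 b0)
  (cov1 b4 b3 b2 b1 b0) (cov0 b4 b3 b2 b1 b0).
Qed.

Lemma square_cov_type1 A B C x y :
  square_cov A 0 B 0 C (2 * B) x y = 12 * (B ^+ 2 - 4 * (A * C)) * (x * y) ^+ 2.
Proof. by rewrite /square_cov /sub4 /cov4 /cov3 /cov2 /cov1 /cov0; ring. Qed.

Lemma square_cov_type2 A B C x y :
  square_cov A B C B A (6 * A - C) x y =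
  3 * (B ^+ 2 + 8 * A ^+ 2 - 4 * A * C) * (x ^+ 2 - y ^+ 2) ^+ 2.
Proof. by rewrite /square_cov /sub4 /cov4 /cov3 /cov2 /cov1 /cov0; ring. Qed.

(** A second integral root L' would satisfy (2 L' + L)^2 = 9 E, making E a square. *)
Lemma resolvent_root_unique (L L' E E' I J : int) :
  12 * I = 3 * L ^+ 2 + 9 * E -> J = 3 * I * L - L ^+ 3 ->
  12 * I = 3 * L' ^+ 2 + 9 * E' -> J = 3 * I * L' - L' ^+ 3 ->
  (forall j : int, E != j ^+ 2) -> L' = L.
Proof.
move=> eI eJ eI' eJ' nsq; apply/eqP/negP=> /negP LL.
have wL : L'%:~R != L%:~R :> rat by rewrite eqr_int.
have := depressed_cubic_other_root eI eJ wL.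
have -> : L'%:~R ^+ 3 - 3 * I%:~R * L'%:~R + J%:~R = 0 :> rat.
  by rewrite eJ' !(rmorphB, rmorphM, rmorphXn) /=; ring.
move=> /(_ erefl) /eqP; have -> : 2 * L'%:~R + L%:~R = (2 * L' + L)%:~R :> rat.
  by rewrite rmorphD rmorphM.
rewrite -rmorphXn eqr_int /= => /eqP e.
have [|j jE] := @square_of_multiple E 3 (2 * L' + L) isT; first by rewrite e; ring.
by case/eqP: (nsq j).
Qed.

(** The nonsquare conditions give a Galois group D4 or C4, and also a unique integral root L and a
    nonzero covariant F4 + 4 L F. *)
Definition generic1 (A B C : int) :=
  [/\ A != 0, forall j : int, A * C != j ^+ 2 & forall j : int, B ^+ 2 - 4 * (A * C) != j ^+ 2].

Definition generic2 (A B C : int) (m := 2 * A + 2 * B + C) (n := 2 * A - 2 * B + C) :=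
  [/\ m != 0, forall j : int, m * n != j ^+ 2 & forall j : int, (6 * A - C) ^+ 2 - m * n != j ^+ 2].

Lemma generic1_nonsquare A B C : generic1 A B C -> forall j : int, 16 * (A * C) != j ^+ 2.
Proof.
move=> [_ nsq _] j; apply/eqP=> e.
have [|k kE] := @square_of_multiple (A * C) 4 j isT; first by rewrite -e; ring.
by case/eqP: (nsq k).
Qed.

Lemma class_eq_sub (b4 b3 b2 b1 b0 c4 c3 c2 c1 c0 : int) :
  GL2Z_class (quartic_form b4 b3 b2 b1 b0) = GL2Z_class (quartic_form c4 c3 c2 c1 c0) ->
  exists p q r s, (p * s - q * r) ^+ 2 = 1 /\
    sub_form c4 c3 c2 c1 c0 p q r s = quartic_form b4 b3 b2 b1 b0.
Proof.
move=> e; have : GL2Z_class (quartic_form c4 c3 c2 c1 c0) (quartic_form b4 b3 b2 b1 b0).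
  rewrite -e; exists (mx2 1 0 0 1); first by rewrite unitmx_int.
  have d1 : (1 * 1 - 0 * 0 : int) ^+ 2 = 1 by ring.
  rewrite (quartic_act_int _ _ _ _ _ d1) /sub_form /sub4 /sub3 /sub2 /sub1 /sub0.
  by congr quartic_form; ring.
move=> [T]; rewrite (mx2_eta T) unitmx_int => /eqP d1.
rewrite (quartic_act_int _ _ _ _ _ d1) => eF.
by exists (T 0 0), (T 0 1), (T 1 0), (T 1 1); split; [exact: d1 | rewrite eF].
Qed.

Lemma invariants_GL2Z (b4 b3 b2 b1 b0 c4 c3 c2 c1 c0 p q r s : int) :
  (p * s - q * r) ^+ 2 = 1 ->
  sub_form b4 b3 b2 b1 b0 p q r s = quartic_form c4 c3 c2 c1 c0 ->
  I_inv (quartic_form c4 c3 c2 c1 c0) = I_inv (quartic_form b4 b3 b2 b1 b0) /\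
  J_inv (quartic_form c4 c3 c2 c1 c0) = J_inv (quartic_form b4 b3 b2 b1 b0).
Proof.
move=> d1 <-; rewrite I_inv_sub J_inv_sub (exprM _ 2 2) (exprM _ 2 3) d1.
by rewrite !expr1n !mul1r.
Qed.

Lemma mulz_unit_sqr (x y : int) : (x * y) ^+ 2 = 1 -> x ^+ 2 = 1 /\ y ^+ 2 = 1.
Proof.
rewrite exprMn => xy; split; first exact: mulz_sqr_eq1 xy.
by rewrite mulrC in xy; apply: mulz_sqr_eq1 xy.
Qed.

Lemma mulz_sqr_eq0 (c x : int) : c != 0 -> c * x ^+ 2 = 0 -> x = 0.
Proof. by move=> c0 /eqP; rewrite mulf_eq0 (negPf c0) sqrf_eq0 => /eqP. Qed.

(** The root L = 2 B is preserved, hence so is the covariant, a multiple of (x y)^2. The matrix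
    therefore permutes the two axes: it is diagonal or antidiagonal with entries +-1. *)
Lemma class_type1_inj A B C A' B' C' : generic1 A B C -> generic1 A' B' C' ->
  GL2Z_class (type1 A B C) = GL2Z_class (type1 A' B' C') ->
  B = B' /\ ((A = A' /\ C = C') \/ (A = C' /\ C = A')).
Proof.
move=> gen [A0' _ D'] /class_eq_sub [p [q [r [s [d1 eF]]]]].
have E := generic1_nonsquare gen; have [A0 _ D] := gen.
have [eI eJ] := type1_invariants A B C; have [eI' eJ'] := type1_invariants A' B' C'.
have [sameI sameJ] := invariants_GL2Z d1 eF.
rewrite -/(type1 A B C) -/(type1 A' B' C') in sameI sameJ.
rewrite -sameI -sameJ in eI' eJ'.
have BB : B = B' by have := resolvent_root_unique eI eJ eI' eJ' E; lia.
split=> //.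
have cov x y : 12 * (B ^+ 2 - 4 * (A * C)) * (x * y) ^+ 2 =
    12 * (B' ^+ 2 - 4 * (A' * C')) * ((p * x + q * y) * (r * x + s * y)) ^+ 2.
  by rewrite -!square_cov_type1 BB; apply: square_cov_sub d1 _; rewrite eF BB.
have D0' : 12 * (B' ^+ 2 - 4 * (A' * C')) != 0.
  by rewrite mulf_neq0 //; apply: contraNneq (D' 0) => ->.
have pr : p * r = 0.
  apply: (mulz_sqr_eq0 D0'); transitivity (12 * (B ^+ 2 - 4 * (A * C)) * (1 * 0) ^+ 2); last by ring.
  by rewrite cov; ring.
have qs : q * s = 0.
  apply: (mulz_sqr_eq0 D0'); transitivity (12 * (B ^+ 2 - 4 * (A * C)) * (0 * 1) ^+ 2); last by ring.
  by rewrite cov; ring.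
move/eqP: pr; move/eqP: qs; rewrite !mulf_eq0 => qs pr.
have [e4 _ _ _ e0] := quartic_form_inj eF; rewrite /sub4 /sub0 in e4 e0.
have pow4 (x y : int) : x ^+ 2 = 1 -> y * x ^+ 4 = y.
  by move=> x2; rewrite (exprM x 2 2) x2 expr1n mulr1.
case/orP: pr => /eqP z1.
  have [q2 r2] : q ^+ 2 = 1 /\ r ^+ 2 = 1.
    by apply: mulz_unit_sqr; rewrite -d1 z1; ring.
  have s0 : s = 0 by apply/eqP; move: qs; case/orP=> // /eqP q0; move: q2; rewrite q0.
  right; split.
    by rewrite -e4 z1 -[RHS](pow4 r) //; ring.
  by rewrite -e0 s0 -[RHS](pow4 q) //; ring.
have [p2 s2] : p ^+ 2 = 1 /\ s ^+ 2 = 1.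
  by apply: mulz_unit_sqr; rewrite -d1 z1; ring.
have q0 : q = 0 by apply/eqP; move: qs; case/orP=> // /eqP s0; move: s2; rewrite s0.
left; split.
  by rewrite -e4 z1 -[RHS](pow4 p) //; ring.
by rewrite -e0 q0 -[RHS](pow4 s) //; ring.
Qed.

Lemma type2_cov_coef (A B C : int) (m := 2 * A + 2 * B + C) (n := 2 * A - 2 * B + C) :
  (6 * A - C) ^+ 2 - m * n = 4 * (B ^+ 2 + 8 * A ^+ 2 - 4 * A * C).
Proof. by rewrite /m /n; ring. Qed.

Lemma generic2_coef (A B C : int) : generic2 A B C -> 3 * (B ^+ 2 + 8 * A ^+ 2 - 4 * A * C) != 0.
Proof.
move=> [_ _ D]; rewrite mulf_neq0 //; apply: contraNneq (D 0) => e.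
by rewrite type2_cov_coef e.
Qed.

(** The matrix permutes the lines x = y and x = - y. Unless the determinant vanishes, (p, q) = e (s,
    r) with e = +-1; then (s - r) (s + r) is a unit, so both factors are units and r s = 0. *)
Lemma unimodular_monomial (p q r s : int) : (p * s - q * r) ^+ 2 = 1 ->
  (p + q == r + s) || (p + q == - (r + s)) -> (p - q == r - s) || (p - q == - (r - s)) ->
  (q = 0 /\ r = 0 /\ p ^+ 2 = 1 /\ s ^+ 2 = 1) \/
  (p = 0 /\ s = 0 /\ q ^+ 2 = 1 /\ r ^+ 2 = 1).
Proof.
move=> d1 plus minus.
have [e [e2 pE qE]] : exists e, [/\ e ^+ 2 = 1, p = e * s & q = e * r].
  case/orP: plus => /eqP h1; case/orP: minus => /eqP h2.
  - have pr : p = r by move: h1 h2; clear; lia.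
    have qs : q = s by move: h1 h2; clear; lia.
    by move: d1; rewrite pr qs mulrC subrr expr0n.
  - by exists 1; split; rewrite ?expr1n ?mul1r //; move: h1 h2; clear; lia.
  - by exists (-1); split; rewrite ?sqrrN ?expr1n ?mulN1r //; move: h1 h2; clear; lia.
  - have pr : p = - r by move: h1 h2; clear; lia.
    have qs : q = - s by move: h1 h2; clear; lia.
    by move: d1; rewrite pr qs !mulNr mulrC subrr expr0n.
have rs1 : (s ^+ 2 - r ^+ 2) ^+ 2 = 1.
  rewrite -d1 pE qE -[LHS]mul1r -{1}e2; ring.
rewrite subr_sqr in rs1; have [h1 h2] := mulz_unit_sqr rs1.
have rs : r * s = 0.
  have : 4 * (r * s) = (s + r) ^+ 2 - (s - r) ^+ 2 by ring.
  by rewrite h1 h2 subrr; clear; lia.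
have rs2 : s ^+ 2 + r ^+ 2 = 1.
  transitivity ((s + r) ^+ 2 - 2 * (r * s)); first by ring.
  by rewrite h2 rs; ring.
move/eqP: rs; rewrite mulf_eq0 => /orP[] /eqP z; [left|right].
  rewrite z expr0n addr0 in rs2.
  by rewrite qE pE z mulr0 exprMn e2 rs2.
rewrite z expr0n add0r in rs2.
by rewrite qE pE z mulr0 exprMn e2 rs2.
Qed.

(** The covariant is a multiple of (x^2 - y^2)^2, so the equivalence is monomial: it keeps A and can
    only change the sign of B. Then C is determined by L = 6 A - C. *)
Lemma class_type2_inj A B C A' B' C' : 0 <= B -> 0 <= B' ->
  generic2 A B C -> generic2 A' B' C' ->
  GL2Z_class (type2 A B C) = GL2Z_class (type2 A' B' C') -> [/\ A = A', B = B' & C = C'].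
Proof.
move=> B0 B0' gen gen' /class_eq_sub [p [q [r [s [d1 eF]]]]].
have [m0 E D] := gen.
have [eI eJ] := type2_invariants A B C; have [eI' eJ'] := type2_invariants A' B' C'.
have [sameI sameJ] := invariants_GL2Z d1 eF.
rewrite -/(type2 A B C) -/(type2 A' B' C') in sameI sameJ.
rewrite -sameI -sameJ in eI' eJ'.
have LL := resolvent_root_unique eI eJ eI' eJ' E.
have cov x y : 3 * (B ^+ 2 + 8 * A ^+ 2 - 4 * A * C) * (x ^+ 2 - y ^+ 2) ^+ 2 =
    3 * (B' ^+ 2 + 8 * A' ^+ 2 - 4 * A' * C')
      * ((p * x + q * y) ^+ 2 - (r * x + s * y) ^+ 2) ^+ 2.
  by rewrite -!square_cov_type2 -LL; apply: square_cov_sub d1 eF.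
have plus : (p + q) ^+ 2 - (r + s) ^+ 2 = 0.
  apply: (mulz_sqr_eq0 (generic2_coef gen')).
  transitivity (3 * (B ^+ 2 + 8 * A ^+ 2 - 4 * A * C) * (1 ^+ 2 - 1 ^+ 2) ^+ 2); last by ring.
  by rewrite cov; ring.
have minus : (p - q) ^+ 2 - (r - s) ^+ 2 = 0.
  apply: (mulz_sqr_eq0 (generic2_coef gen')).
  transitivity (3 * (B ^+ 2 + 8 * A ^+ 2 - 4 * A * C) * (1 ^+ 2 - (-1) ^+ 2) ^+ 2); last by ring.
  by rewrite cov; ring.
move/eqP: plus; move/eqP: minus; rewrite !subr_eq0 !eqf_sqr => minus plus.
have [e4 e3 _ _ _] := quartic_form_inj eF; rewrite /sub4 /sub3 in e4 e3.
have mono := unimodular_monomial d1 plus minus.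
have AB : A = A' /\ (B = B' \/ B = - B').
  have pow4 (x y : int) : x ^+ 2 = 1 -> y * x ^+ 4 = y.
    by move=> x2; rewrite (exprM x 2 2) x2 expr1n mulr1.
  have sgn (x y z : int) : x ^+ 2 = 1 -> y ^+ 2 = 1 -> z * (x ^+ 3 * y) = z \/ z * (x ^+ 3 * y) = - z.
    move=> x2 y2; have /eqP : (x * y) ^+ 2 = 1 by rewrite exprMn x2 y2.
    rewrite sqrf_eq1 exprSr x2 mul1r => /orP[] /eqP ->; [left|right]; ring.
  case: mono => [[q0 [r0 [p2 s2]]]|[p0 [s0 [q2 r2]]]]; split.
  - by rewrite -e4 r0 -[RHS](pow4 p) //; ring.
  - have -> : B = B' * (p ^+ 3 * s) by rewrite -e3 q0 r0; ring.
    exact: sgn.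
  - by rewrite -e4 p0 -[RHS](pow4 r) //; ring.
  - have -> : B = B' * (r ^+ 3 * q) by rewrite -e3 p0 s0; ring.
    exact: sgn.
by case: AB => AE BE; split=> //; move: AE BE B0 B0' LL; clear; lia.
Qed.

(** The equivalence would send the axes to the lines x = +- y; then p = +- r and q = +- s, which
    makes the determinant even. *)
Lemma class_type12_neq A B C A' B' C' : generic1 A B C -> generic2 A' B' C' ->
  GL2Z_class (type1 A B C) <> GL2Z_class (type2 A' B' C').
Proof.
move=> gen gen' /class_eq_sub [p [q [r [s [d1 eF]]]]].
have E := generic1_nonsquare gen.
have [eI eJ] := type1_invariants A B C; have [eI' eJ'] := type2_invariants A' B' C'.
have [sameI sameJ] := invariants_GL2Z d1 eF.
rewrite -/(type1 A B C) -/(type2 A' B' C') in sameI sameJ.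
rewrite -sameI -sameJ in eI' eJ'.
have LL := resolvent_root_unique eI eJ eI' eJ' E.
have cov x y : 12 * (B ^+ 2 - 4 * (A * C)) * (x * y) ^+ 2 =
    3 * (B' ^+ 2 + 8 * A' ^+ 2 - 4 * A' * C')
      * ((p * x + q * y) ^+ 2 - (r * x + s * y) ^+ 2) ^+ 2.
  by rewrite -square_cov_type2 -square_cov_type1 -LL; apply: square_cov_sub d1 eF.
have c10 : p ^+ 2 - r ^+ 2 = 0.
  apply: (mulz_sqr_eq0 (generic2_coef gen')).
  transitivity (12 * (B ^+ 2 - 4 * (A * C)) * (1 * 0) ^+ 2); last by ring.
  by rewrite cov; ring.
have c01 : q ^+ 2 - s ^+ 2 = 0.
  apply: (mulz_sqr_eq0 (generic2_coef gen')).
  transitivity (12 * (B ^+ 2 - 4 * (A * C)) * (0 * 1) ^+ 2); last by ring.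
  by rewrite cov; ring.
move/eqP: c10; move/eqP: c01; rewrite !subr_eq0 !eqf_sqr => c01 c10.
have even (k : int) : (2 * k) ^+ 2 = 1 -> False by rewrite exprMn; lia.
have [k kE] : exists k, p * s - q * r = 2 * k.
  case/orP: c01 => /eqP ->; case/orP: c10 => /eqP ->; [exists 0|exists (- (r * s))|
    exists (r * s)|exists 0]; ring.
by rewrite kE in d1; apply: even d1.
Qed.

Lemma square_covariant_intr (K : comNzRingType) (b4 b3 b2 b1 b0 L c : int)
    (f : {mpoly int[2]}) (F := quartic_form b4 b3 b2 b1 b0) :
  F4_covariant F + (4 * L) *: F = c *: f ^+ 2 ->
  F4_covariant (map_mpoly intr F : {mpoly K[2]}) + (4%:R * L%:~R) *: map_mpoly intr F =
  c%:~R *: (map_mpoly intr f) ^+ 2.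
Proof.
move=> /(congr1 (map_mpoly (intmul 1 : int -> K))).
rewrite rmorphD /= !(map_mpolyZ (intmul 1)) rmorphXn /= => <-.
by rewrite F4_covariant_intr /F F4_covariant_form !map_intr_form (rmorphM _ 4 L).
Qed.

(** * Generic normal forms in range are counted *)

Section HeightExists.
Variable R : realType.
Implicit Types (X h : R).

Lemma is_height_exists (b4 b3 b2 b1 b0 L E : int) (f : {mpoly int[2]}) (c : R[i]) X
    (F := quartic_form b4 b3 b2 b1 b0) :
  fixing_quadratic F f -> c != 0 ->
  F4_covariant (C_form R F) + (4%:R * L%:~R) *: C_form R F = c *: C_form R f ^+ 2 ->
  12 * I_inv F = 3 * L ^+ 2 + 9 * E -> J_inv F = 3 * I_inv F * L - L ^+ 3 ->
  in_range X L E -> exists2 h, is_height F h & h <= X.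
Proof.
move=> ff c0 cov eI eJ /andP[LX KX].
(* E may be negative, so the two other roots are built in [R[i]]; their product (L^2 - 9 E) / 4 is
   rational in any case. *)
pose dl : R[i] := sqrtC (9 * E)%:~R.
have dl2 : dl ^+ 2 = (9 * E)%:~R by rewrite sqrtCK.
pose w' : R[i] := (- L%:~R + dl) / 2; pose w'' : R[i] := (- L%:~R - dl) / 2.
have two0 : 2 != 0 :> R[i] by rewrite pnatr_eq0.
have sw : w' + w'' = - L%:~R by rewrite /w' /w''; field.
have pw : 4 * (w' * w'') = (L ^+ 2 - 9 * E)%:~R.
  by rewrite rmorphB rmorphXn /= -dl2 /w' /w''; field.
have I4 : 4 * (3 * (I_inv F)%:~R) = 3 * L%:~R ^+ 2 + (9 * E)%:~R :> R[i].
  rewrite mulrA -natrM -[12%:R]/(12%:~R) -rmorphM eI rmorphD (rmorphM _ 3) rmorphXn //.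
have four0 : 4 != 0 :> R[i] by rewrite pnatr_eq0.
have I3 : 3 * (I_inv F)%:~R = L%:~R ^+ 2 - w' * w''.
  by apply: (mulfI four0); rewrite mulrBr pw I4 rmorphB rmorphXn /=; ring.
have Jw : (J_inv F)%:~R = L%:~R * (3 * (I_inv F)%:~R) - L%:~R ^+ 3 :> R[i].
  by rewrite eJ rmorphB !rmorphM /=; ring.
have cub : cubic_resolvent (C_form R F) = ('X - (L%:~R)%:P) * ('X - w'%:P) * ('X - w''%:P).
  rewrite /cubic_resolvent I_inv_intr J_inv_intr Jw I3.
  have -> : w'' = - L%:~R - w' by rewrite -sw addrC addKr.
  by rewrite -!mul_polyC !(rmorphD, rmorphN, rmorphM, rmorphXn) /=; ring.
pose h : R := Num.max (L ^+ 2)%:~R (`|(9 * E - L ^+ 2)%:~R| / 4).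
exists h; last first.
  by rewrite ge_max LX ler_pdivrMr // (mulrC X).
exists f, L%:~R, w', w''; split=> //.
  split; last by exists c.
  by rewrite cub !rootM root_XsubC eqxx.
have KE : `|- (w' * w'')| = (`|(9 * E - L ^+ 2)%:~R| / 4)%:C%C.
  have -> : - (w' * w'') = ((9 * E - L ^+ 2)%:~R / 4)%:C%C.
    apply: (mulfI four0); rewrite mulrN pw.
    rewrite -[4 in RHS](rmorph_nat (real_complex R)) -rmorphM /= (mulrC 4%:R).
    by rewrite divfK ?pnatr_eq0 // -intr_RC -rmorphN opprB.
  rewrite normc_def /= expr0n addr0 sqrtr_sqr normrM.
  by rewrite [X in _ * X]ger0_norm // invr_ge0.
cbv zeta; rewrite KE -rmorphXn /= intr_RC /h /Order.max ltcR.
by case: ifP.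
Qed.

Lemma type1_counted X A B C : generic1 A B C -> in_range X (2 * B) (16 * (A * C)) ->
  counted_classes X (GL2Z_class (type1 A B C)).
Proof.
move=> gen rg; have [A0 nsq D] := gen.
have [sm nV] := type1_V_sm A0 nsq D; exists (type1 A B C) => //; split.
  split=> //; exists (mx2 1 0 0 (-1)); split; rewrite ?unitmx_int //.
  - by apply/eqP=> /matrixP/(_ 1 1); rewrite !mxE.
  - by apply/eqP=> /matrixP/(_ 0 0); rewrite !mxE.
  rewrite quartic_act_int; last by ring.
  by congr quartic_form; rewrite /sub4 /sub3 /sub2 /sub1 /sub0; ring.
have [eI eJ] := type1_invariants A B C.
have D0 : B ^+ 2 - 4 * (A * C) != 0 by apply: contraNneq (D 0) => ->.
pose c : R[i] := (12 * (B ^+ 2 - 4 * (A * C)))%:~R.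
have c0 : c != 0 by rewrite intr_eq0 mulf_neq0.
(* For f = x y, the matrix M_f is diag(1, -1). *)
apply: (is_height_exists (f := quadratic 0 1 0) _ c0 _ eI eJ rg).
  split; first exact: homog_quadratic.
  - by rewrite /primitive_quadratic; have [-> -> ->] := quadratic_coefs 0 1 (0 : int).
  - by rewrite /quadratic_disc; have [-> -> ->] := quadratic_coefs 0 1 (0 : int).
  - rewrite /Q_form map_quadratic M_quadE map_intr_form quartic_act_mx2 scale_quartic_form.
    by congr quartic_form; rewrite /sub4 /sub3 /sub2 /sub1 /sub0; field.
apply: square_covariant_intr; rewrite F4_covariant_form sqr_quadratic_form !scale_quartic_form add_quartic_form.
by congr quartic_form; rewrite /cov4 /cov3 /cov2 /cov1 /cov0; ring.
Qed.

Lemma type2_counted X A B C (m := 2 * A + 2 * B + C) (n := 2 * A - 2 * B + C) :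
  generic2 A B C -> in_range X (6 * A - C) (m * n) ->
  counted_classes X (GL2Z_class (type2 A B C)).
Proof.
move=> gen rg; have [m0 nsq D] := gen.
have [sm nV] := type2_V_sm m0 nsq D; exists (type2 A B C) => //; split.
  split=> //; exists (mx2 0 1 1 0); split; rewrite ?unitmx_int //.
  - by apply/eqP=> /matrixP/(_ 0 1); rewrite !mxE.
  - by apply/eqP=> /matrixP/(_ 0 1); rewrite !mxE.
  rewrite quartic_act_int; last by ring.
  by congr quartic_form; rewrite /sub4 /sub3 /sub2 /sub1 /sub0; ring.
have [eI eJ] := type2_invariants A B C.
have c0 : (3 * (B ^+ 2 + 8 * A ^+ 2 - 4 * A * C))%:~R != 0 :> R[i].
  by rewrite intr_eq0 generic2_coef.
(* For f = x^2 - y^2, the matrix M_f is -2 times the exchange of the variables. *)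
apply: (is_height_exists (f := quadratic 1 0 (-1)) _ c0 _ eI eJ rg).
  split; first exact: homog_quadratic.
  - by rewrite /primitive_quadratic; have [-> -> ->] := quadratic_coefs 1 0 (-1 : int).
  - by rewrite /quadratic_disc; have [-> -> ->] := quadratic_coefs 1 0 (-1 : int).
  - rewrite /Q_form map_quadratic M_quadE map_intr_form quartic_act_mx2 scale_quartic_form.
    by congr quartic_form; rewrite /sub4 /sub3 /sub2 /sub1 /sub0; field.
apply: square_covariant_intr; rewrite F4_covariant_form sqr_quadratic_form !scale_quartic_form add_quartic_form.
by congr quartic_form; rewrite /cov4 /cov3 /cov2 /cov1 /cov0; ring.
Qed.

End HeightExists.

End FixedQuartics.

(** * Counting the triples (m, L, n) *)

Module LatticePoints.
From mathcomp Require Import classical_sets topology normedtype exp.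
Import numFieldNormedType.Exports Ranges.
Set Implicit Arguments.
Unset Strict Implicit.
Unset Printing Implicit Defensive.

Definition zrange (N : nat) : seq int := [seq i%:Z - N%:Z | i <- iota 0 (2 * N).+1].

Lemma mem_zrange N (x : int) : (x \in zrange N) = (`|x| <= N)%N.
Proof.
apply/mapP/idP=> [[i]|xN]; first by rewrite mem_iota => iN ->; lia.
by exists (absz (x + N%:Z)); rewrite ?mem_iota; lia.
Qed.

Lemma zrange_uniq N : uniq (zrange N).
Proof. by rewrite map_inj_uniq ?iota_uniq // => i j; lia. Qed.

Lemma size_zrange N : size (zrange N) = (2 * N).+1.
Proof. by rewrite size_map size_iota. Qed.

Section Interval.
Variable R : realType.
Implicit Types x y a b X : R.

Lemma size_interval (s : seq int) x y : uniq s -> x <= y ->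
  (forall t : int, (t \in s) = (x <= t%:~R <= y)) -> `|(size s)%:R - (y - x)| <= 1.
Proof.
move=> us xy sE; set u := Num.ceil x; set v := Num.floor y.
have mem t : (t \in s) = (u <= t <= v) by rewrite sE ceil_le_int floor_ge_int.
have /andP[v1 v2] := floor_itv y; have /andP[u1 u2] := ceil_itv x.
rewrite -/v in v1 v2; rewrite -/u in u1 u2.
have uv : 0 <= v - u + 1.
  have : (-1 : R) < (v - u + 1)%:~R.
    rewrite !(rmorphD, rmorphB) /= in v2 u1 *; lra.
  by rewrite -[X in X < _]/((-1)%:~R) ltr_int; lia.
have su : (size s)%:Z = v - u + 1.
  have -> : size s = size [seq u + i%:Z | i <- iota 0 (absz (v - u + 1))].
    apply/perm_size/uniq_perm => //.
      by rewrite map_inj_uniq ?iota_uniq // => i j /addrI [].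
    move=> t; rewrite mem; apply/idP/mapP=> [tuv|[i]].
      exists (absz (t - u)); rewrite ?mem_iota; lia.
    rewrite mem_iota => il ->; lia.
  by rewrite size_map size_iota; lia.
have -> : (size s)%:R = v%:~R - u%:~R + 1 :> R.
  by rewrite -[LHS]/((size s)%:Z%:~R) su rmorphD rmorphB.
rewrite !(rmorphD, rmorphB) /= in v2 u1; rewrite ler_norml; lra.
Qed.

(** The map n -> (n - c) / q carries the progression to all integers of an interval of length (b -
    a) / q. *)
Lemma count_progression N (q : nat) (c : int) a b : (0 < q)%N -> a <= b ->
  (forall n : int, a <= n%:~R <= b -> (`|n| <= N)%N) ->
  `|(count (fun n : int => (q%:Z %| n - c)%Z && (a <= n%:~R <= b)) (zrange N))%:R
    - (b - a) / q%:R| <= 1.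
Proof.
move=> q0 ab abN; have q0' : (0 : R) < q%:R by rewrite ltr0n.
rewrite -size_filter; set s := [seq _ <- _ | _].
have -> : size s = size [seq ((n - c) %/ q%:Z)%Z | n <- s] by rewrite size_map.
have -> : (b - a) / q%:R = (b - c%:~R) / q%:R - (a - c%:~R) / q%:R.
  by rewrite -mulrBl; congr (_ / _); ring.
apply: size_interval.
- rewrite map_inj_in_uniq ?filter_uniq ?zrange_uniq // => n1 n2.
  rewrite !mem_filter => /andP[/andP[d1 _] _] /andP[/andP[d2 _] _] e.
  by apply: (addIr (- c)); rewrite -(divzK d1) -(divzK d2) e.
- by rewrite ler_pM2r ?invr_gt0 // lerD2r.
move=> t; rewrite ler_pdivrMr // ler_pdivlMr // lerBlDr lerBrDr.
have tE : t%:~R * q%:R + c%:~R = (t * q%:Z + c)%:~R :> R by rewrite rmorphD rmorphM.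
rewrite tE; apply/mapP/idP=> [[n]|tab].
  rewrite mem_filter => /andP[/andP[d nab] _] ->.
  by rewrite divzK // subrK.
exists (t * q%:Z + c).
  by rewrite mem_filter tab addrK dvdz_mull //= mem_zrange abN.
by rewrite addrK mulzK //; lia.
Qed.

(** Induction, with ln (1 + x) <= x at x = 1 / (N + 1) for the lower bound and at x = - 1 / (N + 1)
    for the upper one. *)
Lemma harmonic_ln N : (0 < N)%N ->
  ln (N.+1%:R : R) <= \sum_(1 <= k < N.+1) k%:R^-1 <= 1 + ln (N%:R : R).
Proof.
elim: N => // -[_ _|N IHN _].
  rewrite big_nat1 invr1 ln1 addr0 lexx andbT.
  by rewrite -[X in ln X]/(1 + 1) le_ln1Dx //; lra.
have /andP[h1 h2] := IHN isT; rewrite big_nat_recr //=.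
have p k : (0 : R) < k.+1%:R by rewrite ltr0n.
have lnS k : ln (k.+2%:R : R) = ln k.+1%:R + ln (1 + k.+1%:R^-1).
  rewrite -lnM ?posrE ?addr_gt0 ?invr_gt0 //; congr ln.
  by rewrite mulrDr mulr1 mulfV ?gt_eqF // -natr1.
have lnS' k : ln (k.+1%:R : R) = ln k.+2%:R + ln (1 - k.+2%:R^-1).
  rewrite -lnM ?posrE // ?subr_gt0 ?invf_lt1 ?ltr1n //; congr ln.
  by rewrite mulrBr mulr1 mulfV ?gt_eqF // -[k.+2%:R]natr1 addrK.
apply/andP; split.
  rewrite lnS lerD // le_ln1Dx // (lt_trans (ltrN10 _)) // invr_gt0 //.
have : ln (1 - N.+2%:R^-1) <= - N.+2%:R^-1 :> R.
  by rewrite le_ln1Dx // ltrN2 invf_lt1 ?ltr1n.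
move: h2; rewrite (lnS' N); move: (\sum_(_ <= _ < _) _) (N.+2%:R^-1) => S i.
by move: (ln (1 - i)) (ln _) => l1 l2; lra.
Qed.

Lemma harmonic_error X : 1 <= X ->
  `|\sum_(1 <= k < (Num.truncn X).+1) k%:R^-1 - ln X| <= 1.
Proof.
move=> X1; set N := Num.truncn X.
have X0 : 0 < X by apply: lt_le_trans X1.
have N0 : (0 < N)%N by rewrite truncn_gt0.
have /andP[h1 h2] := harmonic_ln N0.
have /andP[n1 n2] := truncn_itv (ltW X0).
have l1 : ln X <= ln (N.+1%:R : R) by rewrite ler_ln ?posrE ?ltr0n // ltW.
have l2 : ln (N%:R : R) <= ln X by rewrite ler_ln ?posrE ?ltr0n.
by rewrite ler_norml; lra.
Qed.

Lemma sum_zrange_inv N : \sum_(m <- zrange N | m != 0) `|m%:~R|^-1 =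
  2 * \sum_(1 <= k < N.+1) k%:R^-1 :> R.
Proof.
rewrite -big_filter.
have Hp : perm_eq [seq m <- zrange N | m != 0]
    ([seq k%:Z | k <- iota 1 N] ++ [seq - k%:Z | k <- iota 1 N]).
  apply: uniq_perm; first by rewrite filter_uniq ?zrange_uniq.
    rewrite cat_uniq !map_inj_uniq ?iota_uniq //=; last 2 first.
    - by move=> i j; lia.
    - by move=> i j; lia.
    rewrite andbT; apply/hasPn=> x /mapP[k]; rewrite mem_iota => k1 ->.
    by apply/negP=> /mapP[l]; rewrite mem_iota => l1 /= e; lia.
  move=> m; rewrite mem_filter mem_zrange mem_cat; apply/idP/idP.
    move=> /andP[m0 mN]; have [m1|m1] := lerP 0 m; apply/orP; [left|right]; apply/mapP;
      exists (absz m); rewrite ?mem_iota; lia.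
  by case/orP=> /mapP[k]; rewrite mem_iota => k1 ->; lia.
rewrite (perm_big _ Hp) big_cat !big_map /= mulr_natl mulr2n /index_iota subn1 /=.
by congr (_ + _); apply: eq_bigr => k _; rewrite ?rmorphN ?normrN normr_nat.
Qed.

End Interval.

Definition box (N : nat) : seq (int * int * int) :=
  [seq (p, n) | p <- [seq (m, L) | m <- zrange N, L <- zrange N], n <- zrange N].

Lemma mem_box N (m L n : int) : ((m, L, n) \in box N) =
  [&& (absz m <= N)%N, (absz L <= N)%N & (absz n <= N)%N].
Proof.
rewrite -!mem_zrange; apply/allpairsP/and3P=> [[[p n'] [pin n'N [e1 e2]]]|[mN LN nN]].
  by move: pin; rewrite -[(p, n').1]/p -e1 e2 => /allpairsP[[m2 L2] [m2N L2N [-> ->]]].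
exists ((m, L), n); split=> //.
by apply/allpairsP; exists (m, L).
Qed.

Lemma box_uniq N : uniq (box N).
Proof.
by apply: allpairs_uniq; rewrite ?allpairs_uniq ?zrange_uniq // => -[a b] [c d].
Qed.

Lemma size_box N : size (box N) = ((2 * N).+1 ^ 3)%N.
Proof. by rewrite !size_allpairs size_zrange -mulnA mulnn mulnC -expnSr. Qed.

Lemma count_box (P : pred (int * int * int)) N :
  count P (box N) = (\sum_(m <- zrange N) \sum_(L <- zrange N)
     count (fun n => P (m, L, n)) (zrange N))%N.
Proof.
rewrite -sum1_count big_mkcond big_allpairs_dep big_allpairs_dep /=.
apply: eq_bigr => m _; apply: eq_bigr => L _.
by rewrite -big_mkcond sum1_count.
Qed.

Lemma count_neq0_bounds (P : pred int) (s : seq int) : uniq s ->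
  (count (fun n : int => (n != 0) && P n) s <= count P s
     <= (count (fun n : int => (n != 0) && P n) s).+1)%N.
Proof.
move=> us; have -> : count P s = (count (fun n : int => (n != 0) && P n) s
    + count (fun n : int => (n == 0) && P n) s)%N.
  rewrite -count_predUI -[LHS]addn0 -[X in (_ + X)%N = _](count_pred0 s).
  by congr (_ + _)%N; apply: eq_count => n /=; case: (n =P 0) => [->|_]; case: (P _).
rewrite leq_addr -[(count _ s).+1]addn1 leq_add2l.
apply: (@leq_trans (count_mem 0 s)); last by rewrite count_uniq_mem //; case: (_ \in _).
by apply: sub_count => n /andP[].
Qed.

Section LatticeCount.
Variable R : realType.
Variables (e : int -> int) (c : int -> int -> int).
Implicit Types X : R.

(* m n is the quantity E of [in_range]; the congruences express that the coefficients
   of the form are integers. *)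
Definition lattice_point X (t : int * int * int) : bool :=
  let: (m, L, n) := t in
  [&& m != 0, n != 0, (2 %| L - e m)%Z, (16 %| n - c m L)%Z & in_range X L (m * n)].

Variable X : R.
Hypothesis X1 : 1 <= X.
Let N := Num.truncn X.

Lemma le_truncn_abs (n : int) : `|n%:~R| <= X -> (absz n <= N)%N.
Proof.
move=> nX; rewrite truncn_ge_nat; last by apply: le_trans X1.
by rewrite natr_absz intr_norm.
Qed.

(** An interval of length 8 X / (9 |m|) and modulus 16 give X / (18 |m|). The error 2 is one for the
    ends of the interval and one for the excluded value n = 0. *)
Lemma count_third (m L : int) : m != 0 -> (L ^+ 2)%:~R <= X ->
  `|(count (fun n => [&& n != 0, (16 %| n - c m L)%Z & `|(9 * (m * n) - L ^+ 2)%:~R| <= 4 * X])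
      (zrange N))%:R - X / 18 * `|m%:~R|^-1| <= 2.
Proof.
move=> m0 LX; have m0' : m%:~R != 0 :> R by rewrite intr_eq0.
have am : 0 < `|m%:~R : R| by rewrite normr_gt0.
have X0 : 0 < X by apply: lt_le_trans X1.
pose ctr : R := (L ^+ 2)%:~R / (9 * m%:~R); pose r : R := 4 * X / (9 * `|m%:~R|).
have r0 : 0 <= r by rewrite divr_ge0 // mulr_ge0 // ltW.
have inE (n : int) : (`|(9 * (m * n) - L ^+ 2)%:~R : R| <= 4 * X) = (ctr - r <= n%:~R <= ctr + r).
  rewrite -ler_distlC distrC /r ler_pdivlMr ?mulr_gt0 //.
  have -> : (9 * (m * n) - L ^+ 2)%:~R = (n%:~R - ctr) * (9 * m%:~R) :> R.
    by rewrite rmorphB !rmorphM /= /ctr; field.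
  by rewrite !normrM normr_nat.
pose P (n : int) := (16%:Z %| n - c m L)%Z && (ctr - r <= n%:~R <= ctr + r).
rewrite -(eq_count (a1 := fun n => (n != 0) && P n)); last by move=> n /=; rewrite inE.
have /andP[h1 h2] := count_neq0_bounds P (zrange_uniq N).
have key : `|(count P (zrange N))%:R - (ctr + r - (ctr - r)) / 16%:R| <= 1 :> R.
  apply: count_progression => //; first by lra.
  (* The interval lies inside the box because 9 |m n| <= 4 X + L^2 <= 5 X. *)
  move=> n; rewrite -inE => nb; apply: le_truncn_abs.
  have m1 : 1 <= `|m%:~R : R| by rewrite -intr_norm ler1z; lia.
  have : 9 * (`|m%:~R| * `|n%:~R|) <= 5 * X :> R.
    have -> : 9 * (`|m%:~R| * `|n%:~R|) = `|(9 * (m * n))%:~R| :> R.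
      by rewrite !rmorphM !normrM /= normr_nat.
    rewrite -[9 * _](subrK (L ^+ 2)) rmorphD /=; apply: le_trans (ler_normD _ _) _.
    have -> : 5 * X = 4 * X + X by ring.
    by rewrite lerD // ger0_norm // ler0z sqr_ge0.
  have := ler_wpM2r (normr_ge0 (n%:~R : R)) m1; rewrite mul1r.
  by move: (_ * _) => u; lra.
have rE : (ctr + r - (ctr - r)) / 16%:R = X / 18 * `|m%:~R|^-1.
  by rewrite /r; field; rewrite lt0r_neq0.
rewrite rE in key; rewrite -(ler_nat R) in h1; rewrite -(ler_nat R) -natr1 in h2.
by move: key h1 h2; rewrite !ler_norml; lra.
Qed.

End LatticeCount.

Section LatticeSum.
Variable R : realType.
Variables (e : int -> int) (c : int -> int -> int).

Lemma norm_sum_sub (I : Type) (s : seq I) (P : pred I) (F : I -> R) (a b : R) :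
  (forall i, P i -> `|F i - a| <= b) ->
  `|\sum_(i <- s | P i) F i - (count P s)%:R * a| <= (count P s)%:R * b.
Proof.
move=> H; rewrite -!sum1_count !natr_sum !mulr_suml -sumrB.
apply: le_trans (ler_norm_sum _ _ _) _.
by apply: ler_sum => i /H; rewrite !mul1r.
Qed.

Lemma ln_le_sqrt (X : R) : 1 <= X -> ln X <= 2 * Num.sqrt X.
Proof.
move=> X1; have X0 : 0 < X by apply: lt_le_trans X1.
have s0 : 0 < Num.sqrt X by rewrite sqrtr_gt0.
rewrite -[X in ln X](sqr_sqrtr (ltW X0)) lnXn // mulr_natl lerMn2r /=.
have := @le_ln1Dx R (Num.sqrt X - 1); rewrite [1 + _]addrC subrK => h.
by apply: le_trans (h _) _; lra.
Qed.

Variable X : R.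
Hypothesis X1 : 1 <= X.
Let N := Num.truncn X.
Let S := Num.sqrt X.

Lemma sqrt_ge1 : 1 <= S.
Proof. by rewrite -[1]sqrtr1 ler_sqrt // (le_trans ler01). Qed.

Lemma sqr_sqrt : S * S = X.
Proof. by rewrite -expr2 sqr_sqrtr // (le_trans ler01). Qed.

Lemma count_second (m : int) :
  `|(count (fun L => (2 %| L - e m)%Z && ((L ^+ 2)%:~R <= X)) (zrange N))%:R - S| <= 1.
Proof.
have S1 := sqrt_ge1; have SS := sqr_sqrt.
rewrite -(eq_count (a1 := fun L : int => (2%:Z %| L - e m)%Z && (- S <= L%:~R <= S))); last first.
  move=> L /=; congr (_ && _); rewrite -ler_norml rmorphXn /= -[(_ ^+ 2) in RHS]real_normK ?num_real //.
  by rewrite -SS -expr2 ler_sqr // ?nnegrE // (le_trans ler01).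
have key : `|(count (fun L : int => (2%:Z %| L - e m)%Z && (- S <= L%:~R <= S)) (zrange N))%:R
    - (S - - S) / 2%:R| <= 1 :> R.
  apply: count_progression => //; first by lra.
  move=> L; rewrite -ler_norml => LS; apply: (le_truncn_abs X1).
  by apply: (le_trans LS); rewrite -SS ler_peMl //; lra.
by move: key; rewrite (_ : (S - - S) / 2%:R = S) //; field.
Qed.

(** There are S +- 1 values of L. Each costs an error 2 in [count_third], and the uncertainty in
    their number costs one main term. *)
Lemma count_first (m : int) : m != 0 ->
  `|(\sum_(L <- zrange N) count (fun n => lattice_point e c X (m, L, n)) (zrange N))%:R
     - S * (X / 18 * `|m%:~R|^-1)| <= 2 * (S + 1) + X / 18 * `|m%:~R|^-1 :> R.
Proof.
move=> m0; set a := X / 18 * _; pose D L := (2 %| L - e m)%Z && ((L ^+ 2)%:~R <= X).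
have a0 : 0 <= a by rewrite mulr_ge0 ?invr_ge0 // divr_ge0 // (le_trans ler01).
pose Q L n := [&& n != 0, (16 %| n - c m L)%Z & `|(9 * (m * n) - L ^+ 2)%:~R| <= 4 * X].
have -> : (\sum_(L <- zrange N) count (fun n => lattice_point e c X (m, L, n)) (zrange N)
    = \sum_(L <- zrange N | D L) count (Q L) (zrange N))%N.
  rewrite [RHS]big_mkcond; apply: eq_bigr => L _; rewrite /D.
  case: ifP => [/andP[d LX]|dL].
    by apply: eq_count => n; rewrite /= /in_range m0 d LX.
  rewrite -[RHS](count_pred0 (zrange N)); apply: eq_count => n /=.
  rewrite /in_range; apply/negP=> /and5P[_ _ d _ /andP[LX _]].
  by rewrite d LX in dL.
rewrite natr_sum.
have h1 : `|\sum_(L <- zrange N | D L) (count (Q L) (zrange N))%:R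
    - (count D (zrange N))%:R * a| <= (count D (zrange N))%:R * 2.
  by apply: norm_sum_sub => L /andP[_ LX]; apply: count_third.
have := count_second m; rewrite -/(D _).
move: (count D _)%:R h1 => d h1 h2.
have h3 : `|d * a - S * a| <= a by rewrite -mulrBl normrM (ger0_norm a0) ler_piMl.
move: h1 h2 h3; rewrite !ler_norml; move: (d * a) (S * a) => u v; lra.
Qed.

Lemma lattice_count :
  `|(count (lattice_point e c X) (box N))%:R - 1 / 9 * (X * S) * ln X| <= 13 * (X * S).
Proof.
have S1 := sqrt_ge1; have SS := sqr_sqrt.
have X0 : 0 <= X by apply: le_trans X1.
pose G m := (\sum_(L <- zrange N) count (fun n => lattice_point e c X (m, L, n)) (zrange N))%N.
have -> : count (lattice_point e c X) (box N) = (\sum_(m <- zrange N | m != 0%Z) G m)%N.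
  rewrite count_box [RHS]big_mkcond; apply: eq_bigr => m _; case: ifP => // /negbFE m0.
  by rewrite big1 // => L _; rewrite -[RHS](count_pred0 (zrange N)); apply: eq_count => n /=; rewrite m0.
rewrite natr_sum; set H := \sum_(1 <= k < N.+1) k%:R^-1 : R.
pose a (m : int) : R := X / 18 * `|m%:~R|^-1.
have sa : \sum_(m <- zrange N | m != 0) a m = X / 9 * H.
  by rewrite -mulr_sumr sum_zrange_inv -/H; field.
have h1 : `|\sum_(m <- zrange N | m != 0) (G m)%:R - S * (X / 9 * H)|
    <= \sum_(m <- zrange N | m != 0) (2 * (S + 1) + a m).
  rewrite -sa mulr_sumr -sumrB; apply: le_trans (ler_norm_sum _ _ _) _.
  by apply: ler_sum => m; apply: count_first.
have cN : (count (fun m : int => m != 0) (zrange N))%:R <= 3 * X :> R.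
  have : (count (fun m : int => m != 0) (zrange N) <= (2 * N).+1)%N.
    by rewrite -(size_zrange N) count_size.
  rewrite -(ler_nat R) => /le_trans; apply.
  have /andP[NX _] := truncn_itv X0; rewrite -/N in NX.
  by rewrite -natr1 natrM; have := X1; move: (N%:R : R) NX => n nX ?; lra.
rewrite big_split /= sa big_const_seq iter_addr_0 -[_ *+ count _ _]mulr_natr in h1.
have h2 := harmonic_error X1; rewrite -/N -/H in h2.
have lX := ln_le_sqrt X1; rewrite -/S in lX.
have XS : X <= X * S by rewrite ler_peMr.
(* The three errors h3, h4, h5 amount to 12 + 1/3 + 1/9 < 13 times X S. For h4, the harmonic sum is
   at most 1 + ln X <= 3 S. *)
have h3 : (2 * (S + 1)) * (count (fun m : int => m != 0) (zrange N))%:R <= 12 * (X * S).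
  apply: (@le_trans _ _ ((2 * (S + 1)) * (3 * X))); first by rewrite ler_wpM2l //; lra.
  by lra.
have h4 : X / 9 * H <= X / 3 * S.
  have -> : X / 3 * S = X / 9 * (3 * S) by field.
  by rewrite ler_wpM2l ?divr_ge0 //; move: h2; rewrite ler_norml; lra.
have h5 : `|S * (X / 9 * H) - 1 / 9 * (X * S) * ln X| <= X * S / 9.
  have -> : S * (X / 9 * H) - 1 / 9 * (X * S) * ln X = X * S / 9 * (H - ln X) by field.
  have p0 : 0 <= X * S / 9 by rewrite divr_ge0 ?mulr_ge0 // (le_trans ler01).
  by rewrite normrM (ger0_norm p0) ler_piMr.
move: h1 h3 h4 h5; rewrite !ler_norml.
move=> /andP[? ?] ? ? /andP[? ?]; apply/andP; split; lra.
Qed.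
End LatticeSum.

(** The involution exchanges key <= 0 with key >= 0, and these two halves overlap where key = 0. *)
Lemma count_half (T : eqType) (s : seq T) (V : pred T) (key : T -> int) (i : T -> T) :
  uniq s -> (forall t, t \in s -> V t -> [/\ i t \in s, V (i t), i (i t) = t & key (i t) = - key t]) ->
  (2 * count (fun t => V t && (key t <= 0)%R) s =
   count V s + count (fun t => V t && (key t == 0)%R) s)%N.
Proof.
move=> us H; set P := fun t => V t && (key t <= 0); pose Q t := V t && (0 <= key t).
have PQ : count P s = count Q s.
  rewrite -!size_filter -(size_map i [seq t <- s | P t]); apply/perm_size/uniq_perm.
  - rewrite map_inj_in_uniq ?filter_uniq // => x y; rewrite !mem_filter.
    move=> /andP[/andP[Vx _] xs] /andP[/andP[Vy _] ys] e.
    by have [_ _ <- _] := H x xs Vx; have [_ _ <- _] := H y ys Vy; rewrite e.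
  - by rewrite filter_uniq.
  move=> t; rewrite mem_filter; apply/mapP/andP=> [[u]|[/andP[Vt kt] ts]].
    rewrite mem_filter => /andP[/andP[Vu ku] us'] ->; have [its iV _ ik] := H u us' Vu.
    by rewrite /Q its iV ik oppr_ge0.
  have [its iV ii ik] := H t ts Vt; exists (i t) => //.
  by rewrite mem_filter /P its iV ik oppr_le0 kt.
rewrite mul2n -addnn {2}PQ -count_predUI; congr (_ + _)%N; apply: eq_count => t /=.
  by rewrite /P /Q -andb_orr le_total andbT.
by rewrite /P /Q; case: (V t) => //=; rewrite -eq_le.
Qed.

(** * The triples of the two families, their symmetries and the exceptional squares *)

Section Triples.
Variable R : realType.
Implicit Types X : R.

Definition lattice1 X := lattice_point (fun _ => 0) (fun _ _ => 0) X.
(** Inverting the parametrisation gives m + n + 2 L = 16 A, C = 6 A - L and m - n = 4 B. Once 16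
    divides m + n + 2 L, the last equation is solvable exactly when L - m is even. *)
Definition lattice2 X := lattice_point id (fun m L => - (2 * L) - m) X.
(** [key1] is 16 (A - C) and [key2] is - 4 B; the symmetries A <-> C and B <-> - B negate them. *)
Definition key1 (t : int * int * int) : int := 16 * t.1.1 - t.2.
Definition key2 (t : int * int * int) : int := t.2 - t.1.1.

(* Contains the (m, L, n) such that m n or L^2 - m n is a square j^2: one of m and n is at
   most sqrt |m n| in absolute value, and with j and L it determines the other. *)
Definition sqr_cover (K : nat) : seq (int * int * int) :=
  [seq (t.1.1, t.2, ((t.1.2 ^+ 2) %/ t.1.1)%Z) | t <- box K] ++
  [seq (((t.1.2 ^+ 2) %/ t.1.1)%Z, t.2, t.1.1) | t <- box K] ++
  [seq (t.1.1, t.2, ((t.2 ^+ 2 - t.1.2 ^+ 2) %/ t.1.1)%Z) | t <- box K] ++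
  [seq (((t.2 ^+ 2 - t.1.2 ^+ 2) %/ t.1.1)%Z, t.2, t.1.1) | t <- box K].

Lemma size_sqr_cover K : size (sqr_cover K) = (4 * (2 * K).+1 ^ 3)%N.
Proof. by rewrite !size_cat !size_map size_box; lia. Qed.

Lemma min_factor (m n q : int) (K : nat) : m * n = q -> (absz q <= K ^ 2)%N ->
  (absz m <= K)%N || (absz n <= K)%N.
Proof.
move=> <-; rewrite abszM; apply: contraLR; rewrite negb_or -!ltnNge => /andP[h1 h2].
by rewrite -mulnn ltn_mul.
Qed.

Lemma sqr_coverP (m n L j : int) (K : nat) : m != 0 -> n != 0 ->
  m * n = j ^+ 2 \/ m * n = L ^+ 2 - j ^+ 2 ->
  (absz (m * n)%R <= K ^ 2)%N -> (absz L <= K)%N -> (absz j <= K)%N -> (m, L, n) \in sqr_cover K.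
Proof.
move=> m0 n0 mnj mnK LK jK; rewrite !mem_cat.
have [mK|nK] := orP (min_factor (erefl _) mnK).
  have tb : (m, j, L) \in box K by rewrite mem_box mK jK.
  case: mnj => e; apply/or4P; [apply: Or41|apply: Or43]; apply/mapP; exists (m, j, L) => //=;
    by rewrite -e mulrC mulzK.
have tb : (n, j, L) \in box K by rewrite mem_box nK jK.
by case: mnj => e; apply/or4P; [apply: Or42|apply: Or44]; apply/mapP; exists (n, j, L) => //=;
  rewrite -e mulzK.
Qed.

Variable X : R.
Hypothesis X1 : 1 <= X.
(** The factor 2 makes K bound every integer j with j^2 <= 4 X, and K > 2 sqrt X - 1 >= sqrt X
    ensures X <= K^2, as [min_factor] requires. *)
Let K := Num.truncn (2 * Num.sqrt X).

Lemma sqr_le_truncn (a : int) : (a ^+ 2)%:~R <= 4 * X -> (absz a <= K)%N.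
Proof.
move=> aX; rewrite truncn_ge_nat ?mulr_ge0 ?sqrtr_ge0 //.
have -> : 2 * Num.sqrt X = Num.sqrt (4 * X).
  by rewrite sqrtrM // -[4]/(2 * 2)%:R natrM -expr2 sqrtr_sqr normr_nat.
by rewrite natr_absz intr_norm -sqrtr_sqr ler_wsqrtr // -rmorphXn.
Qed.

Lemma mul_le_truncn (q : int) : `|q%:~R| <= X -> (absz q <= K ^ 2)%N.
Proof.
move=> qX; have S1 := sqrt_ge1 X1; have SS := sqr_sqrt X1.
have S0 : 0 <= 2 * Num.sqrt X by rewrite mulr_ge0 // sqrtr_ge0.
have /andP[_ KX] := truncn_itv S0; rewrite -/K -natr1 in KX.
rewrite -(ler_nat R) natr_absz intr_norm natrX; apply: (le_trans qX).
rewrite -SS -expr2 ler_sqr ?nnegrE ?sqrtr_ge0 ?ler0n //; lra.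
Qed.

Lemma in_range_abs (L q : int) : in_range X L q ->
  (L ^+ 2)%:~R <= X /\ `|q%:~R| <= X.
Proof.
move=> /andP[LX]; rewrite ler_norml rmorphB /= rmorphM /= => /andP[h1 h2]; split=> //.
have L0 : 0 <= (L ^+ 2)%:~R :> R by rewrite ler0z sqr_ge0.
by have := X1; rewrite ler_norml; move: (_ ^+ 2)%:~R (q%:~R) LX L0 h1 h2 => u v; lra.
Qed.

Lemma abs_int_le (a b : int) : (absz a <= absz b)%N -> `|b%:~R| <= X -> `|a%:~R| <= X.
Proof.
move=> ab; apply: le_trans.
by rewrite -!intr_norm ler_int -!abszE lez_nat.
Qed.

Lemma sqr_le4 (a : int) : `|a%:~R| <= X -> a%:~R <= 4 * X.
Proof. by have := X1; rewrite ler_norml => ? /andP[? ?]; lra. Qed.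

Lemma lattice_point_box e c t : lattice_point e c X t -> t \in box (Num.truncn X).
Proof.
case: t => [[m L] n] /and5P[m0 n0 _ _ /in_range_abs[LX mnX]].
rewrite mem_box !le_truncn_abs //.
- by apply: abs_int_le mnX; rewrite abszM leq_pmull // absz_gt0.
- apply: (@abs_int_le _ (L ^+ 2)); first by rewrite abszX; case: (absz L) => // k; rewrite -mulnn leq_pmull.
  by rewrite ger0_norm // ler0z sqr_ge0.
- by apply: abs_int_le mnX; rewrite abszM leq_pmulr // absz_gt0.
Qed.

(** Both L^2 and |m n| are at most X, so j^2 <= 2 X in either case. *)
Lemma lattice_sqr_cover (m n L j : int) : m != 0 -> n != 0 -> in_range X L (m * n) ->
  m * n = j ^+ 2 \/ L ^+ 2 - m * n = j ^+ 2 -> (m, L, n) \in sqr_cover K.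
Proof.
move=> m0 n0 /in_range_abs[LX mnX] mnj.
have jX : (j ^+ 2)%:~R <= 4 * X.
  case: mnj => <-; first exact: sqr_le4.
  by move: mnX; have := X1; rewrite ler_norml rmorphB /= => ? /andP[? ?]; lra.
apply: (@sqr_coverP _ _ _ j) => //.
- by case: mnj => [|<-]; [left | right; rewrite subKr].
- exact: mul_le_truncn.
- by apply: sqr_le_truncn; have := X1; lra.
- exact: sqr_le_truncn.
Qed.

Lemma small_sqr_cover (m n L j : int) : m != 0 -> n != 0 -> small_range X L (m * n) ->
  m * n = j ^+ 2 -> (m, L, n) \in sqr_cover K.
Proof.
rewrite /small_range => m0 n0 + e; rewrite e rmorphD !rmorphM /= => LX.
have [L0 j0] : 0 <= (L ^+ 2)%:~R :> R /\ 0 <= (j ^+ 2)%:~R :> R by rewrite !ler0z !sqr_ge0.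
have LK : (absz L <= K)%N by apply: sqr_le_truncn; rewrite !rmorphXn /= in LX L0 j0 *; lra.
have jK : (absz j <= K)%N by apply: sqr_le_truncn; rewrite !rmorphXn /= in LX L0 j0 *; lra.
apply: (@sqr_coverP _ _ _ j) => //; first by left.
by rewrite e abszX leq_sqr.
Qed.

Lemma small_type3_box (A B C : int) :
  small_range X (- (6 * A + C)) ((2 * A - C) ^+ 2 + 4 * B ^+ 2) -> (A, B, C) \in box K.
Proof.
rewrite /small_range.
have -> : 3 * (- (6 * A + C)) ^+ 2 + 9 * ((2 * A - C) ^+ 2 + 4 * B ^+ 2) =
   144 * A ^+ 2 + 36 * B ^+ 2 + 12 * C ^+ 2 by ring.
rewrite !rmorphD !rmorphM /= => h.
have [A0 B0 C0] : [/\ 0 <= (A ^+ 2)%:~R :> R, 0 <= (B ^+ 2)%:~R :> R & 0 <= (C ^+ 2)%:~R :> R].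
  by rewrite !ler0z !sqr_ge0.
rewrite !rmorphXn /= in h A0 B0 C0.
by rewrite mem_box !sqr_le_truncn // rmorphXn /=; lra.
Qed.

(** A point with n = k(m) is determined by m and L, and m^2 <= |m n| <= X. The third coordinate 0 in
    the proof embeds these pairs in a box, so that the error has the same shape as the others. *)
Lemma count_diag e c (k : int -> int) (P : pred (int * int * int)) :
  (forall t, P t -> lattice_point e c X t /\ t.2 = k t.1.1) ->
  (forall m : int, (absz m <= absz (k m))%N) ->
  (count P (box (Num.truncn X)) <= (2 * K).+1 ^ 3)%N.
Proof.
move=> H kk; rewrite -size_filter -size_box -[leqRHS](size_map (fun t => (t.1.1, t.1.2, k t.1.1))).
apply: uniq_leq_size; first by rewrite filter_uniq ?box_uniq.
move=> [[m L] n]; rewrite mem_filter => /andP[/H[/and5P[m0 n0 _ _ /in_range_abs[LX mnX]] e2] _]; have {e2} nE : n = k m := e2.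
apply/mapP; exists (m, L, 0); last by rewrite nE.
rewrite mem_box andbT !sqr_le_truncn //; first by have := X1; lra.
apply: sqr_le4; apply: abs_int_le mnX; rewrite nE abszX abszM -mulnn leq_mul //.
Qed.

Definition half1 := [seq t <- box (Num.truncn X) | lattice1 X t && (key1 t <= 0)].
Definition half2 := [seq t <- box (Num.truncn X) | lattice2 X t && (key2 t <= 0)].

Lemma size_half1 : (count (lattice1 X) (box (Num.truncn X)) <= 2 * size half1
   <= count (lattice1 X) (box (Num.truncn X)) + (2 * K).+1 ^ 3)%N.
Proof.
(* With m = A and n = 16 C, this involution is the exchange A <-> C. *)
rewrite size_filter (count_half (i := fun t => ((t.2 %/ 16)%Z, t.1.2, 16 * t.1.1))) ?box_uniq //.
  rewrite leq_addr leq_add2l (count_diag (e := fun _ => 0) (c := fun _ _ => 0) (k := fun m => 16 * m)) //.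
    by move=> [[m L] n] /andP[V]; rewrite subr_eq0 => /eqP.
  by move=> m; rewrite abszM leq_pmull.
move=> [[m L] n] _ V; have /and5P[m0 n0 dL + r] := V.
rewrite subr0 => /dvdzP[k nE]; subst n.
have V' : lattice1 X (k, L, 16 * m).
  apply/and5P; split=> //.
  - by apply: contraNneq n0 => ->; rewrite mul0r.
  - by rewrite mulf_neq0.
  - by rewrite subr0 dvdz_mulr.
  - by have -> : k * (16 * m) = m * (k * 16) by ring.
rewrite /key1 /= mulzK //; split=> //; first exact: lattice_point_box V'.
  by rewrite mulKz // mulrC.
by rewrite opprB [k * 16]mulrC.
Qed.

Lemma size_half2 : (count (lattice2 X) (box (Num.truncn X)) <= 2 * size half2
   <= count (lattice2 X) (box (Num.truncn X)) + (2 * K).+1 ^ 3)%N.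
Proof.
rewrite size_filter (count_half (i := fun t => (t.2, t.1.2, t.1.1))) ?box_uniq //.
  rewrite leq_addr leq_add2l (count_diag (e := id) (c := fun m L => - (2 * L) - m) (k := id)) //.
  by move=> [[m L] n] /andP[V]; rewrite subr_eq0 => /eqP.
move=> [[m L] n] _ V; have /and5P[m0 n0 /dvdzP[u uE] /dvdzP[v vE] r] := V.
have V' : lattice2 X (n, L, m).
  apply/and5P; split=> //.
  (* From L = m + 2 u and n = 16 v - 2 L - m one gets L - n = 3 L + m - 16 v = 2 (3 u + 2 m - 8
     v). *)
  - by apply/dvdzP; exists (3 * u + 2 * m - 8 * v); rewrite /= in uE vE *; lia.
  - by apply/dvdzP; exists v; rewrite /= in vE *; lia.
  - by rewrite mulrC.
by split=> //; [exact: lattice_point_box V' | rewrite opprB].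
Qed.

(** Two families, each halved, restore the constant 1/9 of a single lattice count. *)
Lemma half_count :
  `|(size half1 + size half2)%:R - 1 / 9 * (X * Num.sqrt X) * ln X|
    <= 13 * (X * Num.sqrt X) + ((2 * K).+1 ^ 3)%:R :> R.
Proof.
have l1 := lattice_count (fun _ => 0) (fun _ _ => 0) X1.
have l2 := lattice_count id (fun m L => - (2 * L) - m) X1.
have /andP[] := size_half1; have /andP[] := size_half2.
rewrite /lattice1 /lattice2; move: l1 l2; set M := 1 / 9 * _ * _; set u := X * _.
move: (count _ _) (count _ _) (size half1) (size half2) (_ ^ 3)%N => c1 c2 h1 h2 k.
rewrite !ler_norml => /andP[? ?] /andP[? ?] p1 p2 p3 p4.
have {}p1 : c1%:R <= 2%:R * h2%:R :> R by rewrite -natrM ler_nat.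
have {}p2 : 2%:R * h2%:R <= c1%:R + k%:R :> R by rewrite -natrM -natrD ler_nat.
have {}p3 : c2%:R <= 2%:R * h1%:R :> R by rewrite -natrM ler_nat.
have {}p4 : 2%:R * h1%:R <= c2%:R + k%:R :> R by rewrite -natrM -natrD ler_nat.
by rewrite natrD; apply/andP; split; lra.
Qed.

End Triples.

End LatticePoints.

(** * From triples to classes *)

Module ClassCount.
From mathcomp Require Import all_fingroup all_solvable all_field.
From mathcomp Require Import boolp classical_sets functions cardinality.
From mathcomp Require Import finmap complex mpoly.
Import Ranges FixedQuartics LatticePoints.
Set Implicit Arguments.
Unset Strict Implicit.
Unset Printing Implicit Defensive.

(** Finiteness is part of the conclusion because [fset_set] is empty on infinite sets. *)
Lemma leq_card_fset_set (T : choiceType) (A : set T) (s : seq T) :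
  (forall x, A x -> x \in s) -> finite_set A /\ (#|` fset_set A| <= size s)%N.
Proof.
move=> As; have fA : finite_set A by apply: (@sub_finite_set _ A [set` s]%classic); last exact: finite_seq.
split=> //; apply: uniq_leq_size; first exact: fset_uniq.
by move=> x; rewrite in_fset_set // => /set_mem/As.
Qed.

Lemma geq_card_fset_set (T : choiceType) (A : set T) (s : seq T) :
  finite_set A -> uniq s -> (forall x, x \in s -> A x) -> (size s <= #|` fset_set A|)%N.
Proof.
move=> fA us sA; apply: uniq_leq_size => // x xs.
by rewrite in_fset_set //; apply/mem_set/sA.
Qed.

Section Counting.
Variable R : realType.
Variable X : R.
Hypothesis X1 : 1 <= X.
Let K := Num.truncn (2 * Num.sqrt X).

Definition class1 (t : int * int * int) : set {mpoly int[2]} :=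
  GL2Z_class (type1 t.1.1 (t.1.2 %/ 2)%Z (t.2 %/ 16)%Z).
Definition class2 (t : int * int * int) : set {mpoly int[2]} :=
  let A := ((t.1.1 + t.2 + 2 * t.1.2) %/ 16)%Z in
  GL2Z_class (type2 A ((t.1.1 - t.2) %/ 4)%Z (6 * A - t.1.2)).
Definition class3 (t : int * int * int) : set {mpoly int[2]} :=
  GL2Z_class (type3 t.1.1 t.1.2 t.2).

Lemma class1E A B C : class1 (A, 2 * B, 16 * C) = GL2Z_class (type1 A B C).
Proof. by rewrite /class1 !mulKz. Qed.

Lemma class2E A B C :
  class2 (2 * A + 2 * B + C, 6 * A - C, 2 * A - 2 * B + C) = GL2Z_class (type2 A B C).
Proof.
rewrite /class2 -[_.1.1]/(2 * A + 2 * B + C) -[_.1.2]/(6 * A - C) -[_.2]/(2 * A - 2 * B + C).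
have -> : 2 * A + 2 * B + C + (2 * A - 2 * B + C) + 2 * (6 * A - C) = 16 * A by ring.
have -> : 2 * A + 2 * B + C - (2 * A - 2 * B + C) = 4 * B by ring.
by rewrite (@mulKz A 16 isT) (@mulKz B 4 isT) subKr.
Qed.

Lemma lattice1P t : lattice1 X t -> exists A B C : int,
  [/\ t = (A, 2 * B, 16 * C), A != 0, C != 0 & in_range X (2 * B) (16 * (A * C))].
Proof.
case: t => [[m L] n] /and5P[m0 n0]; rewrite !subr0 => /dvdzP[B ->] /dvdzP[C nE] r; subst n.
exists m, B, C; rewrite ![2 * _]mulrC [16 * C]mulrC; split=> //.
  by apply: contraNneq n0 => ->; rewrite mul0r.
by have -> : 16 * (m * C) = m * (C * 16) by ring.
Qed.

Lemma lattice2P t : lattice2 X t -> exists A B C : int,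
  [/\ t = (2 * A + 2 * B + C, 6 * A - C, 2 * A - 2 * B + C), 2 * A + 2 * B + C != 0,
      2 * A - 2 * B + C != 0 & in_range X (6 * A - C) ((2 * A + 2 * B + C) * (2 * A - 2 * B + C))].
Proof.
case: t => [[m L] n] /and5P[m0 n0 /dvdzP[u uE] /dvdzP[v vE] r]; rewrite /= in uE vE.
pose A := v; pose C := 6 * A - L; pose B := L + u - 4 * v + m - L.
have mE : 2 * A + 2 * B + C = m by rewrite /B /C /A; lia.
have nE : 2 * A - 2 * B + C = n by rewrite /B /C /A; lia.
by exists A, B, C; rewrite mE nE /C subKr.
Qed.

Lemma case1_half A B C : case_type1 X A B C -> (A, 2 * B, 16 * C) \in half1 X.
Proof.
move=> /and4P[A0 C0 AC r].
have V : lattice1 X (A, 2 * B, 16 * C).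
  apply/and5P; split; rewrite ?subr0 ?dvdz_mulr ?mulf_neq0 //.
  have -> : A * (16 * C) = 16 * (A * C) by ring.
  exact: r.
by rewrite mem_filter V (lattice_point_box X1 V) andbT /key1 -mulrBr /=; lia.
Qed.

Lemma case2_half A B C : case_type2 X A B C ->
  (2 * A + 2 * B + C, 6 * A - C, 2 * A - 2 * B + C) \in half2 X.
Proof.
move=> /and4P[m0 n0 B0 r].
have V : lattice2 X (2 * A + 2 * B + C, 6 * A - C, 2 * A - 2 * B + C).
  apply/and5P; split=> //; apply/dvdzP.
    by exists (2 * A - B - C); ring.
  by exists A; ring.
by rewrite mem_filter V (lattice_point_box X1 V) andbT /key2 /=; lia.
Qed.

Lemma square1_cover A B C : case_square1 X A B C -> (A, 2 * B, 16 * C) \in sqr_cover K.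
Proof.
move=> [A0 C0 [j ACj] r]; apply: (@small_sqr_cover _ _ _ _ _ (4 * j)) => //.
- by rewrite mulf_neq0.
- have -> : A * (16 * C) = 16 * (A * C) by ring.
  exact: r.
- have -> : A * (16 * C) = 16 * (A * C) by ring.
  by rewrite ACj; ring.
Qed.

Lemma square2_cover A B C : case_square2 X A B C ->
  (2 * A + 2 * B + C, 6 * A - C, 2 * A - 2 * B + C) \in sqr_cover K.
Proof. by move=> [m0 n0 [j mnj] r]; apply: (@small_sqr_cover _ _ _ _ _ j). Qed.

Lemma counted_sub G : counted_classes X G ->
  G \in [seq class1 t | t <- half1 X ++ sqr_cover K] ++
        [seq class2 t | t <- half2 X ++ sqr_cover K] ++ [seq class3 t | t <- box K].
Proof.
move=> /counted_class_cases[A [B [C cases]]]; rewrite mem_cat mem_cat.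
case: cases => [[cs ->]|[[cs ->]|[cs ->]]].
- apply/orP; left; apply/mapP; exists (A, 2 * B, 16 * C); last by rewrite class1E.
  by rewrite mem_cat; apply/orP; case: cs => [/case1_half|/square1_cover]; [left|right].
- apply/orP; right; apply/orP; left; apply/mapP.
  exists (2 * A + 2 * B + C, 6 * A - C, 2 * A - 2 * B + C); last by rewrite class2E.
  by rewrite mem_cat; apply/orP; case: cs => [/case2_half|/square2_cover]; [left|right].
apply/orP; right; apply/orP; right; apply/mapP; exists (A, B, C) => //.
exact: small_type3_box.
Qed.

(** Outside the cover neither m n nor L^2 - m n is a square, which is what [generic1] and [generic2]
    demand. *)
Definition generic_half1 := [seq t <- half1 X | t \notin sqr_cover K].
Definition generic_half2 := [seq t <- half2 X | t \notin sqr_cover K].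

Lemma generic_half1P t : t \in generic_half1 -> exists A B C : int,
  [/\ t = (A, 2 * B, 16 * C), generic1 A B C, A <= C & in_range X (2 * B) (16 * (A * C))].
Proof.
rewrite mem_filter mem_filter => /and3P[tn /andP[/lattice1P[A [B [C [te A0 C0 r]]]] k] _].
exists A, B, C; split=> //; last by move: k; rewrite te /key1 /= -mulrBr; lia.
have E : A * (16 * C) = 16 * (A * C) by ring.
have C0' : 16 * C != 0 by rewrite mulf_neq0.
split=> // j; apply/eqP=> e; case/negP: tn; rewrite te.
  by apply: (@lattice_sqr_cover _ _ X1 _ _ _ (4 * j)); rewrite ?E //; left; rewrite e; ring.
apply: (@lattice_sqr_cover _ _ X1 _ _ _ (2 * j)); rewrite ?E //; right.
have -> : (2 * B) ^+ 2 - 16 * (A * C) = 4 * (B ^+ 2 - 4 * (A * C)) by ring.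
by rewrite e; ring.
Qed.

Lemma generic_half2P t : t \in generic_half2 -> exists A B C : int,
  [/\ t = (2 * A + 2 * B + C, 6 * A - C, 2 * A - 2 * B + C), generic2 A B C, 0 <= B
    & in_range X (6 * A - C) ((2 * A + 2 * B + C) * (2 * A - 2 * B + C))].
Proof.
rewrite mem_filter mem_filter => /and3P[tn /andP[/lattice2P[A [B [C [te m0 n0 r]]]] k] _].
exists A, B, C; split=> //; last by move: k; rewrite te /key2 /=; lia.
split=> // j; apply/eqP=> e; case/negP: tn; rewrite te.
  by apply: (@lattice_sqr_cover _ _ X1 _ _ _ j) => //; left.
by apply: (@lattice_sqr_cover _ _ X1 _ _ _ j) => //; right.
Qed.

Lemma generic_classes_uniq :
  uniq ([seq class1 t | t <- generic_half1] ++ [seq class2 t | t <- generic_half2]).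
Proof.
rewrite cat_uniq; apply/and3P; split.
- rewrite map_inj_in_uniq; first by rewrite !filter_uniq ?box_uniq.
  move=> t u.
  move=> /generic_half1P[A [B [C [-> g AC _]]]] /generic_half1P[A' [B' [C' [-> g' AC' _]]]].
  rewrite class1E class1E => /(class_type1_inj g g')[eB eAC].
  have [eA eC] : A = A' /\ C = C' by clear -AC AC' eAC; lia.
  by rewrite eA eB eC.
- apply/hasPn=> _ /mapP[t /generic_half2P[A [B [C [-> g _ _]]]] ->]; rewrite class2E.
  apply/mapP=> -[u /generic_half1P[A' [B' [C' [-> g' _ _]]]]]; rewrite class1E => /esym.
  exact: class_type12_neq g' g.
- rewrite map_inj_in_uniq; first by rewrite !filter_uniq ?box_uniq.
  move=> t u.
  move=> /generic_half2P[A [B [C [-> g B0 _]]]] /generic_half2P[A' [B' [C' [-> g' B0' _]]]].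
  rewrite class2E class2E => /(class_type2_inj B0 B0' g g')[eA eB eC].
  by rewrite eA eB eC.
Qed.

Lemma generic_sub_counted G :
  G \in [seq class1 t | t <- generic_half1] ++ [seq class2 t | t <- generic_half2] ->
  counted_classes X G.
Proof.
rewrite mem_cat => /orP[] /mapP[t].
  move=> /generic_half1P[A [B [C [-> g _ r]]]] ->; rewrite class1E; exact: type1_counted.
by move=> /generic_half2P[A [B [C [-> g _ r]]]] ->; rewrite class2E; exact: type2_counted.
Qed.

Lemma size_generic (s : seq (int * int * int)) : uniq s ->
  (size s <= size [seq t <- s | t \notin sqr_cover K] + 4 * (2 * K).+1 ^ 3)%N.
Proof.
move=> us; rewrite -(size_sqr_cover K) -{1}(count_predC (fun t => t \notin sqr_cover K) s).
rewrite size_filter leq_add2l -size_filter; apply: uniq_leq_size; first exact: filter_uniq.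
by move=> t; rewrite mem_filter /= negbK => /andP[].
Qed.

(** With k = (2 K + 1)^3, the upper list adds one cover of size 4 k to each family and a box of size
    k for the third type; the lower list loses at most 4 k in each family. *)
Lemma N_count_half :
  (N_count X <= size (half1 X) + size (half2 X) + 9 * (2 * K).+1 ^ 3)%N /\
  (size (half1 X) + size (half2 X) <= N_count X + 8 * (2 * K).+1 ^ 3)%N.
Proof.
have u1 : uniq (half1 X) by rewrite filter_uniq ?box_uniq.
have u2 : uniq (half2 X) by rewrite filter_uniq ?box_uniq.
have [fin up] := leq_card_fset_set counted_sub; split.
  apply: leq_trans up _.
  have size3 (T U : Type) (f g h : T -> U) s1 s2 s3 s4 s5 :
      size (map f (s1 ++ s2) ++ map g (s3 ++ s4) ++ map h s5) =
      (size s1 + size s2 + (size s3 + size s4 + size s5))%N.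
    by rewrite !(size_cat, size_map).
  rewrite size3 size_sqr_cover size_box.
  by move: (size _) (size _) (_ ^ 3)%N => p q k; lia.
have := geq_card_fset_set fin generic_classes_uniq generic_sub_counted.
have size2 (T U : Type) (f g : T -> U) s1 s2 : size (map f s1 ++ map g s2) = (size s1 + size s2)%N.
  by rewrite size_cat !size_map.
rewrite size2 -/(N_count X).
have := size_generic u1; have := size_generic u2; rewrite -/generic_half1 -/generic_half2.
move: (N_count X) (size generic_half1) (size generic_half2) (size _) (size _) (_ ^ 3)%N.
by move=> c p' q' q p k; lia.
Qed.

(** 1263 = 13 + 10 * 125: the lattice error, then one k from the halving and nine from the
    exceptions, with k <= (5 sqrt X)^3. *)
Lemma N_count_error :
  `|(N_count X)%:R - 1 / 9 * (X * Num.sqrt X) * exp.ln X| <= 1263 * (X * Num.sqrt X).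
Proof.
have S1 := sqrt_ge1 X1; have SS := sqr_sqrt X1.
have := half_count X1; have [] := N_count_half; rewrite -/K.
set k := ((2 * K).+1 ^ 3)%N => h1 h2.
have k3 : k%:R <= 125 * (X * Num.sqrt X).
  have -> : 125 * (X * Num.sqrt X) = (5 * Num.sqrt X) ^+ 3 by rewrite -[Y in 125 * (Y * _)]SS; ring.
  have S0 : 0 <= 2 * Num.sqrt X by rewrite mulr_ge0 // sqrtr_ge0.
  have /andP[KX _] := truncn_itv S0; rewrite -/K in KX.
  rewrite /k natrX lerXn2r ?nnegrE ?ler0n //; first by lra.
  by rewrite -natr1 natrM; lra.
set u := X * _ in k3 *; set M := _ * exp.ln X; move: h1 h2.
move: (N_count X) (size (half1 X)) (size (half2 X)) k k3 => c p q k k3 h1 h2.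
have {}h1 : c%:R <= p%:R + q%:R + 9%:R * k%:R :> R by rewrite -natrM -!natrD ler_nat.
have {}h2 : p%:R + q%:R <= c%:R + 8%:R * k%:R :> R by rewrite -natrM -!natrD ler_nat.
by rewrite !ler_norml natrD => /andP[? ?]; apply/andP; split; lra.
Qed.

End Counting.

End ClassCount.

From mathcomp Require Import classical_sets topology normedtype exp.
Import numFieldNormedType.Exports ClassCount.

Theorem corollary1p3 (R : realType) :
  exists2 C : R, 0 < C &
    \forall X \near +oo_R,
      `|(N_count X)%:R - 1 / 9 * X `^ (3 / 2) * ln X| <= C * X `^ (3 / 2).
Proof.
(* The estimate is explicit and holds for every X >= 1. *)
exists 1263 => //; apply: filterS (nbhs_pinfty_ge (num_real (1 : R))) => X X1.
have X0 : 0 < X by apply: lt_le_trans X1.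
suff -> : X `^ (3 / 2) = X * Num.sqrt X by apply: N_count_error.
have -> : 3 / 2 = 1 + 2^-1 :> R by field.
by rewrite powRD ?(gt_eqF X0) ?implybT // powRr1 ?powR12_sqrt // ltW.
Qed.
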